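(* Let $n\ge 2$. The bilinear mapping $\mathcal{R}^t:(\Phi,\psi)\mapsto\mathcal{R}^t_\psi\Phi$, where $$\mathcal{R}^t_\psi\Phi(\mathbf{x})=\int_{\mathbb{S}^{n-1}}\int_0^\infty\int_{-\infty}^\infty\Phi(\mathbf{u},b,a)\,\frac1a\psi\left(\frac{\mathbf{x}\cdot\mathbf{u}-b}{a}\right)\frac{db\,da\,d\mathbf{u}}{a^n},\quad \mathbf{x}\in\mathbb{R}^n,$$ is the ridgelet synthesis operator, is a well-defined continuous mapping $\mathcal{R}^t:\mathcal{S}(\mathbb{Y}^{n+1})\times\mathcal{S}_0(\mathbb{R})\to\mathcal{S}_0(\mathbb{R}^n)$.
   Context: $\mathbb{S}^{n-1}$ is the unit sphere of $\mathbb{R}^n$ with surface measure $d\mathbf{u}$, $\mathbb{Y}^{n+1}=\mathbb{S}^{n-1}\times\mathbb{R}\times\mathbb{R}_+$ with points $(\mathbf{u},b,a)$, where $\mathbb{R}_+=(0,\infty)$. For $d\geq 1$, $\mathcal{S}_0(\mathbb{R}^d)$ is the closed subspace (with the subspace topology) of the Schwartz space $\mathcal{S}(\mathbb{R}^d)$ of those $\phi$ with $\int_{\mathbb{R}^d}\mathbf{x}^m\phi(\mathbf{x})d\mathbf{x}=0$ for all multi-indices $m\in\mathbb{N}_0^d$. $\mathcal{S}(\mathbb{Y}^{n+1})$ is the space of $\Phi\in C^\infty(\mathbb{Y}^{n+1})$ such that for all $l,m,k,s,r\in\mathbb{N}_0$ $$\rho^{l,m,k}_{s,r}(\Phi)=\sup_{(\mathbf{u},b,a)\in\mathbb{Y}^{n+1}}\left(a^s+\frac1{a^s}\right)(1+b^2)^{r/2}\left|\frac{\partial^l}{\partial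 a^l}\frac{\partial^m}{\partial b^m}\triangle_{\mathbf{u}}^k\Phi(\mathbf{u},b,a)\right|<\infty,$$ with the topology defined by these seminorms; $\triangle_{\mathbf{u}}$ is the Laplace–Beltrami operator on $\mathbb{S}^{n-1}$. *)

(* Defs.v *)
From HB Require Import structures.
From mathcomp Require Import all_boot all_order all_algebra.
From mathcomp Require Import complex.
From mathcomp Require Import all_classical all_reals all_analysis measurable_realfun.
From mathcomp Require Import ring lra.

Set Implicit Arguments.
Unset Strict Implicit.
Unset Printing Implicit Defensive.

Import Order.TTheory GRing.Theory Num.Theory.
Import numFieldNormedType.Exports.

Local Open Scope classical_set_scope.
Local Open Scope ring_scope.

Local Notation Re := (@complex.Re _).
Local Notation Im := (@complex.Im _).

Section Smooth.
Context {R : realType} {V : normedModType R}.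
Implicit Types (f g : V -> R) (U : set V) (s : seq V) (v x : V) (k : nat).

Fixpoint iter_derive s f : V -> R :=
  if s is v :: s' then 'D_v (iter_derive s' f) else f.

(* f is C^oo on the open set U: all its iterated directional derivatives
   (equivalently, partial derivatives) exist and are continuous on U. *)
Definition smooth_on U f := forall s x, U x ->
  {for x, continuous (iter_derive s f)} /\
  forall v, derivable (iter_derive s f) x v.

Let cd U f := forall x, U x ->
  {for x, continuous f} /\ forall v, derivable f x v.

#[local] Fixpoint ck k U f : Prop :=
  cd U f /\ if k is k'.+1 then forall v, ck k' U ('D_v f) else True.

Lemma iter_derive_rcons s v f :
  iter_derive (rcons s v) f = iter_derive s ('D_v f).
Proof. by elim: s => //= w s ->. Qed.

Lemma smooth_onD U f v : smooth_on U f -> smooth_on U ('D_v f).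
Proof. by move=> sf s x Ux; rewrite -iter_derive_rcons; exact: sf. Qed.

Let smooth_ck U f : smooth_on U f <-> forall k, ck k U f.
Proof.
split.
- move=> sf k; elim: k f sf => [|k IH] f sf /=; split; do ?exact: sf [::].
    by [].
  by move=> v; apply: IH; exact: smooth_onD.
- move=> cf s; have := cf (size s).
  elim/last_ind: s f {cf} => [|s v IH] f; first by case.
  by rewrite size_rcons iter_derive_rcons => -[_ /(_ v)]; exact: IH.
Qed.

Let cd_eq U f g : open U -> (forall x, U x -> f x = g x) -> cd U f -> cd U g.
Proof.
move=> oU fg cf x Ux; have [cfx dfx] := cf x Ux.
have nfg : \forall y \near x, f y = g y.
  by move: (open_nbhs_nbhs (conj oU Ux)); apply: filterS.
split; last by move=> v; exact: near_eq_derivable (dfx v).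
rewrite /prop_for /continuous_at -(fg x Ux); apply: cvg_trans cfx.
exact: near_eq_cvg.
Qed.

Let derive_eq U f g v : open U -> (forall x, U x -> f x = g x) ->
  forall x, U x -> 'D_v f x = 'D_v g x.
Proof.
move=> oU fg x Ux; apply: near_eq_derive.
by move: (open_nbhs_nbhs (conj oU Ux)); apply: filterS.
Qed.

Let ck_eq k U f g : open U -> (forall x, U x -> f x = g x) ->
  ck k U f -> ck k U g.
Proof.
move=> oU; elim: k f g => [|k IH] f g fg /= [cf df].
  by split; first exact: cd_eq oU fg cf.
split=> [|v]; first exact: cd_eq oU fg cf.
by apply: IH (df v); exact: derive_eq oU fg.
Qed.

Lemma smooth_on_eq U f g : open U -> (forall x, U x -> f x = g x) ->
  smooth_on U f -> smooth_on U g.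
Proof.
by move=> oU fg /smooth_ck cf; apply/smooth_ck => k; exact: ck_eq (cf k).
Qed.

Let cd_lin U f g (a b : R) : cd U f -> cd U g -> cd U (a *: f + b *: g).
Proof.
move=> cf cg x Ux; have [? df] := cf x Ux; have [? dg] := cg x Ux; split.
  by apply: continuousD; exact: continuousZr.
by move=> v; apply: derivableD; exact: derivableZ.
Qed.

Let ck_lin k U f g (a b : R) : open U -> ck k U f -> ck k U g ->
  ck k U (a *: f + b *: g).
Proof.
move=> oU; elim: k f g => [|k IH] f g /= [cf df] [cg dg].
  by split; first exact: cd_lin a b cf cg.
split=> [|v]; first exact: cd_lin a b cf cg.
apply: (@ck_eq _ U (a *: 'D_v f + b *: 'D_v g) _ oU); last first.
  exact: IH (df v) (dg v).
move=> x Ux; have [? dfx] := cf x Ux; have [? dgx] := cg x Ux.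
rewrite deriveD; [|exact: derivableZ..].
by rewrite !deriveZ.
Qed.

Lemma smooth_on_lin U f g (a b : R) : open U ->
  smooth_on U f -> smooth_on U g -> smooth_on U (a *: f + b *: g).
Proof.
move=> oU /smooth_ck cf /smooth_ck cg; apply/smooth_ck => k; exact: ck_lin.
Qed.

Let ckW k U f : ck k.+1 U f -> ck k U f.
Proof.
by elim: k f => [|k IH] f [cf df]; split => // v; apply: IH; exact: df.
Qed.

Let ckM k U f g : open U -> ck k U f -> ck k U g -> ck k U (f * g).
Proof.
move=> oU; have cM f' g' : cd U f' -> cd U g' -> cd U (f' * g').
  move=> cf cg x Ux; have [? df] := cf x Ux; have [? dg] := cg x Ux.
  by split=> [|v]; [exact: continuousM|exact: derivableM].
elim: k f g => [|k IH] f g Cf Cg.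
  by split; first exact: cM Cf.1 Cg.1.
have [[cf df] [cg dg]] := (Cf, Cg).
split; first exact: cM.
move=> v; apply: (@ck_eq _ U (1 *: (f * 'D_v g) + 1 *: (g * 'D_v f)) _ oU).
  move=> x Ux; have [? dfx] := cf x Ux; have [? dgx] := cg x Ux.
  by rewrite deriveM// !scale1r; exact: erefl.
exact: ck_lin oU (IH _ _ (ckW Cf) (dg v)) (IH _ _ (ckW Cg) (df v)).
Qed.

Lemma smooth_onM U f g : open U ->
  smooth_on U f -> smooth_on U g -> smooth_on U (f * g).
Proof. by move=> oU /smooth_ck cf /smooth_ck cg; apply/smooth_ck => k; exact: ckM. Qed.

Lemma smooth_on_cst U (c : R) : smooth_on U (cst c).
Proof.
have Dc v (d : R) : 'D_v (cst d : V -> R) = cst 0.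
  by apply/funext => x; rewrite derive_cst.
move=> s; elim/last_ind: s c => [|s v IH] c x Ux.
  by split=> [|v]; [exact: cst_continuous|exact: derivable_cst].
by rewrite iter_derive_rcons Dc; exact: IH.
Qed.

Lemma smooth_on_linear U f : linear f -> continuous f -> smooth_on U f.
Proof.
move=> lf cf.
have df x v : is_derive x v f (f v).
  have E : (fun h => h^-1 *: (f (h *: v + x) - f x)) @ 0^' --> f v.
    apply: cvg_near_cst; near=> h; rewrite lf addrK scalerA mulVf ?scale1r//.
    by near: h; exact: nbhs_dnbhs_neq.
  by split; [apply/cvg_ex; exists (f v)|exact/cvg_lim].
move=> s; elim/last_ind: s => [|s v _] x Ux /=.
  by split=> [|v]; [exact: cf|case: (df x v)].
rewrite iter_derive_rcons (_ : 'D_v f = cst (f v)); last first.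
  by apply/funext => y; rewrite derive_val.
exact: smooth_on_cst.
Unshelve. all: by end_near. Qed.

Lemma smooth_on_sqrt U f : open U -> smooth_on U f ->
  (forall x, U x -> 0 < f x) -> smooth_on U (fun x => Num.sqrt (f x)).
Proof.
move=> oU sf f0.
pose g x := (Num.sqrt (f x))^-1.
have cf : cd U f by exact: sf [::].
have dg x v : U x -> is_derive x v g (- 2^-1 * (g x ^+ 3 * 'D_v f x)).
  move=> Ux; have [cfx /(_ v) dfx] := cf x Ux.
  have fx0 := f0 x Ux.
  have s0 : Num.sqrt (f x) != 0 by rewrite sqrtr_eq0 -ltNge.
  pose l (h : R) := f (h *: v + x).
  have l0 : l 0 = f x by rewrite /l scale0r add0r.
  have dl : is_derive (0 : R) (1 : R) l ('D_v f x).
    split; first exact: (derivable1P f x v).1 dfx.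
    rewrite /derive /l /=; congr (lim (_ @ 0^')); apply/funext => h /=.
    by rewrite -[h%:A]/(h * 1) mulr1 addr0 scale0r add0r.
  have ds : is_derive (0 : R) (1 : R) (Num.sqrt \o l) ((2 * Num.sqrt (f x))^-1 * 'D_v f x).
    by apply: is_derive1_comp; rewrite l0; exact: is_derive1_sqrt.
  have dV : is_derive (0 : R) (1 : R) (fun y : R => (Num.sqrt (l y))^-1)
      (- (Num.sqrt (l 0)) ^- 2 *: ((2 * Num.sqrt (f x))^-1 * 'D_v f x)).
    by apply: is_deriveV ds; rewrite /= l0.
  have gE : 'D_v g x = 'D_(1 : R) (fun y : R => (Num.sqrt (l y))^-1) (0 : R).
    rewrite /derive /g /l /=; congr (lim (_ @ 0^')); apply/funext => h /=.
    by rewrite -[h%:A]/(h * 1) mulr1 addr0 scale0r add0r.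
  split; first by apply/derivable1P; case: dV.
  rewrite gE derive_val l0 /g /GRing.scale /=.
  by field.
have cg : cd U g.
  move=> x Ux; split=> [|v]; last by case: (dg x v Ux).
  have [cfx _] := cf x Ux; apply: continuousV.
    by rewrite sqrtr_eq0 -ltNge f0.
  exact: continuous_comp cfx (@sqrt_continuous _ _).
have sg : smooth_on U g.
  apply/smooth_ck; elim=> [|k IH]; split=> // v.
  apply: (@ck_eq _ _ (0 *: f + (- 2^-1) *: (g * (g * g) * 'D_v f))) => //.
    move=> x Ux; have [_ ->] := dg x v Ux.
    rewrite scale0r add0r -[LHS]/(- 2^-1 * (g x * (g x * g x) * 'D_v f x)).
    by rewrite !exprS expr0 mulr1.
  apply: ck_lin => //; first exact: (smooth_ck _ _).1 sf k.
  apply: ckM => //; first by apply: ckM => //; exact: ckM.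
  exact: (smooth_ck _ _).1 (smooth_onD v sf) k.
apply: (@smooth_on_eq U (f * g) _ oU); last exact: smooth_onM oU sf sg.
move=> x Ux; rewrite -[LHS]/(f x * g x) /g -{1}[f x]sqr_sqrtr ?ltW ?f0//.
by rewrite expr2 mulfK// sqrtr_eq0 -ltNge f0.
Qed.

End Smooth.

Section Complex.
Context {R : realType} {V : normedModType R}.
Implicit Types (f g : V -> R[i]) (U : set V) (v x : V) (c : R[i]).

Definition csmooth_on U f :=
  smooth_on U (Re \o f) /\ smooth_on U (Im \o f).

Definition cderive v f : V -> R[i] :=
  fun x => Complex ('D_v (Re \o f) x) ('D_v (Im \o f) x).

Lemma Re_lin c f g : Re \o (c *: f + g) =
  1 *: (Re c *: (Re \o f) + (- Im c) *: (Im \o f))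
  + 1 *: (Re \o g).
Proof.
apply/funext => x; rewrite /= !scale1r /=.
rewrite -[RHS]/(Re c * Re (f x)
  + - Im c * Im (f x) + Re (g x)).
rewrite -[(c *: f + g) x]/(c * f x + g x).
by case: (f x) => a b; case: (g x) => a' b'; case: c => a'' b'' /=; rewrite mulNr.
Qed.

Lemma Im_lin c f g : Im \o (c *: f + g) =
  1 *: (Re c *: (Im \o f) + Im c *: (Re \o f))
  + 1 *: (Im \o g).
Proof.
apply/funext => x; rewrite /= !scale1r /=.
rewrite -[RHS]/(Re c * Im (f x)
  + Im c * Re (f x) + Im (g x)).
rewrite -[(c *: f + g) x]/(c * f x + g x).
by case: (f x) => a b; case: (g x) => a' b'; case: c => a'' b'' /=.
Qed.

Lemma csmooth_on_lin U c f g : open U ->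
  csmooth_on U f -> csmooth_on U g -> csmooth_on U (c *: f + g).
Proof.
move=> oU [rf jf] [rg jg].
split; [rewrite Re_lin|rewrite Im_lin].
  by apply: (smooth_on_lin _ _ oU _ rg); exact: (smooth_on_lin _ _ oU rf jf).
by apply: (smooth_on_lin _ _ oU _ jg); exact: (smooth_on_lin _ _ oU jf rf).
Qed.

Lemma csmooth_on_cst U c : csmooth_on U (cst c).
Proof. by split; exact: smooth_on_cst. Qed.

Lemma csmooth_on_eq U f g : open U -> (forall x, U x -> f x = g x) ->
  csmooth_on U f -> csmooth_on U g.
Proof.
by move=> oU fg [rf jf]; split; [apply: smooth_on_eq rf|apply: smooth_on_eq jf];
  rewrite // => x Ux /=; rewrite fg.
Qed.

Lemma csmooth_on_cderive U v f : csmooth_on U f -> csmooth_on U (cderive v f).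
Proof. by move=> [rf jf]; split; exact: smooth_onD. Qed.

Lemma cderive_lin U c f g v x : open U -> U x ->
  csmooth_on U f -> csmooth_on U g ->
  cderive v (c *: f + g) x = c * cderive v f x + cderive v g x.
Proof.
move=> oU Ux [rf jf] [rg jg].
have D h : smooth_on U h -> derivable h x v by case/(_ [::] x Ux) => _ /(_ v).
have L (a b : R) (h1 h2 h3 : V -> R) :
    derivable h1 x v -> derivable h2 x v -> derivable h3 x v ->
    'D_v (1 *: (a *: h1 + b *: h2) + 1 *: h3) x =
    a * 'D_v h1 x + b * 'D_v h2 x + 'D_v h3 x.
  move=> d1 d2 d3; rewrite !scale1r.
  have e1 : derivable (a *: h1) x v by exact: derivableZ.
  have e2 : derivable (b *: h2) x v by exact: derivableZ.
  have e12 : derivable (a *: h1 + b *: h2) x v by exact: derivableD.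
  by rewrite (deriveD e12 d3) (deriveD e1 e2) (deriveZ a d1) (deriveZ b d2).
have [[[drf djf] drg] djg] := (D _ rf, D _ jf, D _ rg, D _ jg).
rewrite /cderive Re_lin Im_lin L// L//.
apply/eqP; rewrite eq_complex /=; apply/andP; split; apply/eqP.
  by case: c => a b /=; rewrite mulNr.
by case: c => a b /=.
Qed.

End Complex.

Section ComplexIntegral.
Context d (T : measurableType d) {R : realType}.
Variable mu : {measure set T -> \bar R}.
Implicit Types (D : set T) (f g : T -> R[i]).

Definition cintegrable D f :=
  mu.-integrable D (fun x => (Re (f x))%:E) /\
  mu.-integrable D (fun x => (Im (f x))%:E).

Definition cintegral D f : R[i] :=
  Complex (\int[mu]_(x in D) Re (f x)) (\int[mu]_(x in D) Im (f x)).

Lemma Re_linE (a z w : R[i]) : Re (a * z + w) =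
  Re a * Re z + - Im a * Im z + Re w.
Proof. by case: z => ? ?; case: a => ? ?; case: w => ? ? /=; rewrite mulNr. Qed.

Lemma Im_linE (a z w : R[i]) : Im (a * z + w) =
  Re a * Im z + Im a * Re z + Im w.
Proof. by case: z => ? ?; case: a => ? ?; case: w => ? ?. Qed.

Lemma cintegral_lin D (c : R[i]) f g : measurable D ->
  cintegrable D f -> cintegrable D g ->
  cintegrable D (fun x => c * f x + g x) /\
  cintegral D (fun x => c * f x + g x) = c * cintegral D f + cintegral D g.
Proof.
move=> mD [rf jf] [rg jg].
have Z (a : R) (h : T -> R) : mu.-integrable D (EFin \o h) ->
    mu.-integrable D (EFin \o (fun x => a * h x)).
  by move=> ih; exact: (@integrableZl _ _ _ mu _ mD a _ ih).
have A (h1 h2 : T -> R) : mu.-integrable D (EFin \o h1) ->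
    mu.-integrable D (EFin \o h2) ->
    mu.-integrable D (EFin \o (fun x => h1 x + h2 x)).
  by move=> i1 i2; exact: (@integrableD _ _ _ mu _ mD _ _ i1 i2).
have := (Z (Re c) _ rf, Z (Re c) _ jf,
  Z (Im c) _ rf, Z (- Im c) _ jf) => -[[[z1 z2] z3] z4].
split.
  split.
    rewrite (_ : (fun x => _) = EFin \o (fun x => Re c * Re (f x)
      + - Im c * Im (f x) + Re (g x))).
      by apply: (A (fun x => _ + _)) => //; exact: A.
    by apply/funext => x /=; rewrite Re_linE.
  rewrite (_ : (fun x => _) = EFin \o (fun x => Re c * Im (f x)
    + Im c * Re (f x) + Im (g x))).
    by apply: (A (fun x => _ + _)) => //; exact: A.
  by apply/funext => x /=; rewrite Im_linE.
apply/eqP; rewrite eq_complex; apply/andP; split; apply/eqP.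
  rewrite Re_linE /=.
  under eq_Rintegral do rewrite Re_linE.
  rewrite RintegralD//; last exact: A.
  by rewrite RintegralD// !RintegralZl.
rewrite Im_linE /=.
under eq_Rintegral do rewrite Im_linE.
rewrite RintegralD//; last exact: A.
by rewrite RintegralD// !RintegralZl.
Qed.

End ComplexIntegral.

(* The sigma-algebra on R^n is generated by the coordinates, i.e. it is the
   product (Borel) sigma-algebra, as for [n.-tuple]. *)
Fact rV_display : measure_display. Proof. exact: default_measure_display. Qed.

Section rV_measurable.
Context {R : realType}.
Variable n : nat.

Let coord (i : 'I_n) (x : 'rV[R]_n) : R := x ord0 i.

Let rV_set0 : g_sigma_preimage coord set0.
Proof. exact: sigma_algebra0. Qed.

Let rV_setC A : g_sigma_preimage coord A -> g_sigma_preimage coord (~` A).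
Proof. exact: sigma_algebraC. Qed.

Let rV_bigcup (F : (set 'rV[R]_n)^nat) : (forall i, g_sigma_preimage coord (F i)) ->
  g_sigma_preimage coord (\bigcup_i (F i)).
Proof. exact: sigma_algebra_bigcup. Qed.

HB.instance Definition _ := @isMeasurable.Build rV_display
  'rV[R]_n (g_sigma_preimage coord) rV_set0 rV_setC rV_bigcup.

Lemma measurable_coord (i : 'I_n) :
  measurable_fun [set: 'rV[R]_n] (fun x : 'rV[R]_n => x ord0 i).
Proof.
move=> _ Y mY; rewrite setTI; apply: sub_sigma_algebra => /=.
rewrite -bigcup_seq/=; exists i => /=; first by rewrite mem_index_enum.
by exists Y => //; rewrite setTI.
Qed.

Lemma measurable_fun_rV d (T : measurableType d) (f : T -> 'rV[R]_n) :
  (forall i, measurable_fun [set: T] (fun t => f t ord0 i)) ->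
  measurable_fun [set: T] f.
Proof.
move=> mf.
have sub : preimage_set_system [set: T] f (g_sigma_preimage coord) `<=` measurable.
  rewrite -g_sigma_preimage_comp.
  apply: smallest_sub; first exact: sigma_algebra_measurable.
  rewrite -bigcup_seq; apply: bigcup_sub => i _ A [B mB <-].
  exact: mf.
by move=> _ A mA; apply: sub; exists A.
Qed.

End rV_measurable.

Definition consrV {R : realType} {n} (p : R * 'rV[R]_n) : 'rV[R]_n.+1 :=
  \row_i if unlift ord0 i is Some j then p.2 ord0 j else p.1.

Lemma measurable_consrV {R : realType} n :
  measurable_fun [set: 'rV[R]_n * R] (fun p => consrV (p.2, p.1)).
Proof.
apply: measurable_fun_rV => i; rewrite /consrV.
under eq_fun do rewrite mxE /=.
case: unliftP => [j _|_]; last exact: measurable_snd.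
by apply: (measurableT_comp (@measurable_coord R n j)); exact: measurable_fst.
Qed.

(* n-dimensional Lebesgue measure (on Borel sets): the n-fold product of the
   one-dimensional Lebesgue measure. *)
Fixpoint lebesgue_rV {R : realType} (n : nat) :
    {measure set 'rV[R]_n -> \bar R} :=
  match n with
  | 0 => \d_ (0 : 'rV[R]_0)
  | n'.+1 =>
    measure_function_pushforward__canonical__measure_function_Measure
      (lebesgue_rV n' \x lebesgue_measure)%E (@measurable_consrV R n')
  end.

Section Sphere.
Context {R : realType} {n : nat}.
Implicit Types (x u : 'rV[R]_n).

Definition dotrV x u : R := \sum_i x ord0 i * u ord0 i.

Definition normrV x : R := Num.sqrt (dotrV x x).

Definition sphere : set 'rV[R]_n := [set u | normrV u = 1].

Definition to_sphere x : 'rV[R]_n := (normrV x)^-1 *: x.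

Lemma measurable_normrV : measurable_fun [set: 'rV[R]_n] normrV.
Proof.
apply: (measurableT_comp (f := @Num.sqrt R)).
  by apply: continuous_measurable_fun; exact: sqrt_continuous.
apply: measurable_sum => i.
by apply: measurable_funM; exact: measurable_coord.
Qed.

Lemma measurable_to_sphere : measurable_fun [set: 'rV[R]_n] to_sphere.
Proof.
apply: measurable_fun_rV => i; rewrite /to_sphere.
under eq_fun do rewrite mxE -powR_inv1 ?sqrtr_ge0//.
apply: measurable_funM; last exact: measurable_coord.
by apply: (measurableT_comp (measurable_powR (-1))); exact: measurable_normrV.
Qed.

Lemma measurable_punctured_ball : measurable [set x | 0 < normrV x <= 1].
Proof.
rewrite (_ : [set x | _] = normrV @^-1` `]0, 1]); last first.
  by apply/seteqP; split=> x; rewrite /= in_itv.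
rewrite -[X in measurable X]setTI.
exact: measurable_normrV.
Qed.

(* The surface measure of the unit sphere as the cone measure
   sigma(A) = n |{x : 0 < |x| <= 1, x/|x| in A}|, which is the measure of the
   polar coordinates formula; it is carried by [sphere]. *)
Definition surface_measure : {measure set 'rV[R]_n -> \bar R} :=
  mscale (n%:R%:nng : {nonneg R})
    (measure_function_pushforward__canonical__measure_function_Measure
      (mrestr (lebesgue_rV n) measurable_punctured_ball) measurable_to_sphere).

End Sphere.
Arguments sphere {R} n.
Arguments surface_measure {R} n.

Section LinOn.
Context {K : nzRingType} {E : lmodType K}.
Variable S : set E.

Definition lin_on (O : E -> E) := forall c f g, S f -> S g ->
  S (O f) /\ O (c *: f + g) = c *: O f + O g.

Lemma lin_on_id : lin_on id. Proof. by []. Qed.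

Lemma lin_on_comp O1 O2 : lin_on O1 -> lin_on O2 -> lin_on (O1 \o O2).
Proof.
move=> l1 l2 c f g Sf Sg /=.
have [Sf2 ->] := l2 c f g Sf Sg; have [Sg2 _] := l2 c g f Sg Sf.
exact: l1.
Qed.

Lemma lin_on_iter k O : lin_on O -> lin_on (iter k O).
Proof.
by move=> l; elim: k => [|k IH]; [exact: lin_on_id|exact: lin_on_comp].
Qed.

Lemma lin_on_foldr (I : Type) (s : seq I) (O : I -> E -> E) :
  (forall i, lin_on (O i)) -> lin_on (fun f => foldr O f s).
Proof.
by move=> l; elim: s => [|i s IH]; [exact: lin_on_id|exact: lin_on_comp].
Qed.

Lemma lin_on_sum (I : finType) (O : I -> E -> E) : S 0 ->
  (forall c f g, S f -> S g -> S (c *: f + g)) ->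
  (forall i, lin_on (O i)) -> lin_on (fun f => \sum_i O i f).
Proof.
move=> S0 Slin l c f g Sf Sg; split.
  elim/big_rec: _ => // i h _ Sh.
  by rewrite -[(O i f)]scale1r; apply: Slin => //; have [] := l i c f g Sf Sg.
rewrite scaler_sumr -big_split /=; apply: eq_bigr => i _.
by have [] := l i c f g Sf Sg.
Qed.

End LinOn.

Local Notation cabs := Normc.normc.

Section SupNorm.
Context {R : realType} {T : Type}.
Implicit Types (w : T -> R) (f g : T -> R[i]).

Definition wsup w f : \bar R :=
  ereal_sup [set (w x * cabs (f x))%:E | x in [set: T]].

Let wsupP w f : (wsup w f < +oo)%E <-> exists M : R, forall x, w x * cabs (f x) <= M.
Proof.
split=> [|[M hM]]; last first.
  apply: (@le_lt_trans _ _ M%:E); last exact: ltry.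
  by apply: ge_ereal_sup => _ [x _ <-]; rewrite lee_fin.
have ub x : ((w x * cabs (f x))%:E <= wsup w f)%E.
  by apply: ereal_sup_ubound; exists x.
case: (wsup w f) ub => [r| |] ub // _.
- by exists r => x; rewrite -lee_fin.
- by exists 0 => x; have := ub x; rewrite leeNy_eq.
Qed.

Lemma wsup0 w : (wsup w (0%R : T -> R[i]) < +oo)%E.
Proof.
apply/wsupP; exists 0 => x.
by rewrite (_ : (0 : T -> R[i]) x = 0)// Normc.normc0 mulr0.
Qed.

Lemma wsup_lin w (c : R[i]) f g : (forall x, 0 <= w x) ->
  (wsup w f < +oo -> wsup w g < +oo -> wsup w (c *: f + g)%R < +oo)%E.
Proof.
move=> w0 /wsupP[M hM] /wsupP[N hN].
apply/wsupP; exists (cabs c * M + N) => x.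
have c0 : 0 <= cabs c by case: (c) => a b; exact: sqrtr_ge0.
rewrite -[(c *: f + g) x]/(c * f x + g x).
apply: (@le_trans _ _ (w x * (cabs c * cabs (f x) + cabs (g x)))).
  by apply: ler_wpM2l => //; rewrite -Normc.normcM; exact: le_normcD.
rewrite mulrDr; apply: lerD => //.
by rewrite mulrCA; apply: ler_wpM2l.
Qed.

End SupNorm.

(* Basic open sets of the locally convex topology given by a family [p] of
   seminorms; they form a subbase of that topology. *)
Definition seminorm_balls {R : realType} {E : zmodType} {I : Type}
    (p : I -> E -> \bar R) : set (set E) :=
  [set B | exists (f : E) (i : I) (e : R),
     0 < e /\ B = [set g | (p i (g - f)%R < e%:E)%E]].

Section Schwartz.
Context {R : realType}.
Variable n : nat.
Implicit Types (f g : 'rV[R]_n -> R[i]) (m : {ffun 'I_n -> nat}).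

Definition monomial m (x : 'rV[R]_n) : R := \prod_i x ord0 i ^+ m i.

Definition pderive m f : 'rV[R]_n -> R[i] :=
  foldr (fun i => iter (m i) (cderive (delta_mx ord0 i))) f (enum 'I_n).

Definition schwartz_seminorm (i : {ffun 'I_n -> nat} * {ffun 'I_n -> nat}) f :
    \bar R :=
  wsup (fun x => `|monomial i.1 x|) (pderive i.2 f).

Definition is_schwartz : set ('rV[R]_n -> R[i]) :=
  [set f | csmooth_on setT f /\ forall i, (schwartz_seminorm i f < +oo)%E].

Lemma pderive_lin m : lin_on (csmooth_on setT) (pderive m).
Proof.
apply: lin_on_foldr => i; apply: lin_on_iter => c f g sf sg.
split; first exact: csmooth_on_cderive.
apply/funext => x; exact: (cderive_lin c _ openT I sf sg).
Qed.

Lemma is_schwartz_lin c f g : is_schwartz f -> is_schwartz g ->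
  is_schwartz (c *: f + g).
Proof.
move=> [sf pf] [sg pg]; split; first exact: (csmooth_on_lin c openT sf sg).
move=> i; rewrite /schwartz_seminorm (pderive_lin i.2 c sf sg).2.
by apply: wsup_lin; [move=> x; exact: normr_ge0|exact: pf|exact: pg].
Qed.

Lemma is_schwartz0 : is_schwartz 0.
Proof.
have s0 : csmooth_on setT (0 : 'rV[R]_n -> R[i]) by exact: csmooth_on_cst.
split=> // i; rewrite /schwartz_seminorm.
have := (pderive_lin i.2 (-1) s0 s0).2.
rewrite !scaleN1r !addNr => ->; exact: wsup0.
Qed.

Definition schwartz_pred : {pred 'rV[R]_n -> R[i]} := mem is_schwartz.

Lemma schwartz_submod_closed : submod_closed schwartz_pred.
Proof.
split; first by apply/mem_set; exact: is_schwartz0.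
by move=> c f g /set_mem sf /set_mem sg; apply/mem_set; exact: is_schwartz_lin.
Qed.

HB.instance Definition _ :=
  GRing.isSubmodClosed.Build R[i] ('rV[R]_n -> R[i]) schwartz_pred
    schwartz_submod_closed.

Record schwartz := Schwartz {
  schwartz_fun :> 'rV[R]_n -> R[i];
  schwartz_funP : schwartz_fun \in schwartz_pred }.

HB.instance Definition _ := [isSub for schwartz_fun].
HB.instance Definition _ := [Choice of schwartz by <:].
HB.instance Definition _ := [SubChoice_isSubLmodule of schwartz by <:].

HB.instance Definition _ := @isSubBaseTopological.Build schwartz
  (set schwartz)
  (seminorm_balls (fun i (f : schwartz) => schwartz_seminorm i f)) id.

End Schwartz.
Arguments schwartz R n : clear implicits.

Section Schwartz0.
Context {R : realType}.
Variable n : nat.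

(* All moments exist (which is automatic for Schwartz functions) and vanish. *)
Definition vanishing_moments : set (schwartz R n) :=
  [set f | forall m : {ffun 'I_n -> nat},
    cintegrable (lebesgue_rV n) setT
      (fun x => (monomial m x)%:C%C * f x) /\
    cintegral (lebesgue_rV n) setT
      (fun x => (monomial m x)%:C%C * f x) = 0].

Definition schwartz0_pred : {pred schwartz R n} := mem vanishing_moments.

Lemma schwartz0_submod_closed : submod_closed schwartz0_pred.
Proof.
split.
  apply/mem_set => m.
  rewrite (_ : (fun x => _) = fun x : 'rV[R]_n => 0 : R[i]); last first.
    by apply/funext => x; rewrite [X in _ * X](_ : _ = 0)// mulr0.
  split; first by split; exact: integrable0.
  apply/eqP; rewrite eq_complex /= /Rintegral integral0 //=.
  by rewrite eqxx.
move=> c f g /set_mem vf /set_mem vg; apply/mem_set => m.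
have [[i1 e1] [i2 e2]] := (vf m, vg m).
have [i3 e3] := cintegral_lin c measurableT i1 i2.
rewrite (_ : (fun x => _) = (fun x =>
  c * ((monomial m x)%:C%C * f x) + (monomial m x)%:C%C * g x)); last first.
  apply/funext => x.
  rewrite -[(c *: f + g) x]/(c * f x + g x).
  by rewrite mulrDr mulrCA.
by rewrite e3 e1 e2 mulr0 addr0.
Qed.

HB.instance Definition _ :=
  GRing.isSubmodClosed.Build R[i] (schwartz R n) schwartz0_pred
    schwartz0_submod_closed.

Record schwartz0 := Schwartz0 {
  schwartz0_val :> schwartz R n;
  schwartz0_valP : schwartz0_val \in schwartz0_pred }.

HB.instance Definition _ := [isSub for schwartz0_val].
HB.instance Definition _ := [Choice of schwartz0 by <:].
HB.instance Definition _ := [SubChoice_isSubLmodule of schwartz0 by <:].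

HB.instance Definition _ :=
  Topological.copy schwartz0 (initial_topology schwartz0_val).

End Schwartz0.
Arguments schwartz0 R n : clear implicits.

Section SpaceY.
Context {R : realType}.
Variable n : nat.
Local Notation ambient := ('rV[R]_n * R * R)%type.
Implicit Types (y v : ambient) (k l m : nat).

(* Y^{n+1} = S^{n-1} x R x R_+, whose points are (u, b, a). *)
Definition spaceY := {y : ambient | (normrV y.1.1 == 1) && (0 < y.2)}.
Implicit Types (F G : spaceY -> R[i]).

(* A function on Y^{n+1} is extended to (R^n \ 0) x R x R_+ as a function of
   (x/|x|, b, a); the extension is 0 elsewhere. *)
Definition extY F y : R[i] :=
  if insub (to_sphere y.1.1, y.1.2, y.2) is Some z then F z else 0.

Definition domY : set ambient := [set y | y.1.1 != 0 /\ 0 < y.2].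

Definition smoothY F := csmooth_on domY (extY F).

Definition deriveY v F : spaceY -> R[i] := fun z => cderive v (extY F) (val z).

Definition derive_u (i : 'I_n) := deriveY (delta_mx ord0 i, 0, 0).
Definition derive_b := deriveY (0, 1, 0).
Definition derive_a := deriveY (0, 0, 1).

(* [derive_u i F] is the i-th component of the gradient of F on the sphere, and
   the divergence on the sphere of a tangent field X is the sum of the
   [derive_u i (X i)]: this is div grad in the variable u. *)
Definition laplace_beltrami F : spaceY -> R[i] :=
  \sum_i derive_u i (derive_u i F).

Definition seminormY (i : nat * nat * nat * nat * nat) F : \bar R :=
  let: (l, m, k, s, r) := i in
  wsup (fun z : spaceY =>
          let b := (val z).1.2 in let a := (val z).2 in
          (a ^+ s + (a ^+ s)^-1) * (1 + b ^+ 2) `^ (r%:R / 2))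
       (iter l derive_a (iter m derive_b (iter k laplace_beltrami F))).

Definition is_schwartzY : set (spaceY -> R[i]) :=
  [set F | smoothY F /\ forall i, (seminormY i F < +oo)%E].

Let dotrV_gt0 (x : 'rV[R]_n) : x != 0 -> 0 < dotrV x x.
Proof.
move=> /rV0Pn[i xi]; rewrite /dotrV (bigD1 i)//=.
rewrite ltr_pwDl// -?expr2 ?exprn_even_gt0//.
by apply: sumr_ge0 => j _; rewrite -expr2 sqr_ge0.
Qed.

Let normrV_gt0 (x : 'rV[R]_n) : x != 0 -> 0 < normrV x.
Proof. by move=> x0; rewrite sqrtr_gt0 dotrV_gt0. Qed.

Let normrVZ (t : R) (x : 'rV[R]_n) : 0 <= t -> normrV (t *: x) = t * normrV x.
Proof.
move=> t0; rewrite /normrV (_ : dotrV _ _ = t ^+ 2 * dotrV x x).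
  by rewrite sqrtrM ?sqr_ge0// sqrtr_sqr ger0_norm.
by rewrite /dotrV mulr_sumr; apply: eq_bigr => i _; rewrite !mxE; ring.
Qed.

Let to_sphereZ (t : R) (x : 'rV[R]_n) : 0 < t -> to_sphere (t *: x) = to_sphere x.
Proof.
move=> t0; rewrite /to_sphere normrVZ ?ltW// scalerA invfM mulrAC mulVf ?mul1r//.
exact: lt0r_neq0.
Qed.

Let extYZ F (t : R) (x : 'rV[R]_n) b a : 0 < t ->
  extY F (t *: x, b, a) = extY F (x, b, a).
Proof. by move=> t0; rewrite /extY /= to_sphereZ. Qed.

Let normrV_to_sphere (x : 'rV[R]_n) : x != 0 -> normrV (to_sphere x) = 1.
Proof.
move=> x0; rewrite normrVZ ?invr_ge0 ?sqrtr_ge0// mulVf//.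
by rewrite lt0r_neq0 ?normrV_gt0.
Qed.

Let domY_val (z : spaceY) : domY (val z).
Proof.
case: z => -[[u b] a] /= /andP[/eqP u1 a0]; split => //=.
apply/eqP => u0; move: u1; rewrite u0 /normrV /dotrV big1 ?sqrtr0.
  by move/eqP; rewrite eq_sym oner_eq0.
by move=> i _; rewrite mxE mul0r.
Qed.

Let extY_dom F y : domY y ->
  exists2 z : spaceY, extY F y = F z & val z = (to_sphere y.1.1, y.1.2, y.2).
Proof.
case: y => -[x b] a [/= x0 a0]; rewrite /extY /=.
case: insubP => [z _ <-|]; first by exists z.
by rewrite /= normrV_to_sphere// eqxx a0.
Qed.

Let extY_lin c F G : extY (c *: F + G) = c *: extY F + extY G.
Proof.
apply/funext => y; rewrite /extY.
rewrite -[RHS]/(c * extY F y + extY G y) /extY.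
case: insub => [z|]; first by [].
by rewrite mulr0 addr0.
Qed.

Let open_domY : open domY.
Proof.
have c1 : continuous (fun y : ambient => y.1.1).
  by move=> y; apply: (@cvg_comp _ _ _ fst fst); exact: cvg_fst.
have c2 : continuous (fun y : ambient => y.2) by move=> y; exact: cvg_snd.
rewrite (_ : domY = (fun y : ambient => y.1.1) @^-1` (~` [set 0]) `&`
    (fun y : ambient => y.2) @^-1` [set x : R | 0 < x]); last first.
  by apply/seteqP; split=> y [/= /eqP ? ?].
apply: openI.
  apply: (proj1 (continuousP _) c1); apply: closed_openC.
  exact: (accessible_closed_set1 (hausdorff_accessible (@norm_hausdorff _ _))).
apply: (proj1 (continuousP _) c2); exact: open_gt.
Qed.

Lemma smoothY_lin c F G : smoothY F -> smoothY G -> smoothY (c *: F + G).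
Proof.
move=> sF sG; rewrite /smoothY extY_lin.
exact: (csmooth_on_lin c open_domY sF sG).
Qed.

Let csmooth_on_scale (U : set ambient) (h : ambient -> R) (f : ambient -> R[i]) :
  open U -> smooth_on U h -> csmooth_on U f ->
  csmooth_on U (fun x => (h x)%:C%C * f x).
Proof.
move=> oU sh [rf jf]; split.
  rewrite (_ : _ \o _ = h * (Re \o f)); first exact: (smooth_onM oU sh rf).
  apply/funext => x /=; rewrite -[RHS]/(h x * Re (f x)).
  by case: (f x) => p q /=; rewrite mul0r subr0.
rewrite (_ : _ \o _ = h * (Im \o f)); first exact: (smooth_onM oU sh jf).
apply/funext => x /=; rewrite -[RHS]/(h x * Im (f x)).
by case: (f x) => p q /=; rewrite mul0r addr0.
Qed.

Let smooth_normrV : smooth_on domY (fun y : ambient => normrV y.1.1).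
Proof.
apply: (@smooth_on_sqrt _ _ domY (fun y : ambient => dotrV y.1.1 y.1.1)) => //.
- rewrite (_ : (fun y => _) =
    \sum_i ((fun y : ambient => y.1.1 ord0 i) * (fun y : ambient => y.1.1 ord0 i))).
    elim/big_rec : _ => [|i h _ sh]; first exact: smooth_on_cst.
    rewrite -[X in X + _]scale1r -[X in _ + X]scale1r.
    have sc : smooth_on domY (fun y : ambient => y.1.1 ord0 i).
      apply: smooth_on_linear; first by move=> c y z /=; rewrite !mxE.
      move=> y; apply: (@continuous_comp _ _ _ (fun y : ambient => y.1.1)
        (fun x : 'rV[R]_n => x ord0 i)); last exact: coord_continuous.
      by apply: cvg_comp; exact: cvg_fst.
    exact: (smooth_on_lin 1 1 open_domY (smooth_onM open_domY sc sc) sh).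
  by apply/funext => y; rewrite fct_sumE.
- by move=> y [y0 _]; exact: dotrV_gt0.
Qed.

Let deriveZdir (f : ambient -> R) y v (t : R) : t != 0 ->
  derivable f y v -> 'D_(t *: v) f y = t * 'D_v f y.
Proof.
move=> t0 df; pose l (h : R) := f (h *: v + y).
have dl : is_derive (0 : R) (1 : R) l ('D_v f y).
  split; first exact: (derivable1P f y v).1 df.
  rewrite /derive /l /=; congr (lim (_ @ 0^')); apply/funext => h /=.
  by rewrite -[h%:A]/(h * 1) mulr1 addr0 scale0r add0r.
have dt : is_derive (0 : R) (1 : R) (fun h : R => t * h) t.
  rewrite -[X in is_derive _ _ _ X]mulr1.
  exact: is_deriveZ.
have := @is_derive1_comp _ l (fun h : R => t * h) 0 ('D_v f y) t.
rewrite mulr0 => /(_ dl dt)[_].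
rewrite mulrC => <-.
rewrite /derive /l /=; congr (lim (_ @ 0^')); apply/funext => h /=.
rewrite -[h%:A]/(h * 1) mulr1 addr0 mulr0 scale0r add0r.
by rewrite scalerA mulrC.
Qed.

Let deriveY_u F (w : 'rV[R]_n) y : smoothY F -> domY y ->
  extY (deriveY (w, 0, 0) F) y =
  (normrV y.1.1)%:C%C * cderive (w, 0, 0) (extY F) y.
Proof.
move=> [rF jF] Uy; have [z -> zE] := extY_dom (deriveY (w, 0, 0) F) Uy.
case: y Uy zE => -[x b] a Uy /= zE.
have x0 : 0 < normrV x by case: Uy => /= x0 _; exact: normrV_gt0.
have x'0 := lt0r_neq0 x0.
have key (q : R[i] -> R) : smooth_on domY (q \o extY F) ->
    'D_((w, 0, 0) : ambient) (q \o extY F) (val z) =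
    normrV x * 'D_((w, 0, 0) : ambient) (q \o extY F) (x, b, a).
  move=> sq; rewrite [val z]zE -deriveZdir//; last first.
    exact: (sq [::] _ Uy).2.
  rewrite /derive /=; congr (lim (_ @ 0^')); apply/funext => h /=.
  rewrite !extYZ ?invr_gt0//.
  congr (_ *: (q _ - _)).
  rewrite -[LHS]/(extY F (h *: w + (normrV x)^-1 *: x, h *: 0 + b, h *: 0 + a)).
  rewrite -[RHS]/(extY F (h *: (normrV x *: w) + x,
    h *: (normrV x *: 0) + b, h *: (normrV x *: 0) + a)).
  rewrite !scaler0 -(extYZ F _ _ _ x0) scalerDr !scalerA mulfV// scale1r.
  by rewrite (mulrC h).
rewrite /deriveY /cderive key// key//.
by apply/eqP; rewrite eq_complex /= !mul0r subr0 addr0 !eqxx.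
Qed.

Let deriveY_ba F (s t : R) y : domY y ->
  extY (deriveY (0, s, t) F) y = cderive (0, s, t) (extY F) y.
Proof.
move=> Uy; have [z -> zE] := extY_dom (deriveY (0, s, t) F) Uy.
case: y Uy zE => -[x b] a Uy /= zE.
have x0 : 0 < normrV x by case: Uy => /= x0 _; exact: normrV_gt0.
have key (q : R[i] -> R) :
    'D_((0, s, t) : ambient) (q \o extY F) (val z) =
    'D_((0, s, t) : ambient) (q \o extY F) (x, b, a).
  have i0 : 0 < (normrV x)^-1 by rewrite invr_gt0.
  have E (h : R) : extY F (h *: ((0, s, t) : ambient) + (to_sphere x, b, a)) =
      extY F (h *: ((0, s, t) : ambient) + (x, b, a)).
    rewrite -[LHS]/(extY F (h *: 0 + to_sphere x, h *: s + b, h *: t + a)).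
    rewrite -[RHS]/(extY F (h *: 0 + x, h *: s + b, h *: t + a)).
    by rewrite scaler0 !add0r (extYZ F x _ _ i0).
  have E0 : extY F (to_sphere x, b, a) = extY F (x, b, a) by exact: extYZ.
  rewrite [val z]zE /derive; congr (lim (_ @ 0^')); apply/funext => h.
  rewrite -[LHS]/(h^-1 *: (q (extY F (h *: ((0, s, t) : ambient)
    + (to_sphere x, b, a))) - q (extY F (to_sphere x, b, a)))).
  by rewrite E E0.
by rewrite /deriveY /cderive !key.
Qed.

Let deriveY_lin v : (forall F, smoothY F -> smoothY (deriveY v F)) ->
  lin_on smoothY (deriveY v).
Proof.
move=> sv c F G sF sG; split; first exact: sv.
apply/funext => z; rewrite /deriveY extY_lin.
exact: (cderive_lin c _ open_domY (domY_val z) sF sG).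
Qed.

Lemma derive_u_lin i : lin_on smoothY (derive_u i).
Proof.
apply: deriveY_lin => F sF.
have E y : domY y -> (normrV y.1.1)%:C%C *
    cderive ((delta_mx ord0 i, 0, 0) : ambient) (extY F) y = extY (derive_u i F) y.
  by move=> Uy; apply/esym; exact: deriveY_u sF Uy.
apply: (csmooth_on_eq open_domY E).
exact: csmooth_on_scale open_domY smooth_normrV (csmooth_on_cderive _ sF).
Qed.

Lemma derive_b_lin : lin_on smoothY derive_b.
Proof.
apply: deriveY_lin => F sF.
have E y : domY y -> cderive ((0, 1, 0) : ambient) (extY F) y = extY (derive_b F) y.
  by move=> Uy; apply/esym; exact: deriveY_ba Uy.
exact: csmooth_on_eq open_domY E (csmooth_on_cderive _ sF).
Qed.

Lemma derive_a_lin : lin_on smoothY derive_a.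
Proof.
apply: deriveY_lin => F sF.
have E y : domY y -> cderive ((0, 0, 1) : ambient) (extY F) y = extY (derive_a F) y.
  by move=> Uy; apply/esym; exact: deriveY_ba Uy.
exact: csmooth_on_eq open_domY E (csmooth_on_cderive _ sF).
Qed.

Lemma smoothY0 : smoothY 0.
Proof.
rewrite /smoothY (_ : extY 0 = cst 0); first exact: csmooth_on_cst.
by apply/funext => y; rewrite /extY; case: insub.
Qed.

Lemma laplace_beltrami_lin : lin_on smoothY laplace_beltrami.
Proof.
apply: (lin_on_sum smoothY0 smoothY_lin) => i.
exact: lin_on_comp (derive_u_lin i) (derive_u_lin i).
Qed.

Let diffopY_lin l m k : lin_on smoothY
  (fun F => iter l derive_a (iter m derive_b (iter k laplace_beltrami F))).
Proof.
apply: lin_on_comp (lin_on_iter l derive_a_lin) _.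
exact: lin_on_comp (lin_on_iter m derive_b_lin)
  (lin_on_iter k laplace_beltrami_lin).
Qed.

Definition schwartzY_pred : {pred spaceY -> R[i]} := mem is_schwartzY.

Lemma schwartzY_submod_closed : submod_closed schwartzY_pred.
Proof.
split.
  apply/mem_set; split; first exact: smoothY0.
  move=> [[[[l m] k] s] r]; rewrite /seminormY.
  have := (diffopY_lin l m k (-1) smoothY0 smoothY0).2.
  by rewrite !scaleN1r !addNr => ->; exact: wsup0.
move=> c F G /set_mem[sF pF] /set_mem[sG pG]; apply/mem_set.
split; first exact: smoothY_lin.
move=> [[[[l m] k] s] r].
have := pF (l, m, k, s, r); have := pG (l, m, k, s, r).
rewrite /seminormY (diffopY_lin l m k c sF sG).2 => pGi pFi.
apply: wsup_lin => // -[y /= /andP[_ a0]].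
by rewrite mulr_ge0 ?powR_ge0// addr_ge0// ?invr_ge0 exprn_ge0// ltW.
Qed.

HB.instance Definition _ :=
  GRing.isSubmodClosed.Build R[i] (spaceY -> R[i]) schwartzY_pred
    schwartzY_submod_closed.

Record schwartzY := SchwartzY {
  schwartzY_fun :> spaceY -> R[i];
  schwartzY_funP : schwartzY_fun \in schwartzY_pred }.

HB.instance Definition _ := [isSub for schwartzY_fun].
HB.instance Definition _ := [Choice of schwartzY by <:].
HB.instance Definition _ := [SubChoice_isSubLmodule of schwartzY by <:].

HB.instance Definition _ := @isSubBaseTopological.Build schwartzY
  (set schwartzY)
  (seminorm_balls (fun i (F : schwartzY) => seminormY i F)) id.

End SpaceY.
Arguments spaceY R n : clear implicits.
Arguments schwartzY R n : clear implicits.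

Section Ridgelet.
Context {R : realType} {n : nat}.
Implicit Types (F : spaceY R n -> R[i]) (psi : 'rV[R]_1 -> R[i]) (x : 'rV[R]_n).

Definition ridgelet_integrand psi F x (y : 'rV[R]_n * R * R) : R[i] :=
  let: (u, b, a) := y in
  extY F (u, b, a) * (a^-1)%:C%C * psi (const_mx ((dotrV x u - b) / a))
  * (a ^- n)%:C%C.

Definition ridgelet_synthesis psi F x : R[i] :=
  cintegral (surface_measure n) (sphere n) (fun u =>
    cintegral lebesgue_measure `]0, +oo[ (fun a =>
      cintegral lebesgue_measure setT (fun b =>
        ridgelet_integrand psi F x (u, b, a)))).

Definition ridgelet_integrable psi F x : Prop :=
  cintegrable ((surface_measure n \x lebesgue_measure) \x lebesgue_measure)%E
    (sphere n `*` setT `*` `]0, +oo[) (ridgelet_integrand psi F x).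

End Ridgelet.

(* Main.v *)
(** The synthesis integral is a superposition of ridge functions
    [x |-> h ((x.u - b) / a)], integrated against a weight on [Y^{n+1}] of the form
    [a^p b^r (Laplacian^k Phi)].  Differentiating in [x] along [v] multiplies the
    weight by [(v.u) / a] and replaces [h] by [h'], which keeps the integrand dominated,
    so the integral is smooth with bounded derivatives.

    For the decay, write [psi = chi''] with [chi] in [S_0(R)] ([S_0(R)] is stable under
    antiderivatives).  The spherical Laplacian of [u |-> chi ((x.u - b) / a)] is
    [|x|^2 psi / a^2] up to terms that do not grow with [x]; by Green's formula it
    can be moved onto [Phi], so that [|x|^2 R^t_psi Phi] is a finite sum of transforms of
    the same kind.  Iterating gives rapid decay, and Landau's interpolation inequality
    passes it on to the derivatives.

    Since [sum_i (e_i.u)^2 = 1], the transform of [(Phi, psi)] is the Laplacian in [x] of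
    the transform of [(a^2 Phi, chi)]: integrating by parts against a monomial lowers its
    degree by two, and the moments vanish by induction.

    All estimates are bilinear in finitely many seminorms, which is continuity. *)
From HB Require Import structures.
Require Import Defs.
From mathcomp Require Import all_boot all_order all_algebra.
From mathcomp Require Import complex.
From mathcomp Require Import all_classical all_reals all_analysis.
From mathcomp Require Import measurable_realfun.
From mathcomp Require Import ring lra zify.
Set Implicit Arguments.
Unset Strict Implicit.
Unset Printing Implicit Defensive.
Import Order.TTheory GRing.Theory Num.Theory.
Import numFieldNormedType.Exports.
Local Open Scope classical_set_scope.
Local Open Scope ring_scope.

(* [GRing] exports another [normrV]. *)
Local Notation normrV := Defs.normrV.

(** * Measurability and integration *)

(** The proof runs inside one class of transforms: weights [a^p a^-q b^r Delta^k Phi], with a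
    function of one variable given as a sequence of successive derivatives. In the spherical
    Laplacian, powers of [x.u] appear; writing [x.u = a tau + b], with [tau] the argument of the
    one-variable function, the powers of [tau] are absorbed by that function and the powers of [b]
    by the weight. The class is thus closed, and the inductions let its indices vary. The identity
    for [|x|^2] is kept free of the factors [v.u] produced by derivatives in [x], which Green's
    formula would differentiate as well. Hence the decay of the derivatives comes from
    interpolation, between the decay of the transform and the mere boundedness of one more
    derivative. Green's formula uses no charts: functions on the sphere are extended to be
    homogeneous of degree 0, a tangential field is cut off near the origin and outside the unit
    ball, and its divergence is integrated over [R^n]. The cone form of the surface measure fits
    this. Bounds are carried as [tame], linear in a bound for [Phi] and in one for [psi], so that
    the same induction yields decay and continuity. *)

Section OpenMeasurable.
Context {R : realType} {n : nat}.
Local Notation ambient := ('rV[R]_n * R * R)%type.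

Lemma measurable_ball_rV (x : 'rV[R]_n) (e : R) : 0 < e -> measurable (ball x e).
Proof.
move=> e0.
rewrite (_ : ball x e = \big[setI/setT]_(i < n)
   ((fun y : 'rV[R]_n => y ord0 i) @^-1` ball (x ord0 i) e)).
  apply: bigsetI_measurable => i _; rewrite -[X in measurable X]setTI.
  by apply: measurable_coord => //; exact: measurable_ball.
rewrite -bigcap_seq; apply/seteqP; split=> y.
  by move=> [_ xy] i _; exact: xy.
move=> xy; split => // i j; rewrite ord1.
by apply: xy; rewrite /= mem_index_enum.
Qed.

Lemma exists_rat_near (x e : R) : 0 < e -> exists q : rat, `|x - ratr q| < e.
Proof.
move=> e0.
have [y [bxy [q _ qy]]] : ball x e `&` range (@ratr R) !=set0.
  by apply: dense_rat; [exists x; exact: ballxx|exact: ball_open].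
by exists q; rewrite qy; exact: bxy.
Qed.

(** The sigma-algebra is generated by coordinates and the topology by the sup norm, so second
    countability is what links them: [U] is the union of the balls with rational centre and radius
    [1/(k+1)] that it contains, enumerated by [pickle]. *)
Lemma open_measurable_ambient (U : set ambient) : open U -> measurable U.
Proof.
move=> oU.
pose T := ('rV[rat]_n * rat * rat * nat)%type.
pose B (t : T) : set ambient :=
  let: (q, b, a, k) := t in
  ball ((map_mx ratr q, ratr b, ratr a) : ambient) (k.+1%:R^-1 : R).
pose F (i : nat) : set ambient :=
  if unpickle i is Some t then (if `[< B t `<=` U >] then B t else set0) else set0.
have -> : U = \bigcup_i F i.
  apply/seteqP; split=> [z Uz|z [i _]]; last first.
    by rewrite /F; case: (unpickle _) => // t; case: asboolP => // + zt; exact.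
  have [e /= e0 zeU] : exists2 e : R, 0 < e & ball z e `<=` U.
    by apply/nbhs_ballP; exact: open_nbhs_nbhs.
  (* Twice the radius: once to go from [z] to the rational centre, once from the centre to any point
     of its ball. *)
  have [k ke] : exists k : nat, 2 * k.+1%:R^-1 < e.
    pose k := Num.truncn (2 / e); exists k.
    rewrite -ltr_pdivlMl ?ltr0n// mulrC invf_plt ?posrE ?divr_gt0 ?ltr0n//.
    rewrite invf_div (lt_le_trans (truncnS_gt _))//.
  have k0 : 0 < k.+1%:R^-1 :> R by rewrite invr_gt0.
  case: z Uz zeU => -[x b] a Uz zeU.
  have [a' ha] := exists_rat_near a k0; have [b' hb] := exists_rat_near b k0.
  have /choice[f hf] : forall i : 'I_n, exists q : rat, `|x ord0 i - ratr q| < k.+1%:R^-1.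
    by move=> i; exact: exists_rat_near.
  pose t : T := (\row_i f i, b', a', k).
  have xq : ball (map_mx ratr (\row_i f i) : 'rV[R]_n) (k.+1%:R^-1 : R) x.
    by split => // i j; rewrite ord1 !mxE -ball_normE/= distrC.
  have zt : B t (x, b, a).
    have nb (c : R) q : `|c - ratr q| < k.+1%:R^-1 -> ball (ratr q : R) k.+1%:R^-1 c.
      by rewrite -ball_normE/= distrC.
    by split; [split; [exact: xq|exact: nb]|exact: nb].
  have tU : B t `<=` U.
    move=> y ty; apply: zeU; apply: (@le_ball _ _ _ (k.+1%:R^-1 + k.+1%:R^-1)).
      by rewrite -mulr2n -[_ *+ 2]mulr_natl ltW.
    by apply: ball_triangle ty; exact: ball_sym.
  exists (pickle t); first exact: I.
  by rewrite /F pickleK asboolT.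
apply: bigcup_measurable => i _; rewrite /F.
case: (unpickle _) => [[[[q b] a] k]|] //; case: asboolP => // _.
have k0 : 0 < k.+1%:R^-1 :> R by rewrite invr_gt0.
rewrite (_ : B _ = ball (map_mx ratr q : 'rV[R]_n) k.+1%:R^-1
  `*` ball (ratr b : R) k.+1%:R^-1 `*` ball (ratr a : R) k.+1%:R^-1)//.
apply: measurableX; first apply: measurableX; try exact: measurable_ball.
exact: measurable_ball_rV.
Qed.

Lemma open_measurable_rV (U : set 'rV[R]_n) : open U -> measurable U.
Proof.
move=> oU.
have : measurable [set z : ambient | U z.1.1].
  apply: open_measurable_ambient.
  rewrite (_ : [set z | _] = (fun z : ambient => z.1.1) @^-1` U)//.
  apply: open_comp => // z _.
  by apply: (@cvg_comp _ _ _ fst fst); exact: cvg_fst.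
move=> m1.
rewrite (_ : U = (fun x => (x, 0, 0) : ambient) @^-1` [set z : ambient | U z.1.1])//.
rewrite -[X in measurable X]setTI.
suff : measurable_fun setT (fun x : 'rV[R]_n => (x, 0, 0) : ambient) by exact.
by apply: measurable_fun_pair => //; apply: measurable_fun_pair.
Qed.

(** The map [inj] separates the measurable structure from the topological one; in the uses it is the
    identity of a set that carries both. *)
Lemma continuous_open_measurable d (T : measurableType d) (S : topologicalType)
   (inj : T -> S) (D : set S) (f : S -> R) :
  (forall U : set S, open U -> measurable (inj @^-1` U)) ->
  open D -> (forall x, D x -> {for x, continuous f}) ->
  measurable_fun (inj @^-1` D) (f \o inj).
Proof.
move=> mU oD cf.
apply: (measurability _ (RGenOpens.measurableE R)) => _ [_ [a [b ->]] <-].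
have oB : open [set` `]a, b[%R] by exact: interval_open.
rewrite (_ : _ `&` _ = inj @^-1` (D `&` f @^-1` [set` `]a, b[%R])); last by apply/seteqP; split.
apply: mU; rewrite openE => x [Dx Bfx]; apply: filterI.
  by apply: open_nbhs_nbhs.
by apply: cf => //; exact: open_nbhs_nbhs.
Qed.

Lemma continuous_measurable_ambient (D : set ambient) (f : ambient -> R) :
  open D -> (forall x, D x -> {for x, continuous f}) -> measurable_fun D f.
Proof.
move=> oD cf.
exact: (@continuous_open_measurable _ _ ambient (id : ambient -> ambient) D f open_measurable_ambient oD cf).
Qed.

Lemma continuous_measurable_rV (D : set 'rV[R]_n) (f : 'rV[R]_n -> R) :
  open D -> (forall x, D x -> {for x, continuous f}) -> measurable_fun D f.
Proof.
move=> oD cf.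
exact: (@continuous_open_measurable _ _ _ (id : 'rV[R]_n -> _) D f open_measurable_rV oD cf).
Qed.

End OpenMeasurable.

Section Domination.
Context d (T : measurableType d) {R : realType} (mu : {measure set T -> \bar R}).

Lemma integrable_dominated (D : set T) (f g : T -> R) : measurable D ->
  measurable_fun D f -> (forall x, D x -> `|f x| <= g x) ->
  mu.-integrable D (EFin \o g) -> mu.-integrable D (EFin \o f).
Proof.
move=> mD mf fg; apply: le_integrable => //; first exact/measurable_EFinP.
by move=> x Dx /=; rewrite lee_fin (le_trans (fg _ Dx))// ler_norm.
Qed.

Lemma normr_Rintegral_le (D : set T) (f g : T -> R) : measurable D ->
  measurable_fun D f -> (forall x, D x -> `|f x| <= g x) ->
  mu.-integrable D (EFin \o g) ->
  `|\int[mu]_(x in D) f x| <= \int[mu]_(x in D) g x.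
Proof.
move=> mD mf fg ig; have intf := integrable_dominated mD mf fg ig.
apply: (le_trans (le_normr_Rintegral mD intf)).
by apply: le_Rintegral => //; exact: integrable_norm.
Qed.

(** Markov's inequality: the sets where [w >= 1/(k+1)] have finite measure and exhaust the space.
    The measures on [R^n], on the sphere and on the product of sphere and line get their
    sigma-finiteness from an integrable weight in this way. *)
Lemma sigma_finite_pos (w : T -> R) : (forall x, 0 < w x) ->
  mu.-integrable setT (EFin \o w) -> sigma_finite setT mu.
Proof.
move=> w0 iw; have mw : measurable_fun setT w.
  by apply/measurable_EFinP; case/integrableP : iw.
pose F k := w @^-1` `[k.+1%:R^-1, +oo[.
exists F.
  apply/seteqP; split=> // x _; have := w0 x => wx0.
  exists (Num.truncn (w x)^-1) => //; rewrite /F/= in_itv/= andbT.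
  by rewrite invf_ple ?posrE ?ltr0n// ltW// truncnS_gt.
move=> k.
have k0 : 0 < k.+1%:R^-1 :> R by rewrite invr_gt0.
have mF : measurable (F k) by rewrite -[F k]setTI; exact: mw.
split=> //.
have : (\int[mu]_(x in F k) (k.+1%:R^-1)%:E < +oo)%E.
  apply: (@le_lt_trans _ _ (\int[mu]_(x in setT) (w x)%:E)%E); last first.
    have /integrableP[_] := iw; congr (_ < _)%E; apply: eq_integral => x _ /=.
    by rewrite ger0_norm ?ltW.
  apply: (@le_trans _ _ (\int[mu]_(x in F k) (w x)%:E)%E); last first.
    by apply: ge0_subset_integral => //=; [exact/measurable_EFinP|move=> x _; rewrite lee_fin ltW].
  apply: ge0_le_integral => //=.
  + by apply/measurable_EFinP; exact: measurable_funS mw.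
  + by move=> x; rewrite /F/= in_itv/= andbT lee_fin.
rewrite integral_cst//.
case: (mu (F k)) (measure_ge0 mu (F k)) => [r| |] // _; first by rewrite !ltry.
by rewrite gt0_muley// lte_fin.
Qed.

Lemma Rintegral_setT_support (D : set T) (f : T -> R) : measurable D ->
  (forall x, ~ D x -> f x = 0) -> \int[mu]_x f x = \int[mu]_(x in D) f x.
Proof.
move=> mD f0; rewrite [RHS]Rintegral_mkcond; apply: eq_Rintegral => x _.
by rewrite patchE; case: ifPn => // /negP nx; apply: f0 => Dx; apply: nx; rewrite inE.
Qed.

End Domination.

Section RFubini.
Context d1 d2 (T1 : measurableType d1) (T2 : measurableType d2) {R : realType}.
Variables (m1 : {measure set T1 -> \bar R}) (m2 : {sigma_finite_measure set T2 -> \bar R}).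
Hypothesis sm1 : sigma_finite setT m1.

(** An alias of [m1] that remembers the proof of sigma-finiteness, so that the structure expected by
    Fubini's theorem can be declared on it. *)
Definition sigma_finite_copy (_ : sigma_finite setT m1) : set T1 -> \bar R := m1.
Local Notation copy := (sigma_finite_copy sm1).
HB.instance Definition _ := Measure.on copy.
HB.instance Definition _ := Measure_isSigmaFinite.Build _ _ _ copy sm1.
Let m1' : {sigma_finite_measure set T1 -> \bar R} := copy.

(** Integrability of every slice, not only of almost every one, makes the inner integrals finite
    everywhere, so that [fine] loses nothing. *)
Lemma Rintegral_prod12 (f : T1 * T2 -> R) :
  (m1 \x m2)%E.-integrable setT (EFin \o f) ->
  (forall x, m2.-integrable setT (fun y => (f (x, y))%:E)) ->
  \int[(m1 \x m2)%E]_z f z = \int[m1]_x \int[m2]_y f (x, y).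
Proof.
move=> intf if1; rewrite /Rintegral.
have := @integral12_prod_meas1 _ _ _ _ _ m1' m2 (EFin \o f) intf => <-.
congr fine; apply: eq_integral => x _; rewrite /fubini_F fineK//.
exact: integrable_fin_num.
Qed.

Lemma integrable_Rintegral2 (f : T1 * T2 -> R) :
  (m1 \x m2)%E.-integrable setT (EFin \o f) ->
  (forall x, m2.-integrable setT (fun y => (f (x, y))%:E)) ->
  m1.-integrable setT (fun x => (\int[m2]_y f (x, y))%:E).
Proof.
move=> intf if1; apply: eq_integrable (@integrable_fubini_F _ _ _ _ _ m1' m2 (EFin \o f) intf) => //.
by move=> x _; rewrite /fubini_F /= /Rintegral fineK//; exact: integrable_fin_num.
Qed.

Lemma Rintegral_prod21 (f : T1 * T2 -> R) :
  (m1 \x m2)%E.-integrable setT (EFin \o f) ->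
  (forall y, m1.-integrable setT (fun x => (f (x, y))%:E)) ->
  \int[(m1 \x m2)%E]_z f z = \int[m2]_y \int[m1]_x f (x, y).
Proof.
move=> intf if1; rewrite /Rintegral.
have := @integral21_prod_meas1 _ _ _ _ _ m1' m2 (EFin \o f) intf => <-.
congr fine; apply: eq_integral => x _; rewrite /fubini_G fineK//.
exact: integrable_fin_num.
Qed.

Lemma integrable_prodM (f : T1 -> R) (g : T2 -> R) :
  m1.-integrable setT (EFin \o f) -> m2.-integrable setT (EFin \o g) ->
  (m1 \x m2)%E.-integrable setT (fun z => (f z.1 * g z.2)%:E).
Proof.
move=> intf intg.
have mf : measurable_fun setT f by apply/measurable_EFinP; case/integrableP : intf.
have mg : measurable_fun setT g by apply/measurable_EFinP; case/integrableP : intg.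
have mfg : measurable_fun setT (fun z : T1 * T2 => (f z.1 * g z.2)%:E).
  apply/measurable_EFinP; apply: measurable_funM.
    by apply: (measurableT_comp mf); exact: measurable_fst.
  by apply: (measurableT_comp mg); exact: measurable_snd.
apply: (@integrable12ltyP _ _ _ _ _ m1' m2 _ mfg).2.
have E x : (\int[m2]_y `|(f (x, y).1 * g (x, y).2)%:E| = `|f x|%:E * \int[m2]_y `|(g y)%:E|)%E.
  rewrite -ge0_integralZl//=.
  - by apply: eq_integral => y _; rewrite /= normrM EFinM.
  - by apply/measurable_EFinP; exact: measurableT_comp.
under eq_integral => x _ do rewrite E.
rewrite ge0_integralZr//=.
- apply: lte_mul_pinfty.
  + exact: integral_ge0.
  + by rewrite ge0_fin_numE ?integral_ge0//; case/integrableP : intf.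
  + by case/integrableP : intg.
- by apply/measurable_EFinP; exact: measurableT_comp.
- exact: integral_ge0.
Qed.

End RFubini.

Section OneDim.
Context {R : realType}.
Local Notation leb := (@lebesgue_measure R).

Lemma integrable_oneDsqrV : leb.-integrable setT (fun t : R => ((1 + t ^+ 2)^-1)%:E).
Proof.
have c := @continuous_oneDsqrV R.
apply/integrableP; split.
  by apply/measurable_EFinP; exact: continuous_measurable_fun.
under eq_integral => x _.
  rewrite gee0_abs; last by rewrite lee_fin invr_ge0 addr_ge0 ?sqr_ge0.
  over.
rewrite (@ge0_symfun_integralT _ (fun x => (1 + x ^+ 2)^-1)).
- by rewrite -set_itvcy integral0y_oneDsqr -EFinM ltry.
- by move=> x; rewrite /= invr_ge0 addr_ge0 ?sqr_ge0.
- exact: c.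
- by move=> x; rewrite /= sqrrN.
Qed.

End OneDim.

Section DeriveAffine.
Context {R : realType}.

(** A directional derivative only sees a line, and [A] sends the line through [x] to the line
    through [A x]: the difference quotients are equal. *)
Lemma is_derive_affine (V W : normedModType R) (A : V -> W) (f : W -> R) x v w (d : R) :
  (forall h : R, A (h *: v + x) = h *: w + A x) ->
  is_derive (A x) w f d -> is_derive x v (f \o A) d.
Proof.
move=> hA [df dE].
have E : (fun h : R => h^-1 *: ((f \o A) (h *: v + x) - (f \o A) x)) =
         (fun h : R => h^-1 *: (f (h *: w + A x) - f (A x))).
  by apply/funext => h /=; rewrite hA.
split; first by rewrite /derivable E.
by rewrite -dE /derive E.
Qed.

Lemma is_derive_line (V : normedModType R) (f : V -> R) x v (d t : R) :
  is_derive (t *: v + x) v f d -> is_derive t (1 : R) (fun s : R => f (s *: v + x)) d.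
Proof.
move=> H; refine (@is_derive_affine _ _ (fun s : R => s *: v + x) f t 1 v d _ H) => h.
by rewrite -[h%:A]/(h * 1) mulr1 scalerDl addrA.
Qed.

Lemma is_derive1_continuous (f : R -> R) (df : R -> R) :
  (forall t, is_derive t (1 : R) f (df t)) -> continuous f.
Proof.
move=> H t; apply/differentiable_continuous/derivable1_diffP.
by case: (H t).
Qed.

End DeriveAffine.

Section DominatedR.
Context d (T : measurableType d) {R : realType} (mu : {measure set T -> \bar R}).

Lemma cvg_Rintegral_dominated (D : set T) (f_ : nat -> T -> R) (f g : T -> R) :
  measurable D -> (forall k, measurable_fun D (f_ k)) ->
  (forall x, D x -> f_ ^~ x @ \oo --> f x) ->
  mu.-integrable D (EFin \o g) ->
  (forall k x, D x -> `|f_ k x| <= g x) ->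
  (fun k => \int[mu]_(x in D) f_ k x) @ \oo --> \int[mu]_(x in D) f x.
Proof.
move=> mD mf cf ig fg.
have cfE x : D x -> (fun k => (f_ k x)%:E) @ \oo --> (f x)%:E.
  by move=> Dx; apply: cvg_EFin; [exact: nearW|exact: cf].
have mfE k : measurable_fun D (fun x => (f_ k x)%:E) by exact/measurable_EFinP.
have fgE k x : D x -> (`|(f_ k x)%:E| <= (g x)%:E)%E by move=> Dx; rewrite lee_fin fg.
have mfE' : measurable_fun D (fun x => (f x)%:E) by exact: emeasurable_fun_cvg mfE cfE.
have [intf _] := dominated_convergence mD mfE mfE' (aeW _ cfE) ig
  (aeW _ (fun x k Dx => fgE k x Dx)).
rewrite -[X in _ --> X](fineK (integrable_fin_num mD intf)).
by move=> /fine_cvg.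
Qed.

End DominatedR.

(** * Divergence theorem on the whole space for dominated fields *)

Section Divergence1.
Context {R : realType}.
Local Notation leb := (@lebesgue_measure R).
Local Notation w1 := (fun t : R => (1 + t ^+ 2)^-1).

Lemma w1_gt0 (t : R) : 0 < (1 + t ^+ 2)^-1.
Proof. by rewrite invr_gt0 ltr_pwDl ?sqr_ge0. Qed.

Lemma integrable_Zw1 (C : R) : leb.-integrable setT (fun t : R => (C * (1 + t ^+ 2)^-1)%:E).
Proof. exact: (@integrableZl _ _ _ leb setT measurableT C _ integrable_oneDsqrV). Qed.

(** The fundamental theorem of calculus on [[-(k+1), k+1]] leaves two boundary terms of size
    [C/(k+1)], while dominated convergence gives the integral over the line. *)
Lemma Rintegral_derive_eq0 (G g : R -> R) (C : R) :
  (forall t, is_derive t (1 : R) G (g t)) -> continuous g ->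
  (forall t, `|G t| <= C * (1 + t ^+ 2)^-1) ->
  (forall t, `|g t| <= C * (1 + t ^+ 2)^-1) ->
  \int[leb]_t g t = 0.
Proof.
move=> dG cg bG bg.
have cG := is_derive1_continuous dG.
pose I k := [set` `[- k.+1%:R, k.+1%:R : R]].
have FTC k : \int[leb]_(t in I k) g t = G k.+1%:R - G (- k.+1%:R).
  rewrite /Rintegral (@continuous_FTC2 _ g G) //.
  - by rewrite (@lt_trans _ _ 0)// ?oppr_lt0 ltr0n.
  - exact: continuous_subspaceT.
  - split; first by move=> x _; case: (dG x).
    + by apply: cvg_at_right_filter; exact: cG.
    + by apply: cvg_at_left_filter; exact: cG.
  - by move=> x _; rewrite derive1E; case: (dG x).
have mg : measurable_fun setT g by exact: continuous_measurable_fun.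
have lim1 : (fun k => \int[leb]_t (g \_ (I k)) t) @ \oo --> \int[leb]_t g t.
  apply: (@cvg_Rintegral_dominated _ _ R leb setT (fun k => g \_ (I k)) g
    (fun t => C * (1 + t ^+ 2)^-1)) => //.
  - move=> k; apply/(measurable_restrict _ _ _) => //.
      exact: measurable_itv.
    by apply: measurable_funS mg.
  - move=> t _; apply: cvg_near_cst; near=> k.
    rewrite patchE mem_set // /I/= in_itv/= -ler_norml.
    rewrite (le_trans (ltW (truncnS_gt _)))// ler_nat ltnS.
    by near: k; exact: nbhs_infty_ge.
  - exact: integrable_Zw1.
  - move=> k t _; rewrite patchE; case: ifPn => // _.
    by rewrite normr0 (le_trans _ (bg t)).
have lim2 : (fun k => \int[leb]_t (g \_ (I k)) t) @ \oo --> (0 : R).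
  rewrite (_ : (fun k => _) = (fun k => G k.+1%:R - G (- k.+1%:R))); last first.
    by apply/funext => k; rewrite -Rintegral_mkcond FTC.
  apply: norm_cvg0.
  apply: (@squeeze_cvgr _ _ _ _ (cst 0) (fun k => 2 * C * k.+1%:R^-1)).
  - apply: nearW => k /=; rewrite normr_ge0/=.
    have C0 : 0 <= C.
      by have := le_trans (normr_ge0 _) (bG 0); rewrite pmulr_lge0 ?w1_gt0.
    have h (t : R) : `|t| = k.+1%:R -> `|G t| <= C * k.+1%:R^-1.
      move=> tk; apply: (le_trans (bG t)); apply: ler_wpM2l => //.
      rewrite lef_pV2 ?posrE ?ltr0n// ?ltr_pwDl ?sqr_ge0// -(real_normK (num_real t)) tk.
      rewrite ler_wpDl// -natrX ler_nat -mulnn leq_pmulr//.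
    rewrite (le_trans (ler_normB _ _))// -mulrA mulr_natl mulr2n lerD//.
      by apply: h; rewrite ger0_norm.
    by apply: h; rewrite normrN ger0_norm.
  - exact: cvg_cst.
  - rewrite -[X in _ --> X](mulr0 (2 * C)); apply: cvgMr.
    exact: cvg_harmonic.
exact: (cvg_unique _ lim1 lim2).
Unshelve. all: by end_near. Qed.

End Divergence1.

Section LebesgueRV.
Context {R : realType}.
Local Notation leb := (@lebesgue_measure R).

Let prod_rV n : {measure set ('rV[R]_n * measurableTypeR R) -> \bar R} :=
  (lebesgue_rV n \x leb)%E.

(** A product weight rather than a radial one: it factors under [consrV], so that integrability and
    Fubini go by induction on the dimension. *)
Definition wrV {n} (x : 'rV[R]_n) : R := \prod_i (1 + x ord0 i ^+ 2)^-1.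

Lemma wrV_gt0 n (x : 'rV[R]_n) : 0 < wrV x.
Proof. by apply: prodr_gt0 => i _; exact: w1_gt0. Qed.

Lemma consrV0 n (t : R) (y : 'rV[R]_n) : consrV (t, y) ord0 ord0 = t.
Proof. by rewrite mxE unlift_none. Qed.

Lemma consrV_lift n (t : R) (y : 'rV[R]_n) i : consrV (t, y) ord0 (lift ord0 i) = y ord0 i.
Proof. by rewrite mxE liftK. Qed.

Lemma wrV_consrV n t (y : 'rV[R]_n) : wrV (consrV (t, y)) = wrV y * (1 + t ^+ 2)^-1.
Proof.
rewrite /wrV big_ord_recl consrV0 mulrC; congr (_ * _).
by apply: eq_bigr => i _; rewrite consrV_lift.
Qed.

Lemma measurable_wrV n : measurable_fun [set: 'rV[R]_n] wrV.
Proof.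
apply: measurable_prod => i _.
apply: (measurableT_comp (f := fun t : R => (1 + t ^+ 2)^-1)).
  by apply: continuous_measurable_fun; exact: continuous_oneDsqrV.
exact: measurable_coord.
Qed.

Lemma integrable_wrV n : (lebesgue_rV n).-integrable setT (fun x : 'rV[R]_n => (wrV x)%:E).
Proof.
elim: n => [|n IH].
  apply/integrableP; split; first by apply/measurable_EFinP; exact: measurable_wrV.
  rewrite integral_dirac//=.
    by rewrite diracE in_setT mul1e ltry.
  by apply/measurable_EFinP; apply: measurableT_comp => //; exact: measurable_wrV.
apply: (@integrable_pushforward _ _ ('rV[R]_n * measurableTypeR R)%type _ R _
  (@measurable_consrV R n) (prod_rV n) setT (fun x => (wrV x)%:E)) => //.
  by apply/measurable_EFinP; exact: measurable_wrV.
rewrite preimage_setT (_ : _ \o _ = fun z : 'rV[R]_n * R => (wrV z.1 * (1 + z.2 ^+ 2)^-1)%:E).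
  apply: (@integrable_prodM _ _ _ _ R (lebesgue_rV n) leb _ wrV (fun t => (1 + t ^+ 2)^-1) IH).
    exact: sigma_finite_pos (@wrV_gt0 n) IH.
  exact: integrable_oneDsqrV.
by apply/funext => -[y t] /=; rewrite wrV_consrV.
Qed.

Lemma sigma_finite_lebesgue_rV n : sigma_finite setT (lebesgue_rV n : set 'rV[R]_n -> _).
Proof. exact: sigma_finite_pos (@wrV_gt0 n) (integrable_wrV n). Qed.

Lemma integrable_ZwrV n (C : R) :
  (lebesgue_rV n).-integrable setT (fun x : 'rV[R]_n => (C * wrV x)%:E).
Proof. exact: (@integrableZl _ _ _ _ setT measurableT C _ (integrable_wrV n)). Qed.

Section Slices.
Variables (n : nat) (f : 'rV[R]_n.+1 -> R) (C : R).
Hypotheses (mf : measurable_fun setT f) (bf : forall x, `|f x| <= C * wrV x).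

Let F (z : 'rV[R]_n * R) := f (consrV (z.2, z.1)).

Let mF : measurable_fun setT F.
Proof. by apply: measurableT_comp => //; exact: measurable_consrV. Qed.

Let intF : (lebesgue_rV n \x leb)%E.-integrable setT (EFin \o F).
Proof.
apply: (@integrable_dominated _ ('rV[R]_n * measurableTypeR R)%type _ (prod_rV n) _ F
  (fun z => C * wrV z.1 * (1 + z.2 ^+ 2)^-1)) => //.
  by move=> z _; rewrite -mulrA -wrV_consrV; exact: bf.
apply: (@integrable_prodM _ _ _ _ R (lebesgue_rV n) leb _
  (fun y => C * wrV y) (fun t => (1 + t ^+ 2)^-1)).
- exact: sigma_finite_lebesgue_rV.
- exact: integrable_ZwrV.
- exact: integrable_oneDsqrV.
Qed.

Let rVE : \int[lebesgue_rV n.+1]_x f x = \int[(lebesgue_rV n \x leb)%E]_z F z.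
Proof.
rewrite /Rintegral; congr fine.
apply: (@integral_pushforward _ _ ('rV[R]_n * measurableTypeR R)%type _ R _
  (@measurable_consrV R n) (prod_rV n) setT (fun x => (f x)%:E)) => //.
exact/measurable_EFinP.
Qed.

(** Domination by the product weight gives integrability on the product and on each slice, as
    [Rintegral_prod12] requires. *)
Lemma Rintegral_rV12 : \int[lebesgue_rV n.+1]_x f x =
  \int[lebesgue_rV n]_y \int[leb]_t f (consrV (t, y)).
Proof.
rewrite rVE (Rintegral_prod12 (@sigma_finite_lebesgue_rV n) intF)// => y.
apply: (@integrable_dominated _ (measurableTypeR R) _ leb _ (fun t => F (y, t))
  (fun t => C * wrV y * (1 + t ^+ 2)^-1)) => //.
- by apply: measurableT_comp => //; exact: measurable_pair1.
- by move=> t _; rewrite -mulrA -wrV_consrV; exact: bf.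
- exact: integrable_Zw1.
Qed.

Lemma Rintegral_rV21 : \int[lebesgue_rV n.+1]_x f x =
  \int[leb]_t \int[lebesgue_rV n]_y f (consrV (t, y)).
Proof.
rewrite rVE (Rintegral_prod21 (@sigma_finite_lebesgue_rV n) intF)// => t.
apply: (@integrable_dominated _ _ _ _ _ (fun y => F (y, t))
  (fun y => C * (1 + t ^+ 2)^-1 * wrV y)) => //.
- by apply: measurableT_comp => //; exact: measurable_pair2.
- by move=> y _; rewrite -mulrA (mulrC _ (wrV _)) -wrV_consrV; exact: bf.
- exact: integrable_ZwrV.
Qed.

End Slices.

Lemma continuous_consrV1 n (y : 'rV[R]_n) : continuous (fun t : R => consrV (t, y)).
Proof.
move=> t; apply/cvg_ballP => e e0.
have : \forall z \near t, ball t e z by exact: nbhsx_ballx.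
apply: filterS => s ts; split=> // i j; rewrite !mxE.
by case: unliftP => [k _|_] //=; exact: ballxx.
Qed.

Lemma continuous_consrV2 n (t : R) : continuous (fun y : 'rV[R]_n => consrV (t, y)).
Proof.
move=> y A /nbhs_ballP[e /= e0 eA]; apply/nbhs_ballP; exists e => // z [_ yz].
apply: eA; split=> // i j; rewrite !mxE.
by case: unliftP => [k _|_] //=; exact: ballxx.
Qed.

(** Only the first coordinate can be split off. If [i] is that coordinate, the inner integral
    vanishes by the one-dimensional case; otherwise the first coordinate is frozen, its weight joins
    the constant, and induction applies. *)
Lemma Rintegral_partial_eq0 n (i : 'I_n) (G g : 'rV[R]_n -> R) (C : R) :
  (forall x, is_derive x (delta_mx ord0 i) G (g x)) -> continuous g ->
  (forall x, `|G x| <= C * wrV x) -> (forall x, `|g x| <= C * wrV x) ->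
  \int[lebesgue_rV n]_x g x = 0.
Proof.
elim: n i G g C => [[]//|n IH] i G g C dG cg bG bg.
have mg : measurable_fun setT g.
  by apply: (continuous_measurable_rV openT) => x _; exact: cg.
have [j ij|i0] := unliftP ord0 i.
- rewrite (Rintegral_rV21 mg bg).
  rewrite (_ : (fun t => _) = fun => 0); first by rewrite /Rintegral integral0.
  apply/funext => t.
  apply: (IH j (fun y => G (consrV (t, y))) _ (C * (1 + t ^+ 2)^-1)).
  + move=> y; apply: (@is_derive_affine _ _ _ (fun y => consrV (t, y)) G y _ (delta_mx ord0 i)) => //.
    move=> h; apply/rowP => k; rewrite !mxE.
    case: unliftP => [l ->|->]; rewrite ij /= ?mxE/=.
      by rewrite (inj_eq (@lift_inj _ ord0)).
      by rewrite mulr0 add0r.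
  + move=> y; apply: (@continuous_comp _ _ _ (fun y => consrV (t, y)) g).
      exact: continuous_consrV2.
    exact: cg.
  + by move=> y; rewrite -mulrA (mulrC _ (wrV _)) -wrV_consrV; exact: bG.
  + by move=> y; rewrite -mulrA (mulrC _ (wrV _)) -wrV_consrV; exact: bg.
- rewrite (Rintegral_rV12 mg bg).
  rewrite (_ : (fun t => _) = fun => 0); first by rewrite /Rintegral integral0.
  apply/funext => y.
  apply: (@Rintegral_derive_eq0 R (fun t => G (consrV (t, y))) _ (C * wrV y)).
  + move=> t; apply: (@is_derive_affine _ _ _ (fun t => consrV (t, y)) G t _ (delta_mx ord0 i)) => //.
    move=> h; apply/rowP => k; rewrite !mxE.
    case: unliftP => [l ->|->]; rewrite i0 /= ?mxE/= ?mulr0 ?add0r//.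
  + move=> t; apply: (@continuous_comp _ _ _ (fun t => consrV (t, y)) g).
      exact: continuous_consrV1.
    exact: cg.
  + by move=> t; rewrite -mulrA -wrV_consrV; exact: bG.
  + by move=> t; rewrite -mulrA -wrV_consrV; exact: bg.
Qed.

End LebesgueRV.

(** * Calculus on the sphere *)

Section DeriveTools.
Context {R : realType}.

(** A quadratic remainder along the line identifies the derivative. It is applied with [K = 0] to
    affine functions and with [K = 1] to quadratic ones. *)
Lemma is_derive_quadratic (V : normedModType R) (f : V -> R) x v (d K : R) :
  (forall h : R, `|f (h *: v + x) - f x - h * d| <= K * h ^+ 2) -> is_derive x v f d.
Proof.
move=> H.
have E : (fun h : R => h^-1 *: (f (h *: v + x) - f x)) @ 0^' --> d.
  apply/subr_cvg0; apply: norm_cvg0.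
  apply: (@squeeze_cvgr _ _ _ _ (cst 0) (fun h : R => `|K| * `|h|)).
  - near=> h; have h0 : h != 0 by near: h; exact: nbhs_dnbhs_neq.
    rewrite normr_ge0/= -[_ *: _]/(_ * _).
    rewrite (_ : _ - d = h^-1 * (f (h *: v + x) - f x - h * d)); last first.
      by rewrite [RHS]mulrBr mulKf.
    rewrite normrM normfV ler_pdivrMl ?normr_gt0// (le_trans (H h))//.
    rewrite (le_trans (ler_norm _))// normrM normrX expr2 mulrCA mulrA.
    by rewrite mulrC mulrA mulrAC.
  - exact: cvg_cst.
  - rewrite -[X in _ --> X](mulr0 `|K|); apply: cvgMr.
    rewrite -[X in _ --> X](@normr0 _ R); apply: cvg_norm.
    by apply: cvg_trans (@cvg_id _ _); apply: cvg_within.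
by split; [apply/cvg_ex; exists d|exact/cvg_lim].
Unshelve. all: by end_near. Qed.

Lemma is_derive_near_eq (V : normedModType R) (f g : V -> R) x v (d : R) :
  (\forall y \near x, f y = g y) -> is_derive x v f d -> is_derive x v g d.
Proof.
move=> fg [df dE]; split; first exact: near_eq_derivable df.
by rewrite -dE; apply/esym; exact: near_eq_derive.
Qed.

Lemma continuous_near_eq (T U : topologicalType) (f g : T -> U) x :
  (\forall y \near x, f y = g y) -> {for x, continuous f} -> {for x, continuous g}.
Proof.
move=> fg cf; rewrite /prop_for /continuous_at -(nbhs_singleton fg).
by apply: cvg_trans cf; exact: near_eq_cvg.
Qed.

Lemma lipschitz_continuous (V : normedModType R) (f : V -> R) (C : R) : 0 < C ->
  (forall x y, `|f x - f y| <= C * `|x - y|) -> continuous f.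
Proof.
move=> C0 lip x; apply/cvgrPdist_lt => e e0; near=> y.
apply: (le_lt_trans (lip x y)); rewrite mulrC -ltr_pdivlMr//.
by near: y; apply/nbhs_normP; exists (e / C) => //=; exact: divr_gt0.
Unshelve. all: by end_near. Qed.

Lemma is_derive_from_line (V : normedModType R) (f : V -> R) x v (d : R) :
  is_derive (0 : R) (1 : R) (fun s : R => f (s *: v + x)) d -> is_derive x v f d.
Proof.
move=> [dc dE]; split; first exact/derivable1P.
rewrite -dE /derive /=; congr (lim (_ @ 0^')); apply/funext => h /=.
by rewrite -[h%:A]/(h * 1) mulr1 addr0 scale0r add0r.
Qed.

Lemma is_derive_comp1 (V : normedModType R) (f : V -> R) (g : R -> R) x v (a b : R) :
  is_derive x v f a -> is_derive (f x) (1 : R) g b ->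
  is_derive x v (fun y => g (f y)) (b * a).
Proof.
move=> df dg.
have dl : is_derive (0 : R) (1 : R) (fun s : R => f (s *: v + x)) a.
  by apply: is_derive_line; rewrite scale0r add0r.
apply: is_derive_from_line.
have : is_derive (0 : R) (1 : R) (g \o (fun s : R => f (s *: v + x))) (b * a).
  by apply: is_derive1_comp; rewrite scale0r add0r.
by [].
Qed.

(* Directional derivatives in the library are only assumed along one direction:
   additivity in the direction comes from the mean value theorem and the
   continuity of one of the two partial derivatives. *)
Lemma deriveDdir (V : normedModType R) (f : V -> R) x v w :
  derivable f x v -> (\forall y \near x, derivable f y w) ->
  {for x, continuous ('D_w f)} ->
  is_derive x (v + w) f ('D_v f x + 'D_w f x).
Proof.
move=> dv dw cw.
(* The increment along [v + w] is split at the moving point [h *: v + x]; [g] is the part along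
   [w]. *)
pose g (h : R) := h^-1 * (f (h *: (v + w) + x) - f (h *: v + x)).
have cg : g @ 0^' --> 'D_w f x.
  apply/cvgrPdist_lt => e e0.
  have : \forall y \near x, derivable f y w /\ `|'D_w f x - 'D_w f y| < e.
    apply: filterI => //.
    by move/cvgrPdist_lt : cw => /(_ e e0).
  move=> /nbhs_ballP[r /= r0 xr].
  pose K := `|v| + `|w| + 1.
  have K0 : 0 < K by rewrite ltr_wpDl// addr_ge0.
  have near0 (h c : R) : `|h| < r / K -> `|c| <= `|h| -> ball x r (c *: w + (h *: v + x)).
    move=> hr ch; rewrite -ball_normE /= addrA opprD addrCA subrr addr0 normrN.
    rewrite (le_lt_trans (ler_normD _ _))// !normrZ.
    apply: (@le_lt_trans _ _ (`|h| * K)).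
      rewrite /K mulrDr mulr1 mulrDr ler_wpDr// addrC lerD2l.
      by rewrite ler_wpM2r.
    by rewrite -ltr_pdivlMr.
  near=> h.
  have h0 : h != 0 by near: h; exact: nbhs_dnbhs_neq.
  have hr : `|h| < r / K.
    near: h; apply: dnbhs0_lt; exact: divr_gt0.
  have dl (s : R) : `|s| <= `|h| ->
      is_derive s (1 : R) (fun s => f (s *: w + (h *: v + x)))
        ('D_w f (s *: w + (h *: v + x))).
    move=> sh; apply: is_derive_line; apply/derivableP.
    exact: (xr _ (near0 _ _ hr sh)).1.
  have [c ch E] : exists2 c : R, `|c| <= `|h| &
      f (h *: w + (h *: v + x)) - f (h *: v + x) = 'D_w f (c *: w + (h *: v + x)) * h.
    pose L s := f (s *: w + (h *: v + x)).
    have L0 : f (h *: v + x) = L 0 by rewrite /L scale0r add0r.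
    have cL (a b : R) : (forall s, s \in `[a, b]%R -> `|s| <= `|h|) -> {within `[a, b], continuous L}.
      move=> ab; apply: derivable_within_continuous => s sab.
      by case: (dl s (ab _ sab)).
    have [h1|h1|h1] := ltgtP h 0; last by rewrite h1 eqxx in h0.
    - have ab s : s \in `[h, 0]%R -> `|s| <= `|h|.
        by rewrite in_itv/= => /andP[h2 h3]; rewrite ler0_norm// ltr0_norm// lerN2.
      have [|c cI cE] := @MVT R L (fun s => 'D_w f (s *: w + (h *: v + x))) h 0 h1 _ (cL _ _ ab).
        by move=> s sI; apply: dl; apply: ab; exact: subset_itv_oo_cc sI.
      exists c; first by apply: ab; exact: subset_itv_oo_cc cI.
      by rewrite L0 -[LHS]opprB cE sub0r mulrN opprK.
    - have ab s : s \in `[0, h]%R -> `|s| <= `|h|.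
        by rewrite in_itv/= => /andP[h2 h3]; rewrite ger0_norm// gtr0_norm.
      have [|c cI cE] := @MVT R L (fun s => 'D_w f (s *: w + (h *: v + x))) 0 h h1 _ (cL _ _ ab).
        by move=> s sI; apply: dl; apply: ab; exact: subset_itv_oo_cc sI.
      exists c; first by apply: ab; exact: subset_itv_oo_cc cI.
      by rewrite L0 cE subr0.
  rewrite /g scalerDr (addrC (h *: v)) -addrA E mulrC mulfK//.
  exact: (xr _ (near0 _ _ hr ch)).2.
have E : (fun h : R => h^-1 *: (f (h *: (v + w) + x) - f x)) @ 0^' --> 'D_v f x + 'D_w f x.
  rewrite (_ : (fun h => _) = (fun h : R => h^-1 *: (f (h *: v + x) - f x) + g h)).
    by apply: cvgD cg; exact: dv.
  apply/funext => h; rewrite /g -[_ *: _]/(_ * _) -[_ *: _ in RHS]/(_ * _) -mulrDr.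
  by congr (_ * _); rewrite [RHS]addrC subrKA.
by split; [apply/cvg_ex; eexists; exact: E|exact/cvg_lim].
Unshelve. all: by end_near. Qed.

Lemma is_deriveZdir (V : normedModType R) (f : V -> R) x v (c d : R) :
  is_derive x v f d -> is_derive x (c *: v) f (c * d).
Proof.
move=> df.
have dl : is_derive (0 : R) (1 : R) (fun s : R => f (s *: v + x)) d.
  by apply: is_derive_line; rewrite scale0r add0r.
have dc : is_derive (0 : R) (1 : R) (fun s : R => c * s) c.
  rewrite -[X in is_derive _ _ _ X]mulr1; exact: is_deriveZ.
have : is_derive (0 : R) (1 : R) ((fun s : R => f (s *: v + x)) \o (fun s : R => c * s)) (d * c).
  by apply: is_derive1_comp; rewrite mulr0.
rewrite mulrC => H; apply: is_derive_from_line.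
rewrite (_ : (fun s : R => _) = (fun s : R => f (s *: v + x)) \o (fun s : R => c * s))//.
by apply/funext => s /=; rewrite scalerA mulrC.
Qed.

(** Smoothness provides the continuity that [deriveDdir] asks for. The lemma serves Euler's identity
    for functions homogeneous of degree 0. *)
Lemma is_derive_smooth_sum (V : normedModType R) (U : set V) (f : V -> R) x
    (I : Type) (r : seq I) (c : I -> R) (v : I -> V) :
  open U -> smooth_on U f -> U x ->
  is_derive x (\sum_(i <- r) c i *: v i) f (\sum_(i <- r) c i * 'D_(v i) f x).
Proof.
move=> oU sf Ux.
have df y w : U y -> derivable f y w by move=> Uy; exact: (sf [::] y Uy).2.
elim: r => [|i r IH]; first by rewrite !big_nil; exact: is_derive0.
have [dr drE] := IH.
have [dz dzE] : is_derive x (c i *: v i) f (c i * 'D_(v i) f x).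
  by apply: is_deriveZdir; apply/derivableP; exact: df.
(* The terms are swapped so that the new direction [c i *: v i] is the one whose derivative is known
   to be continuous. *)
rewrite !big_cons -drE -dzE addrC [X in is_derive _ _ _ X]addrC.
refine (@deriveDdir _ f x _ _ dr _ (sf [:: c i *: v i] x Ux).1).
by near=> y; apply: df; near: y; exact: open_nbhs_nbhs.
Unshelve. all: by end_near. Qed.

End DeriveTools.

(** * Cutoff functions of class C^1 *)

Section Cutoff.
Context {R : realType}.

(** Class C^1 is enough: the divergence theorem differentiates the cutoff once. *)
Definition pos2 (t : R) : R := Num.max 0 t ^+ 2.

Lemma is_derive_pos2 (t : R) : is_derive t (1 : R) pos2 (2 * Num.max 0 t).
Proof.
apply: (@is_derive_quadratic _ _ _ _ _ _ 1) => h; rewrite mul1r /pos2 -[h%:A]/(h * 1) mulr1.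
rewrite ler_norml; apply/andP.
by case: (leP 0 t) => t0; case: (leP 0 (h + t)) => ht0; split; nra.
Qed.

Lemma pos2_ge0 (t : R) : 0 <= pos2 t. Proof. exact: sqr_ge0. Qed.

Lemma pos2_le0 (t : R) : t <= 0 -> pos2 t = 0.
Proof. by move=> t0; rewrite /pos2 max_l// expr0n. Qed.

Lemma pos2_gt0 (t : R) : 0 < t -> 0 < pos2 t.
Proof. by move=> t0; rewrite /pos2 max_r ?ltW// exprn_gt0. Qed.

(** The classical quotient [g(t) / (g(t) + g(1 - t))], which passes from 0 to 1 on [[0, 1]]. *)
Definition step (t : R) : R := pos2 t / (pos2 t + pos2 (1 - t)).

Definition dstep (t : R) : R :=
  - (pos2 t + pos2 (1 - t)) ^- 2 * (2 * Num.max 0 t - 2 * Num.max 0 (1 - t)) * pos2 t +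
  (pos2 t + pos2 (1 - t))^-1 * (2 * Num.max 0 t).

Lemma pos2_den (t : R) : 0 < pos2 t + pos2 (1 - t).
Proof.
have [t0|t0] := ltP 0 t; first by rewrite ltr_pwDl ?pos2_gt0 ?pos2_ge0.
by rewrite ltr_pwDr ?pos2_ge0// pos2_gt0// subr_gt0 (le_lt_trans t0).
Qed.

Lemma is_derive_step (t : R) : is_derive t (1 : R) step (dstep t).
Proof.
have d1 := is_derive_pos2 t.
have d2 : is_derive t (1 : R) (fun t => pos2 (1 - t)) (2 * Num.max 0 (1 - t) * (-1)).
  apply: (@is_derive_comp1 _ _ (fun t : R => 1 - t)); last exact: is_derive_pos2.
  rewrite -[X in is_derive _ _ _ X]add0r; exact: is_deriveB.
have dV := @is_deriveV R (pos2 + (fun t => pos2 (1 - t))) t _ 1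
  (lt0r_neq0 (pos2_den t)) (is_deriveD d1 d2).
have := is_deriveM d1 dV.
rewrite (_ : _ *: _ + _ *: _ = dstep t); first by [].
rewrite /dstep /GRing.scale /= -[(pos2 + _) t]/(pos2 t + pos2 (1 - t)).
by ring.
Qed.

Lemma continuous_pos2 : continuous pos2.
Proof. exact: is_derive1_continuous is_derive_pos2. Qed.

Lemma continuous_max0 : continuous (fun t : R => Num.max 0 t).
Proof.
by move=> t; apply: continuous_max; [exact: cvg_cst|exact: cvg_id].
Qed.

Lemma continuous_dstep : continuous dstep.
Proof.
move=> t.
have c1 : {for t, continuous (fun t : R => 1 - t)} by apply: cvgB; [exact: cvg_cst|exact: cvg_id].
have c2 : {for t, continuous (fun t : R => pos2 (1 - t))}.
  by apply: (continuous_comp c1); exact: continuous_pos2.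
have c3 : {for t, continuous (fun t : R => Num.max 0 (1 - t))}.
  by apply: (continuous_comp c1); exact: continuous_max0.
have c4 : {for t, continuous (fun t => pos2 t + pos2 (1 - t))}.
  by apply: cvgD => //; exact: continuous_pos2.
have den0 := lt0r_neq0 (pos2_den t).
apply: cvgD.
  apply: cvgM; last exact: continuous_pos2.
  apply: cvgM.
    apply: cvgN; apply: cvgV; first by rewrite expf_neq0.
    by apply: (@continuous_comp _ _ _ _ (fun x : R => x ^+ 2) _ c4); exact: exprn_continuous.
  apply: cvgB; apply: cvgM; try exact: cvg_cst.
    exact: continuous_max0.
  exact: c3.
apply: cvgM; first by apply: cvgV.
by apply: cvgM; [exact: cvg_cst|exact: continuous_max0].
Qed.

Lemma step_le0 (t : R) : t <= 0 -> step t = 0.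
Proof. by move=> t0; rewrite /step pos2_le0// mul0r. Qed.

Lemma step_ge1 (t : R) : 1 <= t -> step t = 1.
Proof.
move=> t1; rewrite /step (@pos2_le0 (1 - t)) ?subr_le0// addr0 mulfV//.
by rewrite lt0r_neq0// pos2_gt0// (lt_le_trans _ t1).
Qed.

Lemma step_ge0_le1 (t : R) : 0 <= step t <= 1.
Proof.
rewrite /step divr_ge0 ?addr_ge0 ?pos2_ge0//=.
by rewrite ler_pdivrMr ?pos2_den// mul1r lerDl pos2_ge0.
Qed.

(** To be taken at [t = |y|^2]. It is 1 on [[2/(k+1), 1]] and 0 outside []1/(k+1), 1 + 1/(k+1)[];
    including the endpoint 1 on the plateau makes the pointwise limit the indicator of the punctured
    closed ball on which [surface_measure] is built. *)
Definition cutoff (k : nat) (t : R) : R :=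
  step (k.+1%:R * t - 1) * step (1 + k.+1%:R * (1 - t)).

Lemma cutoff_C1 k : exists2 dw : R -> R,
  (forall t, is_derive t (1 : R) (cutoff k) (dw t)) & continuous dw.
Proof.
pose K : R := k.+1%:R.
have d1 t : is_derive t (1 : R) (fun t => step (K * t - 1)) (dstep (K * t - 1) * K).
  apply: (@is_derive_comp1 _ _ (fun t : R => K * t - 1)); last exact: is_derive_step.
  rewrite -[X in is_derive _ _ _ X]subr0; apply: is_deriveB.
  by rewrite -[X in is_derive _ _ _ X]mulr1; exact: is_deriveZ.
have d2 t : is_derive t (1 : R) (fun t => step (1 + K * (1 - t))) (dstep (1 + K * (1 - t)) * (- K)).
  apply: (@is_derive_comp1 _ _ (fun t : R => 1 + K * (1 - t))); last exact: is_derive_step.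
  rewrite -[X in is_derive _ _ _ X]add0r; apply: is_deriveD.
  rewrite -[X in is_derive _ _ _ X]mulrN1; apply: is_deriveZ.
  rewrite -[X in is_derive _ _ _ X]add0r; exact: is_deriveB.
exists (fun t => step (K * t - 1) * (dstep (1 + K * (1 - t)) * (- K)) +
   step (1 + K * (1 - t)) * (dstep (K * t - 1) * K)) => t.
  exact: (is_deriveM (d1 t) (d2 t)).
have c1 : {for t, continuous (fun t : R => K * t - 1)}.
  by apply: cvgB; [apply: cvgM; [exact: cvg_cst|exact: cvg_id]|exact: cvg_cst].
have c2 : {for t, continuous (fun t : R => 1 + K * (1 - t))}.
  apply: cvgD; [exact: cvg_cst|apply: cvgM; first exact: cvg_cst].
  by apply: cvgB; [exact: cvg_cst|exact: cvg_id].
have cs := is_derive1_continuous is_derive_step.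
have C (u f : R -> R) : {for t, continuous u} -> continuous f ->
    {for t, continuous (fun t => f (u t))}.
  by move=> cu cf; apply: (continuous_comp cu); exact: cf.
by apply: cvgD; (apply: cvgM; last apply: cvgM; try exact: cvg_cst);
  apply: C => //; exact: continuous_dstep.
Qed.

Lemma cutoff_ge0_le1 k t : 0 <= cutoff k t <= 1.
Proof.
have /andP[a b] := step_ge0_le1 (k.+1%:R * t - 1).
have /andP[c d] := step_ge0_le1 (1 + k.+1%:R * (1 - t)).
by rewrite /cutoff mulr_ge0//= mulr_ile1.
Qed.

Lemma cutoff_small k t : t <= k.+1%:R^-1 -> cutoff k t = 0.
Proof.
by move=> tk; rewrite /cutoff step_le0 ?mul0r// subr_le0 mulrC -ler_pdivlMr ?ltr0n// div1r.
Qed.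

(** The second factor vanishes from [1 + 1/(k+1)] on; 2 is a threshold uniform in [k]. *)
Lemma cutoff_large k t : 2 <= t -> cutoff k t = 0.
Proof.
move=> t2; rewrite /cutoff [X in _ * X]step_le0 ?mulr0//.
have : 1 <= k.+1%:R :> R by rewrite ler1n.
nra.
Qed.

Lemma cvg_cutoff t : cutoff ^~ t @ \oo --> (if 0 < t <= 1 then 1 else 0 : R).
Proof.
have [t0|t0] := leP t 0 => /=.
  by apply: cvg_near_cst; apply: nearW => k; apply: cutoff_small; rewrite (le_trans t0).
have [t1|t1] := leP t 1 => /=.
  apply: cvg_near_cst; near=> k.
  have kt : 2 <= k.+1%:R * t.
    rewrite -ler_pdivrMr// (le_trans (ltW (truncnS_gt _)))// ler_nat ltnS.
    by near: k; exact: nbhs_infty_ge.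
  rewrite /cutoff !step_ge1 ?mulr1//; last by rewrite lerBrDr.
  by rewrite lerDl mulr_ge0// subr_ge0.
apply: cvg_near_cst; near=> k; rewrite /cutoff [X in _ * X]step_le0 ?mulr0//.
have : 1 <= k.+1%:R * (t - 1).
  rewrite -ler_pdivrMr ?subr_gt0// (le_trans (ltW (truncnS_gt _)))// ler_nat ltnS.
  by near: k; exact: nbhs_infty_ge.
lra.
Unshelve. all: by end_near. Qed.

End Cutoff.

(** * The surface measure as a cone measure *)

Section SphereMeasure.
Context {R : realType} {n : nat}.
Implicit Types (x y u : 'rV[R]_n) (i : 'I_n).
Local Notation leb := (lebesgue_rV n).
Local Notation sigma := (@surface_measure R n).
Local Notation ball1 := ([set x : 'rV[R]_n | 0 < normrV x <= 1]).

Lemma dotrV_ge0 x : 0 <= dotrV x x.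
Proof. by apply: sumr_ge0 => i _; rewrite -expr2 sqr_ge0. Qed.

Lemma normrV_ge0 x : 0 <= normrV x. Proof. exact: sqrtr_ge0. Qed.

Lemma sqr_normrV x : normrV x ^+ 2 = dotrV x x.
Proof. by rewrite sqr_sqrtr// dotrV_ge0. Qed.

Lemma sqr_coord_le x i : x ord0 i ^+ 2 <= dotrV x x.
Proof.
rewrite /dotrV (bigD1 i)//= -expr2 lerDl.
by apply: sumr_ge0 => j _; rewrite -expr2 sqr_ge0.
Qed.

Lemma coord_le_normrV x i : `|x ord0 i| <= normrV x.
Proof. by rewrite -sqrtr_sqr ler_wsqrtr// sqr_coord_le. Qed.

Lemma normrV_gt0 x : x != 0 -> 0 < normrV x.
Proof.
move=> /rV0Pn[i xi]; apply: lt_le_trans (coord_le_normrV x i).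
by rewrite normr_gt0.
Qed.

Lemma normrV0 : normrV (0 : 'rV[R]_n) = 0.
Proof.
by rewrite /normrV /dotrV big1 ?sqrtr0// => i _; rewrite mxE mul0r.
Qed.

Lemma normrV_gt0P x : (0 < normrV x) = (x != 0).
Proof.
apply/idP/idP; last exact: normrV_gt0.
by apply: contraTneq => ->; rewrite normrV0 ltxx.
Qed.

Lemma dotrVZl (t : R) x y : dotrV (t *: x) y = t * dotrV x y.
Proof. by rewrite /dotrV mulr_sumr; apply: eq_bigr => i _; rewrite mxE mulrA. Qed.

Lemma dotrVZr (t : R) x y : dotrV x (t *: y) = t * dotrV x y.
Proof. by rewrite /dotrV mulr_sumr; apply: eq_bigr => i _; rewrite mxE mulrCA. Qed.

Lemma dotrVDl x y z : dotrV (x + y) z = dotrV x z + dotrV y z.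
Proof. by rewrite /dotrV -big_split; apply: eq_bigr => i _; rewrite mxE mulrDl. Qed.

Lemma dotrVDr x y z : dotrV x (y + z) = dotrV x y + dotrV x z.
Proof. by rewrite /dotrV -big_split; apply: eq_bigr => i _; rewrite mxE mulrDr. Qed.

Lemma normrVZ (t : R) x : 0 <= t -> normrV (t *: x) = t * normrV x.
Proof.
move=> t0; rewrite /normrV dotrVZl dotrVZr mulrA -expr2 sqrtrM ?sqr_ge0//.
by rewrite sqrtr_sqr ger0_norm.
Qed.

Lemma normrV_to_sphere x : x != 0 -> normrV (to_sphere x) = 1.
Proof.
move=> x0; have := normrV_gt0 x0 => nx.
by rewrite normrVZ ?invr_ge0 ?normrV_ge0// mulVf// lt0r_neq0.
Qed.

Lemma to_sphereZ (t : R) x : 0 < t -> to_sphere (t *: x) = to_sphere x.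
Proof.
move=> t0; rewrite /to_sphere normrVZ ?ltW// scalerA invfM mulrAC mulVf ?mul1r//.
exact: lt0r_neq0.
Qed.

Lemma sphere_neq0 u : sphere n u -> u != 0.
Proof. by move=> u1; rewrite -normrV_gt0P u1. Qed.

Lemma measurable_sphere : measurable (sphere n : set 'rV[R]_n).
Proof.
rewrite (_ : sphere n = normrV @^-1` [set 1])// -[X in measurable X]setTI.
exact: measurable_normrV.
Qed.

Lemma to_sphere_sphere : to_sphere @^-1` (sphere n) = [set x : 'rV[R]_n | x != 0].
Proof.
apply/seteqP; split=> x /=; last exact: normrV_to_sphere.
move=> x1; apply/eqP => x0; move: x1; rewrite x0 /sphere/= /to_sphere scaler0 normrV0.
by move/eqP; rewrite eq_sym oner_eq0.
Qed.

Lemma measurable_neq0 : measurable [set x : 'rV[R]_n | x != 0].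
Proof.
rewrite -to_sphere_sphere -[X in measurable X]setTI.
by apply: measurable_to_sphere => //; exact: measurable_sphere.
Qed.

(** The preimage of the sphere under [to_sphere] is the set of nonzero vectors, and the restricted
    Lebesgue measure charges only the punctured ball inside it. *)
Lemma ge0_integral_surface (g : 'rV[R]_n -> \bar R) :
  measurable_fun (sphere n) g -> (forall u, sphere n u -> (0 <= g u)%E) ->
  (\int[sigma]_(u in sphere n) g u =
   n%:R%:E * \int[leb]_(x in ball1) g (to_sphere x))%E.
Proof.
move=> mg g0; have mS := measurable_sphere.
rewrite ge0_integral_mscale//; congr (_ * _)%E.
rewrite ge0_integral_pushforward//; first last.
- by move=> u; rewrite inE; exact: g0.
- exact: measurable_to_sphere.
rewrite to_sphere_sphere.
have mB := @measurable_punctured_ball R n.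
have BS : ball1 `<=` [set x : 'rV[R]_n | x != 0].
  by move=> x /=; rewrite normrV_gt0P => /andP[].
have mgt : measurable_fun [set x : 'rV[R]_n | x != 0] (g \o to_sphere).
  apply: (@measurable_comp _ _ _ _ _ _ (sphere n)) => //.
    by move=> _ [x /= x0 <-]; exact: normrV_to_sphere.
  by apply: measurable_funS (@measurable_to_sphere R n).
rewrite (ge0_negligible_integral (N := ~` ball1)) //; first last.
- by rewrite -[LHS]/(leb (~` ball1 `&` ball1)) setICl measure0.
- by move=> x x0; apply: g0; exact: normrV_to_sphere.
- exact: measurable_neq0.
- exact: measurableC.
rewrite setDE setCK setIC (setIidl BS).
by apply: eq_measure_integral => A mA AB; rewrite -[LHS]/(leb (A `&` ball1)) setIidl.
Qed.

(** Each factor [(1 + r) / (1 + x_i^2)] is at least 1. Bounded functions supported in a ball are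
    dominated by a multiple of [wrV] in this way. *)
Lemma wrV_ge_sqr (r : R) x : 0 <= r -> dotrV x x <= r -> 1 <= (1 + r) ^+ n * wrV x.
Proof.
move=> r0 xr; rewrite /wrV -[X in _ ^+ X](card_ord n) -prodr_const -big_split/=.
elim/big_ind : _ => [//|? ? ? ?|i _]; first exact: mulr_ege1.
rewrite lter_pdivlMr ?mul1r ?ltr_pwDl ?sqr_ge0// lerD2l.
exact: le_trans (sqr_coord_le x i) xr.
Qed.

Lemma integrable_ball1 : leb.-integrable ball1 (fun=> 1%E).
Proof.
have mB := @measurable_punctured_ball R n.
have iw := integrable_ZwrV n ((1 + 1) ^+ n : R).
apply: (@integrable_dominated _ _ _ _ _ (fun=> 1) (fun x => (1 + 1) ^+ n * wrV x)) => //.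
  move=> x /= /andP[_ x1]; rewrite normr1 wrV_ge_sqr// -sqr_normrV.
  by rewrite exprn_ile1 ?normrV_ge0.
exact: integrableS iw.
Qed.

Lemma surface_measure_lty : (sigma setT < +oo)%E.
Proof.
rewrite -[X in (X < _)%E]/(n%:R%:E * leb (to_sphere @^-1` setT `&` ball1))%E.
rewrite preimage_setT setTI lte_mul_pinfty// ?lee_fin//.
have /integrableP[_] := integrable_ball1.
under eq_integral do rewrite /= normr1.
by rewrite integral_cst//= ?mul1e//; exact: measurable_punctured_ball.
Qed.

Lemma integrable_cst_surface (c : R) : sigma.-integrable setT (fun=> c%:E).
Proof.
apply/integrableP; split => //=.
by rewrite integral_cst//= lte_mul_pinfty ?lee_fin//; exact: surface_measure_lty.
Qed.

Lemma sigma_finite_surface : sigma_finite setT sigma.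
Proof.
apply: (@sigma_finite_pos _ _ _ _ (fun=> 1)) => //; exact: integrable_cst_surface.
Qed.

(** Positive and negative parts are transferred separately by [ge0_integral_surface]; their
    integrals over the ball are finite and equal. *)
Lemma Rintegral_surface_eq0 (G : 'rV[R]_n -> R) :
  measurable_fun (sphere n) G ->
  leb.-integrable ball1 (fun x => (G (to_sphere x))%:E) ->
  \int[leb]_(x in ball1) G (to_sphere x) = 0 ->
  \int[sigma]_(u in sphere n) G u = 0.
Proof.
move=> mG iG; have mB := @measurable_punctured_ball R n.
rewrite /Rintegral => I0.
have {I0} : (\int[leb]_(x in ball1) (G (to_sphere x))%:E = 0)%E.
  by rewrite -(fineK (integrable_fin_num mB iG)) I0.
move=> E0; have E := E0; rewrite integralE in E.
have mGE : measurable_fun (sphere n) (EFin \o G) by exact/measurable_EFinP.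
rewrite integralE !ge0_integral_surface//.
- have := integrable_pos_fin_num mB iG; have := integrable_neg_fin_num mB iG.
  have ep : (fun x => (G (to_sphere x))%:E)^\+%E = fun x => (EFin \o G)^\+%E (to_sphere x).
    by apply/funext => x; rewrite !funeposE.
  have em : (fun x => (G (to_sphere x))%:E)^\-%E = fun x => (EFin \o G)^\-%E (to_sphere x).
    by apply/funext => x; rewrite !funenegE.
  move: E; rewrite ep em.
  set P := integral _ _ _; set M := integral _ _ _.
  move=> E fM fP; rewrite -muleBr//; last by rewrite fin_num_adde_defr.
  by rewrite E mule0.
- exact: measurable_funeneg.
- exact: measurable_funepos.
Qed.

End SphereMeasure.

Section SphereCalculus.
Context {R : realType} {n : nat}.
Implicit Types (x y u : 'rV[R]_n) (i : 'I_n).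
Local Notation e_ i := (delta_mx ord0 i : 'rV[R]_n).

Lemma continuous_sum (T : topologicalType) (I : finType) (f : I -> T -> R) (t : T) :
  (forall k, {for t, continuous (f k)}) -> {for t, continuous (fun z => \sum_k f k z)}.
Proof.
move=> cf; apply: cvg_big => [[a b]|k _]; first exact: add_continuous.
exact: cf.
Qed.

Lemma continuous_prod (T : topologicalType) (I : finType) (f : I -> T -> R) (t : T) :
  (forall k, {for t, continuous (f k)}) -> {for t, continuous (fun z => \prod_k f k z)}.
Proof.
move=> cf; apply: cvg_big => [[a b]|k _]; first exact: mul_continuous.
exact: cf.
Qed.

Lemma dotrV_delta i y : dotrV (e_ i) y = y ord0 i.
Proof.
rewrite /dotrV (bigD1 i)//= mxE !eqxx mul1r big1 ?addr0// => j ji.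
by rewrite mxE eqxx (negbTE ji) mul0r.
Qed.

Lemma dotrVC x y : dotrV x y = dotrV y x.
Proof. by apply: eq_bigr => i _; rewrite mulrC. Qed.

Lemma continuous_dotrV x : continuous (dotrV x).
Proof.
move=> y; apply: (@continuous_sum _ _ (fun i (y : 'rV[R]_n) => x ord0 i * y ord0 i)) => i.
by apply: continuousM; [exact: cst_continuous|exact: coord_continuous].
Qed.

Lemma continuous_sqrV : continuous (fun y => dotrV y y).
Proof.
move=> y; apply: (@continuous_sum _ _ (fun i (y : 'rV[R]_n) => y ord0 i * y ord0 i)) => i.
by apply: continuousM; exact: coord_continuous.
Qed.

Lemma continuous_normrV : continuous (@Defs.normrV R n).
Proof.
move=> y; apply: (@continuous_comp _ _ _ (fun y => dotrV y y) Num.sqrt).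
  exact: continuous_sqrV.
exact: sqrt_continuous.
Qed.

Lemma is_derive_dotrV x y v : is_derive y v (dotrV x) (dotrV x v).
Proof.
apply: (@is_derive_quadratic _ _ _ _ _ _ 0) => h.
by rewrite dotrVDr dotrVZr addrK subrr normr0 mul0r.
Qed.

Lemma is_derive_coord i y v : is_derive y v (fun z : 'rV[R]_n => z ord0 i) (v ord0 i).
Proof.
apply: (@is_derive_quadratic _ _ _ _ _ _ 0) => h.
by rewrite !mxE addrK subrr normr0 mul0r.
Qed.

Lemma is_derive_sqrV i y : is_derive y (e_ i) (fun y => dotrV y y) (2 * y ord0 i).
Proof.
have e1 : e_ i ord0 i = 1 by rewrite mxE !eqxx.
apply: (@is_derive_quadratic _ _ _ _ _ _ 1) => h.
rewrite dotrVDr !dotrVDl !dotrVZl !dotrVZr (dotrVC y (e_ i)) !dotrV_delta e1.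
rewrite [X in `|X|](_ : _ = h ^+ 2); last by ring.
by rewrite ger0_norm ?sqr_ge0// mul1r.
Qed.

Lemma is_derive_normrV i y : y != 0 ->
  is_derive y (e_ i) normrV (y ord0 i / normrV y).
Proof.
move=> y0; have ny := normrV_gt0 y0.
have dy : 0 < dotrV y y by rewrite -sqr_normrV exprn_gt0.
have := is_derive_comp1 (is_derive_sqrV i y) (is_derive1_sqrt dy).
rewrite (_ : _ * (2 * _) = y ord0 i / normrV y) // /Defs.normrV.
by field; rewrite sqrtr_eq0 -ltNge.
Qed.

(** [F] stands for the degree-0 homogeneous extension of a C^2 function on the sphere. [F1 i] is
    [|y| d_i F], a component of the spherical gradient, and [F2 i] is [|y| d_i (F1 i)], so that the
    [F2 i] add up to the Laplace-Beltrami operator; the factors [|y|] keep the degree at 0. The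
    fourth clause is Euler's identity: the gradient is tangential. *)
Definition sphere_C2 (F : 'rV[R]_n -> R) (F1 F2 : 'I_n -> 'rV[R]_n -> R) : Prop :=
  [/\ forall y i, y != 0 -> is_derive y (e_ i) F ((normrV y)^-1 * F1 i y),
      forall y i, y != 0 -> is_derive y (e_ i) (F1 i) ((normrV y)^-1 * F2 i y),
      forall y, y != 0 -> {for y, continuous F} /\
         forall i, {for y, continuous (F1 i)} /\ {for y, continuous (F2 i)},
      forall y, y != 0 -> \sum_i y ord0 i * F1 i y = 0
    & forall y, y != 0 -> F (to_sphere y) = F y /\ forall i, F2 i (to_sphere y) = F2 i y].

Lemma open_neq0 : open [set y : 'rV[R]_n | y != 0].
Proof.
rewrite (_ : [set y | _] = ~` [set 0]); last by apply/seteqP; split=> y /= /eqP.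
apply: closed_openC.
exact: (accessible_closed_set1 (hausdorff_accessible (@norm_hausdorff _ _))).
Qed.

Lemma compact_normrV_le (r : R) : compact [set y : 'rV[R]_n | normrV y <= r].
Proof.
apply: bounded_closed_compact.
  exists r; split; first exact: num_real.
  move=> M rM y /= yr; rewrite (le_trans _ (ltW rM))//.
  rewrite [`|y|]mx_normrE (bigmax_le _ _)//.
    exact: le_trans (normrV_ge0 y) yr.
  by move=> [i j] _ /=; rewrite (ord1 i) (le_trans (coord_le_normrV _ _)).
rewrite (_ : [set y | _] = normrV @^-1` [set t | t <= r])//.
by apply: closed_comp; [move=> y _; exact: continuous_normrV|exact: closed_le].
Qed.

Lemma bounded_on_compact (K : set 'rV[R]_n) (g : 'rV[R]_n -> R) :
  compact K -> (forall y, K y -> {for y, continuous g}) ->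
  exists2 C, 0 <= C & forall y, K y -> `|g y| <= C.
Proof.
move=> cK cg.
have : compact (g @` K).
  apply: continuous_compact => //; apply: continuous_in_subspaceT => y.
  by rewrite inE => Ky; exact: cg.
move=> /compact_bounded[M [_ hM]].
exists (`|M| + 1); first by rewrite addr_ge0.
move=> y Ky; apply: hM; last by exists y.
by rewrite (le_lt_trans (ler_norm M))// ltrDl.
Qed.

Lemma compact_support_le_wrV (r : R) (g : 'rV[R]_n -> R) : continuous g ->
  (forall y, r < normrV y -> g y = 0) -> exists C, forall y, `|g y| <= C * wrV y.
Proof.
move=> cg g0.
have cw : continuous (fun y => wrV y : R).
  move=> y; apply: (@continuous_prod _ _ (fun i (y : 'rV[R]_n) => (1 + y ord0 i ^+ 2)^-1)) => i.
  apply: (@continuous_comp _ _ _ (fun y : 'rV[R]_n => y ord0 i) (fun t : R => (1 + t ^+ 2)^-1)).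
    exact: coord_continuous.
  exact: continuous_oneDsqrV.
have [C C0 hC] := @bounded_on_compact _ (fun y => g y / wrV y) (@compact_normrV_le r)
  (fun y _ => cvgM (cg y) (cvgV (lt0r_neq0 (wrV_gt0 y)) (cw y))).
exists C => y; have [yr|ry] := leP (normrV y) r.
  rewrite -ler_pdivrMr ?wrV_gt0//.
  by have := hC y yr; rewrite normrM normfV (gtr0_norm (wrV_gt0 y)).
by rewrite g0// normr0 mulr_ge0// ltW// wrV_gt0.
Qed.

End SphereCalculus.

(** * Green's formula on the sphere *)

Section Green.
Context {R : realType} {n : nat}.
Implicit Types (x y u : 'rV[R]_n) (i : 'I_n).
Local Notation e_ i := (delta_mx ord0 i : 'rV[R]_n).
Local Notation leb := (lebesgue_rV n).

Lemma Rintegral_sum d (T : measurableType d) (mu : {measure set T -> \bar R})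
    (D : set T) (I : Type) (r : seq I) (f : I -> T -> R) : measurable D ->
  (forall k, mu.-integrable D (fun t => (f k t)%:E)) ->
  \int[mu]_(t in D) \sum_(k <- r) f k t = \sum_(k <- r) \int[mu]_(t in D) f k t.
Proof.
move=> mD If.
suff [] : mu.-integrable D (fun t => (\sum_(k <- r) f k t)%:E) /\
  \int[mu]_(t in D) \sum_(k <- r) f k t = \sum_(k <- r) \int[mu]_(t in D) f k t by [].
elim: r => [|k r [IH1 IH2]].
  rewrite big_nil; under eq_fun do rewrite big_nil; split; first exact: integrable0.
  by under eq_Rintegral do rewrite big_nil; rewrite /Rintegral integral0.
rewrite big_cons -IH2; under eq_fun do rewrite big_cons; split.
  exact: (@integrableD _ _ _ mu D mD _ _ (If k) IH1).
by under eq_Rintegral do rewrite big_cons; exact: (RintegralD mD (If k) IH1).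
Qed.

Variables (F H : 'rV[R]_n -> R) (F1 F2 H1 H2 : 'I_n -> 'rV[R]_n -> R).
Hypotheses (sF : sphere_C2 F F1 F2) (sH : sphere_C2 H H1 H2).

(** The field [F grad H - H grad F]. In its divergence the products of first derivatives cancel,
    which leaves the sum of the [G i], that is [F Delta H - H Delta F]. *)
Let Y i y := F y * H1 i y - H y * F1 i y.
Let G i y := F y * H2 i y - H y * F2 i y.

Let dY y i : y != 0 -> is_derive y (e_ i) (Y i) ((normrV y)^-1 * G i y).
Proof.
move=> y0; have [dF dF1 _ _ _] := sF; have [dH dH1 _ _ _] := sH.
have := is_deriveB (is_deriveM (dF y i y0) (dH1 y i y0)) (is_deriveM (dH y i y0) (dF1 y i y0)).
rewrite (_ : _ *: _ + _ - _ = (normrV y)^-1 * G i y) //.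
rewrite /G /GRing.scale /=; ring.
Qed.

Let cY y i : y != 0 -> {for y, continuous (Y i)}.
Proof.
move=> y0; have [_ _ cF _ _] := sF; have [_ _ cH _ _] := sH.
have [[cF0 /(_ i)[cF1 _]] [cH0 /(_ i)[cH1 _]]] := (cF y y0, cH y y0).
by apply: continuousB; exact: continuousM.
Qed.

Let cG y i : y != 0 -> {for y, continuous (G i)}.
Proof.
move=> y0; have [_ _ cF _ _] := sF; have [_ _ cH _ _] := sH.
have [[cF0 /(_ i)[_ cF1]] [cH0 /(_ i)[_ cH1]]] := (cF y y0, cH y y0).
by apply: continuousB; exact: continuousM.
Qed.

Let Yradial y : y != 0 -> \sum_i y ord0 i * Y i y = 0.
Proof.
move=> y0; have [_ _ _ /(_ y y0) eF _] := sF; have [_ _ _ /(_ y y0) eH _] := sH.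
rewrite (eq_bigr (fun i => F y * (y ord0 i * H1 i y) - H y * (y ord0 i * F1 i y))).
  by rewrite sumrB -!mulr_sumr eF eH !mulr0 subrr.
by move=> i _; rewrite /Y; ring.
Qed.

Let near0_sqr k : \forall y \near (0 : 'rV[R]_n), dotrV y y < k.+1%:R^-1.
Proof.
have : {for (0 : 'rV[R]_n), continuous (fun y => dotrV y y)} by exact: continuous_sqrV.
move=> /cvgrPdist_lt /(_ k.+1%:R^-1); rewrite invr_gt0 ltr0n => /(_ isT).
apply: filterS => y; rewrite -[X in `|X - _|]/(dotrV 0 0) -(sqr_normrV 0) normrV0 expr0n sub0r.
by rewrite normrN ger0_norm ?dotrV_ge0.
Qed.

(* The cutoff makes the field [cutoff (|y|^2) |y| (F grad H - H grad F)] globally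
   C^1; since [F grad H - H grad F] is tangential, the gradient of the cutoff does
   not contribute to the divergence. *)
Let Rintegral_cutoff k : \int[leb]_y (cutoff k (dotrV y y) * \sum_i G i y) = 0.
Proof.
have [dw ddw cdw] := @cutoff_C1 R k.
pose w := @cutoff R k.
have cw : continuous w by exact: is_derive1_continuous ddw.
(* The derivative [dw] is known only through its existence, so its support is recovered from that of
   [w] by locality. *)
have dw0 (t : R) : (\forall s \near t, w s = 0) -> dw t = 0.
  move=> w0; have : is_derive t (1 : R) w 0.
    apply: (@is_derive_near_eq _ _ (cst 0)).
    by apply: filterS w0 => s ->.
  by move=> [_ E]; case: (ddw t) => _ <-.
have dws t : t < k.+1%:R^-1 -> dw t = 0.
  move=> tk; apply: dw0; near=> s; apply: cutoff_small; apply: ltW.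
  by near: s; exact: lt_nbhsl.
have dwl t : 2 < t -> dw t = 0.
  move=> tk; apply: dw0; near=> s; apply: cutoff_large; apply: ltW.
  by near: s; exact: lt_nbhsr.
(* The factor [|y|] in [rho] compensates the [|y|^-1] of [dY]. The gradient of [rho] is radial,
   equal to [A y *: y], and [Yradial] kills its product with the field. *)
pose A y := w (dotrV y y) / normrV y + normrV y * (dw (dotrV y y) * 2).
pose rho y := w (dotrV y y) * normrV y.
have drho y i : y != 0 -> is_derive y (e_ i) rho (A y * y ord0 i).
  move=> y0.
  have := is_deriveM (is_derive_comp1 (is_derive_sqrV i y) (ddw (dotrV y y))) (is_derive_normrV i y0).
  rewrite (_ : _ *: _ + _ = A y * y ord0 i)//.
  by rewrite /GRing.scale /= /A -/w; ring.
have cwN y : {for y, continuous (fun y => w (dotrV y y))}.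
  apply: (@continuous_comp _ _ _ (fun y => dotrV y y) w); last exact: cw.
  exact: continuous_sqrV.
have cdN y : {for y, continuous (fun y => dw (dotrV y y))}.
  apply: (@continuous_comp _ _ _ (fun y => dotrV y y) dw); last exact: cdw.
  exact: continuous_sqrV.
have crho y : {for y, continuous rho} by apply: continuousM => //; exact: continuous_normrV.
have cNV y : y != 0 -> {for y, continuous (fun y => (normrV y)^-1)}.
  move=> y0; apply: continuousV; last exact: continuous_normrV.
  by rewrite lt0r_neq0 ?normrV_gt0.
have cA y : y != 0 -> {for y, continuous A}.
  move=> y0; apply: continuousD; first by apply: continuousM => //; exact: cNV.
  apply: continuousM; first exact: continuous_normrV.
  by apply: continuousM => //; exact: cst_continuous.
pose V i y := rho y * Y i y.
pose g i y := rho y * ((normrV y)^-1 * G i y) + Y i y * (A y * y ord0 i).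
have V0 i y : dotrV y y < k.+1%:R^-1 -> V i y = 0.
  by move=> yk; rewrite /V /rho /w cutoff_small ?mul0r// ltW.
have g0 i y : dotrV y y < k.+1%:R^-1 -> g i y = 0.
  move=> yk; rewrite /g /A /rho dws// /w cutoff_small ?ltW//.
  by rewrite !mul0r mulr0 addr0 mul0r mulr0 addr0.
have V2 i y : 2 < normrV y -> V i y = 0.
  move=> y2; rewrite /V /rho /w cutoff_large ?mul0r// -sqr_normrV; nra.
have g2 i y : 2 < normrV y -> g i y = 0.
  move=> y2; have y22 : 2 < dotrV y y by rewrite -sqr_normrV; nra.
  rewrite /g /A /rho dwl// /w cutoff_large ?ltW//.
  by rewrite !mul0r mulr0 addr0 mul0r mulr0 addr0.
have dV y i : is_derive y (e_ i) (V i) (g i y).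
  have [->|y0] := eqVneq y 0.
    rewrite g0; last by have := nbhs_singleton (near0_sqr k).
    apply: (@is_derive_near_eq _ _ (cst 0)).
    by apply: filterS (near0_sqr k) => z zk; rewrite V0.
  exact: (is_deriveM (drho y i y0) (dY i y0)).
have near0_cont (f : 'rV[R]_n -> R) : (forall y, dotrV y y < k.+1%:R^-1 -> f y = 0) -> {for (0 : 'rV[R]_n), continuous f}.
  move=> f0; apply: (@continuous_near_eq _ _ (cst 0)); last exact: cst_continuous.
  by apply: filterS (near0_sqr k) => z /f0.
have cV i : continuous (V i).
  move=> y; have [->|y0] := eqVneq y 0; first exact: near0_cont (V0 i).
  by apply: continuousM => //; exact: cY.
have cg i : continuous (g i).
  move=> y; have [->|y0] := eqVneq y 0; first exact: near0_cont (g0 i).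
  have c1 : {for y, continuous (fun y => rho y * ((normrV y)^-1 * G i y))}.
    by apply: continuousM => //; apply: continuousM; [exact: cNV|exact: cG].
  have c2 : {for y, continuous (fun y => Y i y * (A y * y ord0 i))}.
    apply: continuousM; first exact: cY.
    by apply: continuousM; [exact: cA|exact: coord_continuous].
  exact: continuousD c1 c2.
have bg i := compact_support_le_wrV (cg i) (g2 i).
have bV i := compact_support_le_wrV (cV i) (V2 i).
have Ig i : leb.-integrable setT (fun y => (g i y)%:E).
  have [C gC] := bg i.
  apply: (@integrable_dominated _ _ _ _ _ (g i) (fun y => C * wrV y)) => //.
    by apply: (continuous_measurable_rV openT) => y _; exact: cg.
  exact: integrable_ZwrV.
have S0 : \sum_i \int[leb]_y g i y = 0.
  rewrite big1// => i _; have [[C1 h1] [C2 h2]] := (bg i, bV i).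
  apply: (@Rintegral_partial_eq0 _ _ i (V i) (g i) (Num.max C1 C2)) => //.
    move=> y; apply: (le_trans (h2 y)); apply: ler_wpM2r; first exact/ltW/wrV_gt0.
    by rewrite le_max lexx orbT.
  move=> y; apply: (le_trans (h1 y)); apply: ler_wpM2r; first exact/ltW/wrV_gt0.
  by rewrite le_max lexx.
rewrite -[RHS]S0 -(@Rintegral_sum _ _ leb setT _ (index_enum 'I_n) g measurableT Ig).
apply: eq_Rintegral => y _; have [->|y0] := eqVneq y 0.
  rewrite [RHS]big1; last by move=> i _; apply: g0; have := nbhs_singleton (near0_sqr k).
  by rewrite cutoff_small ?mul0r// ltW//; have := nbhs_singleton (near0_sqr k).
rewrite [RHS]big_split/= [X in _ = _ + X](_ : _ = A y * \sum_i y ord0 i * Y i y); last first.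
  by rewrite mulr_sumr; apply: eq_bigr => i _; rewrite mulrCA (mulrC (Y i y)).
rewrite Yradial// mulr0 addr0 mulr_sumr; apply: eq_bigr => i _.
by rewrite /rho -/w mulrA mulfK// lt0r_neq0 ?normrV_gt0.
Unshelve. all: by end_near. Qed.

(** The divergence [S] is homogeneous of degree 0, hence bounded by its maximum on the compact
    sphere. Letting the cutoffs tend to the indicator of the punctured ball, dominated convergence
    shows that [S] has integral 0 there, and [Rintegral_surface_eq0] brings this to the sphere. *)
Lemma sphere_green : \int[surface_measure n]_(u in sphere n)
  (F u * \sum_i H2 i u - H u * \sum_i F2 i u) = 0.
Proof.
pose S y := \sum_i G i y.
have SE y : F y * \sum_i H2 i y - H y * \sum_i F2 i y = S y.
  by rewrite !mulr_sumr -sumrB.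
under eq_Rintegral do rewrite SE.
have mB := @measurable_punctured_ball R n.
have cS y : y != 0 -> {for y, continuous S}.
  by move=> y0; apply: continuous_sum => i; exact: cG.
have Sh y : y != 0 -> S (to_sphere y) = S y.
  move=> y0; have [_ _ _ _ /(_ y y0)[hF hF2]] := sF.
  have [_ _ _ _ /(_ y y0)[hH hH2]] := sH.
  by apply: eq_bigr => i _; rewrite /G hF hF2 hH hH2.
have [B B0 SB] : exists2 B, 0 <= B & forall y, y != 0 -> `|S y| <= B.
  have cSn : compact (sphere n : set 'rV[R]_n).
    have SB : (sphere n : set 'rV[R]_n) `<=` [set y | normrV y <= 1] by move=> y /= ->.
    apply: (subclosed_compact _ (@compact_normrV_le R n 1) SB).
    rewrite (_ : sphere n = normrV @^-1` [set 1])//.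
    by apply: closed_comp; [move=> y _; exact: continuous_normrV|exact: closed_eq].
  have [B B0 hB] := bounded_on_compact cSn (fun y yS => cS y (sphere_neq0 yS)).
  exists B => // y y0; rewrite -Sh//; apply: hB.
  by rewrite /sphere/= normrV_to_sphere.
have mS : measurable_fun [set y : 'rV[R]_n | y != 0] S.
  by apply: continuous_measurable_rV cS; exact: open_neq0.
(* The dominating function: all cutoffs live in [|y|^2 <= 2], where [(1 + 2)^n wrV y >= 1]. *)
have Bw y : 0 <= B * (1 + 2) ^+ n * wrV y.
  by rewrite mulr_ge0 ?mulr_ge0 ?exprn_ge0//; exact/ltW/wrV_gt0.
have Sle y c : 0 <= c <= 1 -> (2 <= dotrV y y -> c = 0) -> (y = 0 -> c = 0) ->
    `|c * S y| <= B * (1 + 2) ^+ n * wrV y.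
  move=> /andP[c0 c1] c2 cy; have [y2|/ltW y2] := leP 2 (dotrV y y).
    by rewrite c2// mul0r normr0.
  have [y0|y0] := eqVneq y 0.
    by rewrite cy// mul0r normr0.
  rewrite normrM ger0_norm// -mulrA.
  apply: (@le_trans _ _ (1 * B)); first by apply: ler_pM => //; exact: SB.
  by rewrite mul1r ler_peMr// wrV_ge_sqr.
pose ch y : R := if 0 < dotrV y y <= 1 then 1 else 0.
have chE y : ch y = if 0 < normrV y <= 1 then 1 else 0.
  rewrite /ch -sqr_normrV; congr (if _ then _ else _); congr andb.
    have [->|] := eqVneq (normrV y) 0; first by rewrite expr0n ltxx.
    by move=> yn; rewrite exprn_even_gt0// lt0r yn normrV_ge0.
  by rewrite expr_le1// normrV_ge0.
have mcS k : measurable_fun setT (fun y => cutoff k (dotrV y y) * S y).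
  have [dw ddw _] := @cutoff_C1 R k.
  apply: (continuous_measurable_rV openT) => y _.
  have cc : {for y, continuous (fun y => cutoff k (dotrV y y))}.
    apply: (@continuous_comp _ _ _ (fun y => dotrV y y) (cutoff k)).
      exact: continuous_sqrV.
    exact: is_derive1_continuous ddw _.
  have [->|y0] := eqVneq y 0; last by apply: continuousM => //; exact: cS.
  apply: (@continuous_near_eq _ _ (cst 0)); last exact: cst_continuous.
  apply: filterS (near0_sqr k) => z zk.
  by rewrite cutoff_small ?mul0r// ltW.
have lim : (fun k => \int[leb]_y (cutoff k (dotrV y y) * S y)) @ \oo --> \int[leb]_y (ch y * S y).
  apply: (@cvg_Rintegral_dominated _ _ _ _ _ (fun k y => cutoff k (dotrV y y) * S y) _
    (fun y => B * (1 + 2) ^+ n * wrV y)) => //.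
  - move=> y _; apply: cvgMl; exact: cvg_cutoff.
  - exact: integrable_ZwrV.
  - move=> k y _; apply: Sle; first exact: cutoff_ge0_le1.
      exact: cutoff_large.
    by move=> ->; apply: cutoff_small; rewrite ltW//; have := nbhs_singleton (near0_sqr k).
have I0 : \int[leb]_y (ch y * S y) = 0.
  have E : (fun k => \int[leb]_y (cutoff k (dotrV y y) * S y)) = (fun=> 0).
    by apply/funext => k; exact: Rintegral_cutoff.
  have c0 : (fun _ : nat => 0 : R) @ \oo --> (0 : R) by exact: cvg_cst.
  by move: lim; rewrite E => lim; exact: (cvg_unique _ lim c0).
have chS (y : 'rV[R]_n) : 0 < normrV y <= 1 -> ch y * S y = S (to_sphere y).
  by move=> y1; rewrite chE y1 mul1r Sh// -normrV_gt0P; case/andP : y1.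
have mSt : measurable_fun [set y : 'rV[R]_n | 0 < normrV y <= 1] (S \o to_sphere).
  have BS : [set x : 'rV[R]_n | 0 < normrV x <= 1] `<=` [set x : 'rV[R]_n | x != 0].
    by move=> x /=; rewrite normrV_gt0P => /andP[].
  apply: eq_measurable_fun (measurable_funS measurable_neq0 BS mS) => y.
  by rewrite inE => /BS/= /Sh ->.
apply: Rintegral_surface_eq0.
- exact: (measurable_funS measurable_neq0 (fun u => @sphere_neq0 R n u) mS).
- apply: (@integrable_dominated _ _ _ _ _ (S \o to_sphere) (fun=> B)) => //.
    move=> y /= y1; apply: SB; rewrite -normrV_gt0P normrV_to_sphere//.
    by rewrite -normrV_gt0P; case/andP : y1.
  have := @integrableZl _ _ _ leb _ mB B _ integrable_ball1.
  by apply: eq_integrable => // y _; rewrite mule1.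
- rewrite -[RHS]I0 [RHS](@Rintegral_setT_support _ _ _ _ _ _ mB).
    by apply: eq_Rintegral => y; rewrite inE => /= y1; rewrite chS.
  by move=> y /= y1; rewrite chE; case: ifP => [h|_]; [case: (y1 h)|rewrite mul0r].
Qed.

End Green.

(** * Spherical Laplacian of a ridge function *)

Section RidgeFunction.
Context {R : realType} {n : nat}.
Implicit Types (x y u : 'rV[R]_n) (i : 'I_n).
Local Notation e_ i := (delta_mx ord0 i : 'rV[R]_n).
Variables (h h' h'' : R -> R) (x0 : 'rV[R]_n).
Hypotheses (dh : forall t, is_derive t (1 : R) h (h' t))
  (dh' : forall t, is_derive t (1 : R) h' (h'' t)) (ch'' : continuous h'').

Let om i y := y ord0 i / normrV y.
Let s y := dotrV x0 y / normrV y.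

(** The degree-0 extension of [u |-> h (x0.u)]. The recurring factor [x0_i - s y * om i y] is
    [|y| d_i s], the i-th component of the projection of [x0] onto the tangent space at [y/|y|]. *)
Definition ridge y : R := h (s y).
Definition ridge1 i y : R := h' (s y) * (x0 ord0 i - s y * om i y).
Definition ridge2 i y : R := h'' (s y) * (x0 ord0 i - s y * om i y) ^+ 2 +
  h' (s y) * (- (x0 ord0 i - s y * om i y) * om i y - s y * (1 - om i y ^+ 2)).

Let dV y i : y != 0 -> is_derive y (e_ i) (fun y => (normrV y)^-1) (- (normrV y)^-1 ^+ 2 * om i y).
Proof.
move=> y0; have ny := normrV_gt0 y0.
have := is_derive_comp1 (is_derive_normrV i y0)
  (@is_deriveV R id (normrV y) 1 1 (lt0r_neq0 ny) (is_derive_id _ _)).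
rewrite (_ : _ * (y ord0 i / normrV y) = - (normrV y)^-1 ^+ 2 * om i y) //.
by rewrite /GRing.scale /= /om exprVn; ring.
Qed.

Let ds y i : y != 0 -> is_derive y (e_ i) s ((normrV y)^-1 * (x0 ord0 i - s y * om i y)).
Proof.
move=> y0; have := is_deriveM (is_derive_dotrV x0 y (e_ i)) (dV i y0).
rewrite (dotrVC x0 (e_ i)) dotrV_delta (_ : _ *: _ + _ = (normrV y)^-1 * (x0 ord0 i - s y * om i y))//.
by rewrite /GRing.scale /= /s; ring.
Qed.

Let dom y i : y != 0 -> is_derive y (e_ i) (om i) ((normrV y)^-1 * (1 - om i y ^+ 2)).
Proof.
move=> y0; have := is_deriveM (is_derive_coord i y (e_ i)) (dV i y0).
rewrite mxE !eqxx (_ : _ *: _ + _ = (normrV y)^-1 * (1 - om i y ^+ 2))//.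
by rewrite /GRing.scale /= /om; ring.
Qed.

Let cV y : y != 0 -> {for y, continuous (fun y => (normrV y)^-1)}.
Proof.
move=> y0; apply: continuousV; last exact: continuous_normrV.
by rewrite lt0r_neq0 ?normrV_gt0.
Qed.

Let cs y : y != 0 -> {for y, continuous s}.
Proof. by move=> y0; apply: continuousM; [exact: continuous_dotrV|exact: cV]. Qed.

Let com y i : y != 0 -> {for y, continuous (om i)}.
Proof. by move=> y0; apply: continuousM; [exact: coord_continuous|exact: cV]. Qed.

Let sum_om y : y != 0 -> \sum_i y ord0 i * om i y = normrV y.
Proof.
move=> y0; under eq_bigr do rewrite mulrA; rewrite -mulr_suml.
by rewrite -[X in X / _]/(dotrV y y) -sqr_normrV expr2 mulfK// lt0r_neq0 ?normrV_gt0.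
Qed.

Let dx y i : y != 0 ->
  is_derive y (e_ i) (fun y => x0 ord0 i - s y * om i y)
    ((normrV y)^-1 * (- (x0 ord0 i - s y * om i y) * om i y - s y * (1 - om i y ^+ 2))).
Proof.
move=> y0.
have := is_deriveB (is_derive_cst (x0 ord0 i) y (e_ i)) (is_deriveM (ds i y0) (dom i y0)).
rewrite (_ : 0 - _ = (normrV y)^-1 *
  (- (x0 ord0 i - s y * om i y) * om i y - s y * (1 - om i y ^+ 2)))//.
by rewrite /GRing.scale /=; ring.
Qed.

Let cx y i : y != 0 -> {for y, continuous (fun y => x0 ord0 i - s y * om i y)}.
Proof.
move=> y0; apply: continuousB; first exact: cst_continuous.
by apply: continuousM; [exact: cs|exact: com].
Qed.

Lemma ridge_sphere_C2 : sphere_C2 ridge ridge1 ridge2.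
Proof.
have ch := is_derive1_continuous dh.
have ch' := is_derive1_continuous dh'.
have cc (f : R -> R) y : y != 0 -> continuous f -> {for y, continuous (fun y => f (s y))}.
  by move=> y0 cf; apply: (@continuous_comp _ _ _ s f); [exact: cs|exact: cf].
split.
- move=> y i y0; have := is_derive_comp1 (ds i y0) (dh (s y)).
  by rewrite mulrCA.
- move=> y i y0; have := is_deriveM (is_derive_comp1 (ds i y0) (dh' (s y))) (dx i y0).
  rewrite (_ : _ *: _ + _ = (normrV y)^-1 * ridge2 i y)//.
  by rewrite /GRing.scale /= /ridge2; ring.
- move=> y y0; split; first exact: cc.
  move=> i; split; first by apply: continuousM; [exact: cc|exact: cx].
  have c1 : {for y, continuous (fun y => h'' (s y) * (x0 ord0 i - s y * om i y) ^+ 2)}.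
    apply: continuousM; first exact: cc.
    apply: (@continuous_comp _ _ _ (fun y => x0 ord0 i - s y * om i y) (fun t : R => t ^+ 2)).
      exact: cx.
    exact: exprn_continuous.
  have c2 : {for y, continuous (fun y => - (x0 ord0 i - s y * om i y) * om i y)}.
    by apply: continuousM; [apply: continuousN; exact: cx|exact: com].
  have c3 : {for y, continuous (fun y => s y * (1 - om i y ^+ 2))}.
    apply: continuousM; first exact: cs.
    apply: continuousB; first exact: cst_continuous.
    apply: (@continuous_comp _ _ _ (om i) (fun t : R => t ^+ 2)); first exact: com.
    exact: exprn_continuous.
  have c4 : {for y, continuous (fun y => h' (s y))} by exact: cc.
  exact: (continuousD c1 (continuousM c4 (continuousB c2 c3))).
- move=> y y0; have ny := normrV_gt0 y0.
  rewrite (eq_bigr (fun i => h' (s y) * (x0 ord0 i * y ord0 i) -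
      h' (s y) * s y * (y ord0 i * om i y))); last by move=> i _; rewrite /ridge1; ring.
  rewrite sumrB -!mulr_sumr sum_om// -[X in _ * X - _]/(dotrV x0 y) -mulrA /s.
  by rewrite divfK ?subrr// lt0r_neq0.
- move=> y y0; have ny := normrV_gt0 y0.
  have E1 : s (to_sphere y) = s y.
    by rewrite /s normrV_to_sphere// dotrVZr divr1 mulrC.
  have E2 i : om i (to_sphere y) = om i y.
    by rewrite /om normrV_to_sphere// mxE divr1 mulrC.
  split; first by rewrite /ridge E1.
  by move=> i; rewrite /ridge2 E1 E2.
Qed.

Lemma ridge_sphere u : sphere n u -> ridge u = h (dotrV x0 u).
Proof. by rewrite /ridge /s => ->; rewrite divr1. Qed.

(** The tangential projection of [x0] has squared length [|x0|^2 - t^2], and [u |-> x0.u] is a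
    spherical harmonic of degree 1, with eigenvalue [-(n - 1)]. *)
Lemma ridge_laplacian u : sphere n u -> let t := dotrV x0 u in
  \sum_i ridge2 i u = (dotrV x0 x0 - t ^+ 2) * h'' t - (n%:R - 1) * t * h' t.
Proof.
move=> u1 t; have uu : dotrV u u = 1 by rewrite -sqr_normrV u1 expr1n.
rewrite (eq_bigr (fun i => h'' t * (x0 ord0 i * x0 ord0 i) +
   (2 * t * h' t + h'' t * t ^+ 2) * (u ord0 i * u ord0 i) +
   (- 2 * t * h'' t - h' t) * (x0 ord0 i * u ord0 i) - t * h' t)); last first.
  by move=> i _; rewrite /ridge2 /s /om u1 !divr1 -/t; ring.
rewrite !big_split/= -!mulr_sumr sumr_const card_ord.
rewrite -[\sum_i x0 _ _ * x0 _ _]/(dotrV x0 x0) -[\sum_i u _ _ * u _ _]/(dotrV u u).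
by rewrite -[\sum_i x0 _ _ * u _ _]/t uu -mulr_natl; ring.
Qed.

End RidgeFunction.

(** Selecting the part by a boolean lets each real statement be proved once for both parts. *)
Definition part {R : realType} (b : bool) (z : R[i]) : R :=
  if b then complex.Im z else complex.Re z.

Lemma partD {R : realType} b (z w : R[i]) : part b (z + w) = part b z + part b w.
Proof. by case: z => ? ?; case: w => ? ?; case: b. Qed.

Lemma part0 {R : realType} b : part b (0 : R[i]) = 0.
Proof. by case: b. Qed.

Lemma part_sum {R : realType} b (I : Type) (r : seq I) (f : I -> R[i]) :
  part b (\sum_(i <- r) f i) = \sum_(i <- r) part b (f i).
Proof. by apply: (big_morph (part b)); [exact: partD|exact: part0]. Qed.

Lemma normr_part_le {R : realType} b (z : R[i]) : `|part b z| <= Normc.normc z.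
Proof.
case: z => x y; rewrite /part /=; case: b => /=.
  by rewrite -sqrtr_sqr ler_wsqrtr// lerDr sqr_ge0.
by rewrite -sqrtr_sqr ler_wsqrtr// lerDl sqr_ge0.
Qed.

Lemma normc_le_parts {R : realType} (z : R[i]) :
  Normc.normc z <= `|part false z| + `|part true z|.
Proof.
case: z => x y; rewrite /part /=.
rewrite -[leRHS]ger0_norm ?addr_ge0// -sqrtr_sqr ler_wsqrtr//.
rewrite sqrrD !real_normK ?num_real// -addrA lerD2l lerDr.
by rewrite mulrn_wge0// mulr_ge0.
Qed.

(** * Functions on [Y^{n+1}] through their homogeneous extensions *)

Section ExtY.
Context {R : realType} {n : nat}.
Local Notation ambient := ('rV[R]_n * R * R)%type.
Local Notation domY := (@domY R n).
Local Notation e_ i := (delta_mx ord0 i : 'rV[R]_n).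
Implicit Types (F : spaceY R n -> R[i]) (z : ambient) (x y u : 'rV[R]_n) (a b t : R).

Lemma extY_to_sphere F y y' b a : to_sphere y = to_sphere y' ->
  extY F (y, b, a) = extY F (y', b, a).
Proof. by rewrite /extY /= => ->. Qed.

Lemma extYZ F t y b a : 0 < t -> extY F (t *: y, b, a) = extY F (y, b, a).
Proof. by move=> t0; apply: extY_to_sphere; exact: to_sphereZ. Qed.

Lemma extY_dom F z : domY z ->
  exists2 w : spaceY R n, extY F z = F w & val w = (to_sphere z.1.1, z.1.2, z.2).
Proof.
case: z => -[x b] a [/= x0 a0]; rewrite /extY /=.
case: insubP => [w _ <-|]; first by exists w.
by rewrite /= normrV_to_sphere// eqxx a0.
Qed.

Lemma extY_sum (I : Type) (r : seq I) (F : I -> spaceY R n -> R[i]) z :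
  extY (\sum_(i <- r) F i) z = \sum_(i <- r) extY (F i) z.
Proof.
rewrite /extY; case: insub => [w|]; first by rewrite fct_sumE.
by rewrite big1.
Qed.

Lemma open_domY : open domY.
Proof.
rewrite (_ : domY = (fun z : ambient => z.1.1) @^-1` [set y | y != 0] `&`
    (fun z : ambient => z.2) @^-1` [set x : R | 0 < x])//.
apply: openI; apply: open_comp; try exact: open_neq0; try exact: open_gt.
  by move=> z _; apply: (@cvg_comp _ _ _ fst fst); exact: cvg_fst.
by move=> z _; exact: cvg_snd.
Qed.

Lemma smooth_on_part (V : normedModType R) (U : set V) (f : V -> R[i]) c :
  csmooth_on U f -> smooth_on U (part c \o f).
Proof. by move=> [sr si]; case: c; [exact: si|exact: sr]. Qed.

Lemma part_cderive (V : normedModType R) (f : V -> R[i]) c v (p : V) :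
  part c (cderive v f p) = 'D_v (part c \o f) p.
Proof. by case: c. Qed.

(** The left side differentiates at the projected point [x/|x|] along [e_i]. By homogeneity this is
    the derivative at [x] along [|x| e_i]. *)
Lemma part_extY_derive_u F c i z : smoothY F -> domY z ->
  part c (extY (derive_u i F) z) = normrV z.1.1 * 'D_(e_ i, 0, 0) (part c \o extY F) z.
Proof.
move=> sF dz; have [w -> wE] := extY_dom (derive_u i F) dz.
rewrite /derive_u /deriveY part_cderive wE.
case: z dz {wE} => -[x b] a dz /=; have x0 := normrV_gt0 dz.1.
have xn0 := lt0r_neq0 x0.
have dd : derivable (part c \o extY F) ((x, b, a) : ambient) (e_ i, 0, 0).
  exact: (smooth_on_part c sF [::] dz).2.
have [_ <-] := is_deriveZdir (normrV x) (derivableP dd).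
rewrite /derive /=; congr (lim (_ @ 0^')); apply/funext => h.
congr (_ *: (part c _ - part c _)).
  rewrite -[LHS]/(extY F (h *: e_ i + to_sphere x, h *: 0 + b, h *: 0 + a)).
  rewrite -[RHS]/(extY F (h *: (normrV x *: e_ i) + x, h *: (normrV x *: 0) + b,
    h *: (normrV x *: 0) + a)).
  by rewrite !scaler0 -(extYZ F _ _ _ x0) scalerDr !scalerA mulfV// scale1r (mulrC h).
by rewrite extYZ// invr_gt0.
Qed.

Lemma smoothY_derive_u i F : smoothY F -> smoothY (derive_u i F).
Proof. by move=> sF; have [] := derive_u_lin i 0 sF sF. Qed.

Lemma smoothY_iter_laplace k F : smoothY F -> smoothY (iter k (@laplace_beltrami R n) F).
Proof. by move=> sF; have [] := lin_on_iter k (@laplace_beltrami_lin R n) 0 sF sF. Qed.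

Let slice b a y : ambient := (y, b, a).

Let continuous_slice b a : continuous (slice b a).
Proof.
move=> y A /nbhs_ballP[e /= e0 eA]; apply/nbhs_ballP; exists e => // z yz.
by apply: eA; split; [split|] => //=; exact: ballxx.
Qed.

(** This identifies [laplace_beltrami], defined through [derive_u], with the operator of
    [sphere_green], for each fixed [b] and [a]. *)
Lemma extY_sphere_C2 F c b a : smoothY F -> 0 < a ->
  sphere_C2 (fun y => part c (extY F (y, b, a)))
            (fun i y => part c (extY (derive_u i F) (y, b, a)))
            (fun i y => part c (extY (derive_u i (derive_u i F)) (y, b, a))).
Proof.
move=> sF a0; have dz y : y != 0 -> domY (y, b, a) by [].
have dslice G i y : smoothY G -> y != 0 ->
    is_derive y (e_ i) (fun y => part c (extY G (y, b, a)))
      ((normrV y)^-1 * part c (extY (derive_u i G) (y, b, a))).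
  move=> sG y0; rewrite (part_extY_derive_u _ _ sG (dz y y0)).
  rewrite mulKf ?lt0r_neq0 ?normrV_gt0//.
  apply: (@is_derive_affine _ _ _ (slice b a) (part c \o extY G) y (e_ i) (e_ i, 0, 0)).
    move=> h; rewrite -[RHS]/(h *: e_ i + y, h *: 0 + b, h *: 0 + a).
    by rewrite !scaler0 !add0r.
  by apply/derivableP; exact: (smooth_on_part c sG [::] (dz y y0)).2.
have cslice G y : smoothY G -> y != 0 -> {for y, continuous (fun y => part c (extY G (y, b, a)))}.
  move=> sG y0; apply: (@continuous_comp _ _ _ (slice b a) (part c \o extY G)).
    exact: continuous_slice.
  exact: (smooth_on_part c sG [::] (dz y y0)).1.
split.
- move=> y i y0; exact: (dslice F i y sF y0).
- move=> y i y0; exact: (dslice (derive_u i F) i y (smoothY_derive_u i sF) y0).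
- move=> y y0; split; first exact: (cslice F y sF y0).
  move=> i; have s1 := smoothY_derive_u i sF; split.
    exact: (cslice (derive_u i F) y s1 y0).
  exact: (cslice (derive_u i (derive_u i F)) y (smoothY_derive_u i s1) y0).
- move=> y y0.
  under eq_bigr => i _ do rewrite (part_extY_derive_u c i sF (dz y y0)) mulrCA.
  rewrite -mulr_sumr.
  have := @is_derive_smooth_sum R ambient domY (part c \o extY F) (y, b, a) 'I_n
    (index_enum 'I_n) (fun i => y ord0 i) (fun i => (e_ i, 0, 0)) open_domY
    (smooth_on_part c sF) (dz y y0).
  rewrite (_ : \sum_i _ *: _ = ((y, 0, 0) : ambient)); last first.
    rewrite [in RHS](row_sum_delta y); elim/big_ind2 : _ => //.
      by move=> u1 u2 v1 v2 -> ->; rewrite -[LHS]/(u1 + v1, 0 + 0, 0 + 0) !addr0.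
    by move=> i _; rewrite -[LHS]/(y ord0 i *: e_ i, y ord0 i *: 0, y ord0 i *: 0) !scaler0.
  rewrite -[X in is_derive X]add0r -[X in is_derive (X + _)](scale0r ((y, 0, 0) : ambient)).
  move=> /is_derive_line[_ <-].
  (* Euler's identity: the sum has become the derivative in the radial direction [(y, 0, 0)], along
     which the extension is constant as long as [1 + t > 0]. *)
  have [_ ->] : is_derive (0 : R) (1 : R)
      (fun t : R => (part c \o extY F) (t *: ((y, 0, 0) : ambient) + (y, b, a))) 0.
    apply: (@is_derive_near_eq _ _ (cst ((part c \o extY F) (y, b, a)))).
    near=> t; rewrite -[X in _ = (part c \o extY F) X]/(t *: y + y, t *: 0 + b, t *: 0 + a).
    rewrite scaler0 !add0r -[X in t *: y + X]scale1r -scalerDl /= extYZ//.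
    rewrite -ltrBlDr sub0r; near: t; apply: lt_nbhsr; exact: ltrN10.
  by rewrite mulr0.
- move=> y y0; have ny := normrV_gt0 y0.
  by split=> [|i]; rewrite (extYZ _ _ _ _ (_ : 0 < (normrV y)^-1)) ?invr_gt0.
Unshelve. all: by end_near. Qed.

Lemma extY_laplace F c u b a : smoothY F ->
  part c (extY (laplace_beltrami (n:=n) F) (u, b, a)) =
  \sum_i part c (extY (derive_u i (derive_u i F)) (u, b, a)).
Proof. by move=> sF; rewrite /laplace_beltrami extY_sum part_sum. Qed.

End ExtY.

(** * Functions of one variable with vanishing moments *)

Section S0Families.
Context {R : realType}.
Local Notation leb := (@lebesgue_measure R).
Implicit Types (p : nat -> R -> R) (N j k m : nat) (t M : R).

(* A function in [S_0(R)] is handled together with all its derivatives: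
   [p k] is the k-th derivative of [p 0]. *)
Definition rapid_family p : Prop :=
  (forall k t, is_derive t (1 : R) (p k) (p k.+1 t)) /\
  forall j k, exists M, forall t, `|t| ^+ j * `|p k t| <= M.

Definition S0_family p : Prop :=
  rapid_family p /\ forall m, \int[leb]_t (t ^+ m * p 0%N t) = 0.

Definition bounded_family N p M : Prop :=
  forall j k, (j <= N)%N -> (k <= N)%N -> forall t, `|t| ^+ j * `|p k t| <= M.

Lemma bounded_familyW N N' p M : (N <= N')%N ->
  bounded_family N' p M -> bounded_family N p M.
Proof. by move=> NN' b j k jN kN; apply: b; exact: leq_trans NN'. Qed.

Lemma bounded_family_ge0 N p M : bounded_family N p M -> 0 <= M.
Proof.
move=> /(_ 0%N 0%N (leq0n _) (leq0n _) 0); apply: le_trans.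
by rewrite mulr_ge0 ?exprn_ge0.
Qed.

Lemma le_w1 (a : R) t M : `|t| ^+ 0 * `|a| <= M -> `|t| ^+ 2 * `|a| <= M ->
  `|a| <= 2 * M * (1 + t ^+ 2)^-1.
Proof.
rewrite expr0 mul1r real_normK ?num_real// => h0 h2.
rewrite ler_pdivlMr ?ltr_pwDl ?sqr_ge0// mulrDr mulr1 (mulrC `|a|); lra.
Qed.

Lemma rapid_le_w1 p j k : rapid_family p ->
  exists M, forall t, `|t ^+ j * p k t| <= M * (1 + t ^+ 2)^-1.
Proof.
move=> [_ rp]; have [M1 h1] := rp j k; have [M2 h2] := rp j.+2 k.
exists (2 * Num.max M1 M2) => t; apply: le_w1.
  by rewrite expr0 mul1r normrM normrX le_max h1.
by rewrite normrM normrX mulrA -exprD le_max h2 orbT.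
Qed.

Lemma rapid_continuous p k : rapid_family p -> continuous (p k).
Proof. by case=> dp _; exact: is_derive1_continuous (dp k). Qed.

Lemma rapid_continuousX p j k : rapid_family p -> continuous (fun t : R => t ^+ j * p k t).
Proof.
by move=> rp t; apply: cvgM; [exact: exprn_continuous|exact: rapid_continuous].
Qed.

Lemma rapid_integrable p j k : rapid_family p ->
  leb.-integrable setT (fun t => (t ^+ j * p k t)%:E).
Proof.
move=> rp; have [M hM] := rapid_le_w1 j k rp.
apply: (@integrable_dominated _ (measurableTypeR R) _ leb _ (fun t => t ^+ j * p k t)
  (fun t => M * (1 + t ^+ 2)^-1)) => //.
  by apply: continuous_measurable_fun; exact: rapid_continuousX.
exact: integrable_Zw1.
Qed.

Lemma rapid_integrable0 p k (D : set (measurableTypeR R)) : measurable D -> rapid_family p ->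
  leb.-integrable D (EFin \o p k).
Proof.
move=> mD rp; apply: (@integrableS _ _ _ leb setT) => //.
by apply: eq_integrable (rapid_integrable 0 k rp) => // s _; rewrite /= expr0 mul1r.
Qed.

(** The derivative of [t^m p_0] has integral 0. For [m = 0] the coefficient [m%:R] cancels the term
    where the predecessor is truncated. *)
Lemma rapid_integration_by_parts p m : rapid_family p ->
  \int[leb]_t (t ^+ m * p 1%N t) = - (m%:R * \int[leb]_t (t ^+ m.-1 * p 0%N t)).
Proof.
move=> rp; have [dp _] := rp.
have dX t : is_derive t (1 : R) (fun t : R => t ^+ m) (m%:R * t ^+ m.-1).
  have := is_deriveX m (is_derive_id t (1 : R)); rewrite exprfctE.
  by rewrite -[_ *: 1]/(_ * 1) mulr1.
have dG t : is_derive t (1 : R) (fun t => t ^+ m * p 0%N t)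
    (t ^+ m * p 1%N t + m%:R * (t ^+ m.-1 * p 0%N t)).
  have := is_deriveM (dX t) (dp 0%N t).
  rewrite (_ : _ *: _ + _ = t ^+ m * p 1%N t + m%:R * (t ^+ m.-1 * p 0%N t)) //.
  by rewrite /GRing.scale /=; ring.
have [M1 h1] := rapid_le_w1 m 0 rp; have [M2 h2] := rapid_le_w1 m 1 rp.
have [M3 h3] := rapid_le_w1 m.-1 0 rp.
have := @Rintegral_derive_eq0 R (fun t => t ^+ m * p 0%N t) _
  (`|M1| + `|M2| + m%:R * `|M3|) dG.
have i1 := rapid_integrable m 1 rp; have i2 := rapid_integrable m.-1 0 rp.
rewrite (RintegralD measurableT i1); last first.
  exact: (@integrableZl _ _ _ leb setT measurableT m%:R _ i2).
rewrite (RintegralZl _ measurableT i2) => H; apply/eqP; rewrite -addr_eq0; apply/eqP.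
apply: H.
- move=> t; apply: cvgD; first exact: rapid_continuousX.
  by apply: cvgM; [exact: cvg_cst|exact: rapid_continuousX].
- move=> t; apply: (le_trans (h1 t)); apply: ler_wpM2r; first exact/ltW/w1_gt0.
  by rewrite (le_trans (ler_norm _))// -addrA lerDl addr_ge0// mulr_ge0.
- move=> t; apply: (le_trans (ler_normD _ _)).
  rewrite (_ : _ * _^-1 = `|M1| * (1 + t ^+ 2)^-1 + `|M2| * (1 + t ^+ 2)^-1 +
     m%:R * (`|M3| * (1 + t ^+ 2)^-1)); last by rewrite !mulrDl mulrA.
  have w0 := ltW (w1_gt0 t).
  apply: lerD.
    rewrite (le_trans (h2 t))// -mulrDl; apply: ler_wpM2r => //.
    by rewrite (le_trans (ler_norm _))// lerDr.
  rewrite normrM ger0_norm//; apply: ler_wpM2l => //.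
  by rewrite (le_trans (h3 t))// ler_wpM2r// ler_norm.
Qed.

(** Leibniz's rule for the k-th derivative of [t p_0]; at [k = 0] the second term has coefficient
    0. *)
Definition mulX_family p k t : R := t * p k t + k%:R * p k.-1 t.

Lemma bounded_mulX N p M : bounded_family N.+1 p M ->
  bounded_family N (mulX_family p) ((N%:R + 1) * M).
Proof.
move=> b j k jN kN t; have M0 := bounded_family_ge0 b.
rewrite /mulX_family.
apply: (@le_trans _ _ (`|t| ^+ j.+1 * `|p k t| + k%:R * (`|t| ^+ j * `|p k.-1 t|))).
  rewrite exprSr mulrCA -mulrA -mulrDr; apply: ler_wpM2l; first exact: exprn_ge0.
  by rewrite (le_trans (ler_normD _ _))// !normrM (ger0_norm (ler0n _ k)) lexx.
rewrite addrC mulrDl mul1r; apply: lerD.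
  apply: ler_pM; rewrite ?mulr_ge0 ?exprn_ge0 ?ler_nat ?ler0n//.
  by apply: b; [exact: ltnW|rewrite (leq_trans (leq_pred _))// ltnW].
by apply: b; rewrite // ltnW.
Qed.

Lemma S0_mulX p : S0_family p -> S0_family (mulX_family p).
Proof.
move=> [[dp rp] mp]; split; [split|].
- move=> k t.
  have d1 := is_deriveM (is_derive_id t (1 : R)) (dp k t).
  have d2 : is_derive t (1 : R) (fun t => k%:R * p k.-1 t) (k%:R * p k t).
    case: k {d1} => [|k] /=.
      rewrite mul0r (_ : (fun t : R => 0 * p 0%N t) = cst 0); first exact: is_derive_cst.
      by apply/funext => s; rewrite mul0r.
    exact: is_deriveZ.
  have := is_deriveD d1 d2.
  rewrite (_ : _ + _ = mulX_family p k.+1 t)//.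
  by rewrite /mulX_family /GRing.scale /= mulr1 -natr1; ring.
- move=> j k; have [M1 h1] := rp j.+1 k; have [M2 h2] := rp j k.-1.
  exists (M1 + k%:R * M2) => t; rewrite /mulX_family.
  apply: (@le_trans _ _ (`|t| ^+ j.+1 * `|p k t| + k%:R * (`|t| ^+ j * `|p k.-1 t|))).
    rewrite exprSr mulrCA -mulrA -mulrDr; apply: ler_wpM2l; first exact: exprn_ge0.
    by rewrite (le_trans (ler_normD _ _))// !normrM (ger0_norm (ler0n _ k)) lexx.
  by apply: lerD => //; apply: ler_wpM2l.
- move=> m; rewrite -[RHS](mp m.+1); apply: eq_Rintegral => t _.
  by rewrite /mulX_family mul0r addr0 mulrA -exprSr.
Qed.

Definition anti_family p k t : R :=
  if k is k'.+1 then p k' t else \int[leb]_(s in `]-oo, t]) p 0%N s.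

Lemma is_derive_anti p t : rapid_family p ->
  is_derive t (1 : R) (anti_family p 0) (p 0%N t).
Proof.
move=> rp; have [] := @continuous_FTC1 R (p 0%N) -oo%O t (t + 1).
- by rewrite ltrDl.
- exact: rapid_integrable0.
- by rewrite ltNyr.
- exact: rapid_continuous.
by move=> d E; split; [exact: d|rewrite -E derive1E].
Qed.

(** The vanishing mean makes the antiderivative computable from either end of the line, hence small
    at both. *)
Lemma anti_family_ge0E p t : S0_family p ->
  anti_family p 0 t = - \int[leb]_(s in `]t, +oo[) p 0%N s.
Proof.
move=> [rp /(_ 0%N) m0].
have E : [set: R] = `]-oo, t]%classic `|` `]t, +oo[%classic.
  by apply/seteqP; split => // s _ /=; rewrite !in_itv/= andbT; case: (leP s t); [left|right].
have : \int[leb]_s p 0%N s = 0.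
  by rewrite -m0; apply: eq_Rintegral => s _; rewrite expr0 mul1r.
rewrite [in X in X -> _]E Rintegral_setU//=.
- by move=> /eqP; rewrite addr_eq0 => /eqP.
- by rewrite -E; exact: rapid_integrable0.
- apply/disj_setPS => s [] /=; rewrite !in_itv/= andbT => h1 h2.
  by move: (le_lt_trans h1 h2); rewrite ltxx.
Qed.

(** The 2 comes from [le_w1]; the 1 makes the constant at least 1, so that it also serves for the
    entries that are merely shifted. *)
Definition anti_const : R := 1 + 2 * \int[leb]_t ((1 + t ^+ 2)^-1).

Lemma anti_const_ge1 : 1 <= anti_const.
Proof.
rewrite /anti_const lerDl mulr_ge0// Rintegral_ge0// => t _.
exact/ltW/w1_gt0.
Qed.

(** On the half-line that starts at [t] and leads away from the origin, [|t| <= |s|], so that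
    [|t|^j] passes under the integral; two more powers of [s] make the integrand integrable. *)
Lemma rapid_anti p j M : S0_family p ->
  (forall t, `|t| ^+ j * `|p 0%N t| <= M) -> (forall t, `|t| ^+ j.+2 * `|p 0%N t| <= M) ->
  forall t, `|t| ^+ j * `|anti_family p 0 t| <= anti_const * M.
Proof.
move=> sp h1 h2 t.
have M0 : 0 <= M by apply: le_trans (h1 0); rewrite mulr_ge0 ?exprn_ge0.
have [rp _] := sp.
have key (D : set (measurableTypeR R)) : measurable D -> (forall s, D s -> `|t| <= `|s|) ->
    `|t| ^+ j * `|\int[leb]_(s in D) p 0%N s| <= anti_const * M.
  move=> mD Ds; have iD := rapid_integrable0 0 mD rp.
  rewrite -[X in X * _](ger0_norm (exprn_ge0 j (normr_ge0 t))) -normrM.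
  rewrite -(RintegralZl _ mD iD).
  have mp : measurable_fun D (fun s => `|t| ^+ j * p 0%N s).
    apply: measurable_funM => //.
    by apply: measurable_funTS; apply: continuous_measurable_fun; exact: rapid_continuous.
  apply: (@le_trans _ _ (\int[leb]_(s in D) (2 * M * (1 + s ^+ 2)^-1))).
    apply: normr_Rintegral_le => //; last exact: integrableS (integrable_Zw1 _).
    move=> s Ss; rewrite normrM ger0_norm ?exprn_ge0//.
    apply: (@le_trans _ _ `| `|s| ^+ j * p 0%N s|).
      rewrite normrM (ger0_norm (exprn_ge0 j (normr_ge0 s))).
      by apply: ler_wpM2r => //; apply: lerXn2r; rewrite ?nnegrE ?Ds.
    apply: le_w1; first by rewrite expr0 mul1r normrM ger0_norm ?exprn_ge0.
    by rewrite normrM ger0_norm ?exprn_ge0// mulrA -exprD.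
  apply: (@le_trans _ _ (\int[leb]_s (2 * M * (1 + s ^+ 2)^-1))).
    rewrite [leLHS]Rintegral_mkcond; apply: le_Rintegral => //.
    - rewrite -restrict_EFin; apply/(integrable_mkcond _ mD).
      exact: integrableS (integrable_Zw1 _).
    - exact: integrable_Zw1.
    - move=> s _; rewrite patchE; case: ifP => // _.
      by rewrite !mulr_ge0//; exact/ltW/w1_gt0.
  rewrite (RintegralZl _ measurableT integrable_oneDsqrV) /anti_const.
  by rewrite [leRHS]mulrDl mul1r mulrAC lerDr.
have [t0|t0] := leP t 0.
  apply: key => // s /=; rewrite in_itv/= => st.
  by rewrite !ler0_norm// ?lerN2// (le_trans st).
rewrite anti_family_ge0E// normrN; apply: key => // s /=; rewrite in_itv/= andbT => st.
by rewrite !gtr0_norm// ?(lt_trans t0 st)// ltW.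
Qed.

Lemma bounded_anti N p M : S0_family p -> bounded_family N.+2 p M ->
  bounded_family N (anti_family p) (anti_const * M).
Proof.
move=> sp b j [|k] jN kN t; have M0 := bounded_family_ge0 b.
  by apply: rapid_anti => // s; apply: b => //; rewrite ltnW// ltnW.
rewrite /= -[leLHS]mul1r ler_pM ?anti_const_ge1 ?mulr_ge0 ?exprn_ge0//.
by apply: b; [rewrite ltnW// ltnW|rewrite ltnW// ltnW// ltnW].
Qed.

(** By parts, [m + 1] times the moment of order [m] of the antiderivative is minus the moment of
    order [m + 1] of [p]. *)
Lemma S0_anti p : S0_family p -> S0_family (anti_family p).
Proof.
move=> sp; have [rp mp] := sp; have [dp bp] := rp.
have rA : rapid_family (anti_family p).
  split=> [k t|j k]; first by case: k => [|k]; [exact: is_derive_anti|exact: dp].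
  case: k => [|k]; last exact: bp.
  have [M1 h1] := bp j 0%N; have [M2 h2] := bp j.+2 0%N.
  exists (anti_const * Num.max M1 M2); apply: rapid_anti => // t.
    by rewrite le_max h1.
  by rewrite le_max h2 orbT.
split => // m; have := rapid_integration_by_parts m.+1 rA.
rewrite mp => /eqP; rewrite eq_sym oppr_eq0 mulf_eq0 pnatr_eq0/= => /eqP.
by [].
Qed.

End S0Families.

(** * Ridge transforms and their decay *)

Section RidgeTransform.
Context {R : realType} {n : nat}.
Local Notation leb := (@lebesgue_measure R).
Local Notation T3 := ('rV[R]_n * measurableTypeR R * measurableTypeR R)%type.
Implicit Types (x y v u : 'rV[R]_n) (z : T3) (phi : T3 -> R) (psi : R -> R) (M K : R)
  (s : seq 'rV[R]_n).

Definition mu3 : {measure set T3 -> \bar R} := ((surface_measure n \x leb) \x leb)%E.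

Definition dom3 : set T3 := sphere n `*` setT `*` `]0, +oo[.

(** The variable [u] contributes no factor, as the surface measure is finite. *)
Definition w3 z : R := (1 + z.1.2 ^+ 2)^-1 * (1 + z.2 ^+ 2)^-1.

Lemma w3_gt0 z : 0 < w3 z.
Proof. by rewrite mulr_gt0 ?w1_gt0. Qed.

Lemma measurable_dom3 : measurable dom3.
Proof.
apply: measurableX; last exact: measurable_itv.
by apply: measurableX => //; exact: measurable_sphere.
Qed.

Lemma dom3P z : dom3 z <-> normrV z.1.1 = 1 /\ 0 < z.2.
Proof. by rewrite /dom3 /= in_itv/= andbT; split=> [[[]]|[]]. Qed.

Definition sphere_line : {measure set ('rV[R]_n * measurableTypeR R) -> \bar R} :=
  (surface_measure n \x leb)%E.

Lemma integrable_sphere_line : sphere_line.-integrable setT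
  (fun q : 'rV[R]_n * measurableTypeR R => ((1 + q.2 ^+ 2)^-1)%:E).
Proof.
have := @integrable_prodM _ _ 'rV[R]_n (measurableTypeR R) R (surface_measure n) leb
  sigma_finite_surface (fun=> 1) (fun t => (1 + t ^+ 2)^-1)
  (integrable_cst_surface 1) integrable_oneDsqrV.
by apply: eq_integrable => // q _; rewrite mul1r.
Qed.

Lemma sigma_finite_sphere_line : sigma_finite setT sphere_line.
Proof.
exact: (@sigma_finite_pos _ ('rV[R]_n * measurableTypeR R)%type _ sphere_line
  (fun q => (1 + q.2 ^+ 2)^-1) (fun q => w1_gt0 q.2) integrable_sphere_line).
Qed.

Lemma integrable_w3 : mu3.-integrable dom3 (EFin \o w3).
Proof.
apply: (@integrableS _ _ _ _ setT) => //; first exact: measurable_dom3.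
exact: (@integrable_prodM _ _ ('rV[R]_n * measurableTypeR R)%type (measurableTypeR R) R
  sphere_line leb sigma_finite_sphere_line
  (fun q => (1 + q.2 ^+ 2)^-1) (fun t => (1 + t ^+ 2)^-1)
  integrable_sphere_line integrable_oneDsqrV).
Qed.

Definition mass3 : R := \int[mu3]_(z in dom3) w3 z.

Lemma mass3_ge0 : 0 <= mass3.
Proof. by apply: Rintegral_ge0 => z _; exact/ltW/w3_gt0. Qed.

Definition dominated3 phi M : Prop :=
  measurable_fun dom3 phi /\ forall z, dom3 z -> `|phi z| <= M * w3 z.

Lemma integrable_Zw3 (C : R) : mu3.-integrable dom3 (fun z => (C * w3 z)%:E).
Proof. exact: (@integrableZl _ _ _ _ _ measurable_dom3 C _ integrable_w3). Qed.

Lemma dominated3_integrable phi M : dominated3 phi M -> mu3.-integrable dom3 (EFin \o phi).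
Proof.
move=> [mphi bphi]; apply: (integrable_dominated measurable_dom3 mphi bphi).
exact: integrable_Zw3.
Qed.

Lemma dominated3_Rintegral_le phi M : dominated3 phi M ->
  `|\int[mu3]_(z in dom3) phi z| <= M * mass3.
Proof.
move=> [mphi bphi].
apply: (le_trans (normr_Rintegral_le measurable_dom3 mphi bphi (integrable_Zw3 M))).
by rewrite RintegralZl//; [exact: measurable_dom3|exact: integrable_w3].
Qed.

Lemma continuous_measurable_dom3 (f : 'rV[R]_n * R * R -> R) :
  (forall z, z.1.1 != 0 -> 0 < z.2 -> {for z, continuous f}) ->
  measurable_fun dom3 (f : T3 -> R).
Proof.
move=> cf.
have m1 : measurable_fun (domY (n:=n)) f.
  by apply: (continuous_measurable_ambient (@open_domY R n)) => z [z0 a0]; exact: cf.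
have sub : dom3 `<=` domY (n:=n).
  by move=> z /dom3P[z1 z2]; exact: (conj (sphere_neq0 z1) z2).
have mD : measurable (domY (n:=n) : set ('rV[R]_n * R * R)).
  apply: (@open_measurable_ambient R n); exact: (@open_domY R n).
exact: (measurable_funS mD sub m1).
Qed.

Definition l1norm v : R := \sum_i `|v ord0 i|.

Lemma l1norm_ge0 v : 0 <= l1norm v. Proof. exact: sumr_ge0. Qed.

Lemma normr_dotrV_le v u : normrV u = 1 -> `|dotrV v u| <= l1norm v.
Proof.
move=> u1; apply: (le_trans (ler_norm_sum _ _ _)); apply: ler_sum => i _.
by rewrite normrM ler_piMr// -u1 coord_le_normrV.
Qed.

(** The factors created by differentiation in [x] along [s], kept apart from [phi] because the
    identity behind the decay concerns the empty list. *)
Definition dirs s u : R := \prod_(v <- s) dotrV v u.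

Definition dirs_bound s : R := \prod_(v <- s) l1norm v.

Lemma dirs_bound_ge0 s : 0 <= dirs_bound s.
Proof. by apply: prodr_ge0 => v _; exact: l1norm_ge0. Qed.

Lemma normr_dirs_le s u : normrV u = 1 -> `|dirs s u| <= dirs_bound s.
Proof.
move=> u1; rewrite /dirs normr_prod; apply: ler_prod => v _.
by rewrite normr_ge0 normr_dotrV_le.
Qed.

Definition ridge_kernel s phi psi x z : R :=
  phi z * dirs s z.1.1 * psi ((dotrV x z.1.1 - z.1.2) / z.2).

Definition ridge_transform s phi psi x : R :=
  \int[mu3]_(z in dom3) ridge_kernel s phi psi x z.

Lemma continuous_ridge_var x (z : 'rV[R]_n * R * R) : 0 < z.2 ->
  {for z, continuous (fun z : 'rV[R]_n * R * R => (dotrV x z.1.1 - z.1.2) / z.2)}.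
Proof.
move=> z0.
have c11 : {for z, continuous (fun z : 'rV[R]_n * R * R => z.1.1)}.
  by apply: (@cvg_comp _ _ _ fst fst); exact: cvg_fst.
have c12 : {for z, continuous (fun z : 'rV[R]_n * R * R => z.1.2)}.
  by apply: (@cvg_comp _ _ _ fst snd); [exact: cvg_fst|exact: cvg_snd].
have c2 : {for z, continuous (fun z : 'rV[R]_n * R * R => z.2)} by exact: cvg_snd.
apply: continuousM; last by apply: continuousV; rewrite ?lt0r_neq0.
apply: continuousB => //.
by apply: (@continuous_comp _ _ _ (fun z : 'rV[R]_n * R * R => z.1.1) (dotrV x)); last exact: continuous_dotrV.
Qed.

Lemma measurable_ridge_kernel s phi psi x : measurable_fun dom3 phi -> continuous psi ->
  measurable_fun dom3 (ridge_kernel s phi psi x).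
Proof.
move=> mphi cpsi; apply: measurable_funM; first apply: measurable_funM => //.
  apply: measurable_prod => v _; apply: measurable_funTS; apply: measurable_sum => i.
  apply: measurable_funM => //.
  apply: (measurableT_comp (@measurable_coord R n i)).
  by apply: measurableT_comp; exact: measurable_fst.
apply: (@continuous_measurable_dom3 (fun z => psi ((dotrV x z.1.1 - z.1.2) / z.2))) => z _ z0.
apply: (@continuous_comp _ _ _ (fun z : 'rV[R]_n * R * R => (dotrV x z.1.1 - z.1.2) / z.2) psi).
  exact: continuous_ridge_var.
exact: cpsi.
Qed.

Lemma dominated3_kernel s phi psi x M K : dominated3 phi M -> continuous psi ->
  (forall t, `|psi t| <= K) ->
  dominated3 (ridge_kernel s phi psi x) (dirs_bound s * K * M).
Proof.
move=> [mphi bphi] cpsi bpsi; split; first exact: measurable_ridge_kernel.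
move=> z zD; have [z1 z2] := (dom3P z).1 zD.
rewrite /ridge_kernel !normrM (mulrC `|phi z|) mulrAC -[leRHS]mulrA.
apply: ler_pM; rewrite ?mulr_ge0 ?normr_ge0//; last exact: bphi.
by apply: ler_pM => //; exact: normr_dirs_le.
Qed.

Lemma ridge_transform_le s phi psi x M K : dominated3 phi M -> continuous psi ->
  (forall t, `|psi t| <= K) ->
  `|ridge_transform s phi psi x| <= dirs_bound s * K * M * mass3.
Proof. by move=> dphi cpsi bpsi; apply: dominated3_Rintegral_le; exact: dominated3_kernel. Qed.

(** Differentiation under the integral sign along the line [t *: v + x]. The bound of
    [dominated3_kernel] does not depend on the point, so one integrable function dominates for all
    [t] in []-1, 1[]. *)
Lemma is_derive_ridge_transform s phi (p0 p1 : R -> R) x v M M' K K' :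
  dominated3 phi M -> dominated3 (fun z => phi z / z.2) M' ->
  (forall t, is_derive t (1 : R) p0 (p1 t)) -> continuous p1 ->
  (forall t, `|p0 t| <= K) -> (forall t, `|p1 t| <= K') ->
  is_derive x v (ridge_transform s phi p0)
    (ridge_transform (v :: s) (fun z => phi z / z.2) p1 x).
Proof.
move=> dphi dphi' dp cp1 b0 b1.
have cp0 := is_derive1_continuous dp.
pose f t z := ridge_kernel s phi p0 (t *: v + x) z.
have df t z : dom3 z -> is_derive t (1 : R) (f ^~ z)
    (ridge_kernel (v :: s) (fun z => phi z / z.2) p1 (t *: v + x) z).
  move=> /dom3P[z1 z2].
  pose l := fun t : R => (dotrV (t *: v + x) z.1.1 - z.1.2) / z.2.
  have dl : is_derive t (1 : R) l (dotrV v z.1.1 / z.2).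
    apply: (@is_derive_quadratic _ _ _ _ _ _ 0) => h.
    rewrite /l -[h%:A]/(h * 1) mulr1 !dotrVDl !dotrVZl [X in `|X|](_ : _ = 0) ?normr0 ?mul0r//.
    ring.
  have := is_derive_comp1 dl (dp (l t)) => d1.
  have := is_deriveZ (phi z * dirs s z.1.1) d1.
  rewrite (_ : _ *: _ = ridge_kernel (v :: s) (fun z => phi z / z.2) p1 (t *: v + x) z)//.
  rewrite /ridge_kernel /dirs big_cons -/(l t) /GRing.scale /=; ring.
have dker t := dominated3_kernel s (t *: v + x) dphi cp0 b0.
have dker' t := dominated3_kernel (v :: s) (t *: v + x) dphi' cp1 b1.
have I0 : (`](-1), 1[%classic : set R) 0 by rewrite /= in_itv/= ltrN10 ltr01.
pose g z := dirs_bound (v :: s) * K' * M' * w3 z.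
have M'0 z : dom3 z -> 0 <= g z by move=> zD; exact: le_trans (normr_ge0 _) ((dker' 0).2 z zD).
have g0 z : 0 <= `|dirs_bound (v :: s) * K' * M'| * w3 z.
  by rewrite mulr_ge0//; exact/ltW/w3_gt0.
have intf (t : R) (_ : (`](-1), 1[%classic : set R) t) : mu3.-integrable dom3 (EFin \o f t).
  exact: dominated3_integrable (dker t).
have derf (t : R) z (_ : (`](-1), 1[%classic : set R) t) : dom3 z -> derivable (f ^~ z) t 1.
  by move=> zD; case: (df t z zD).
have d1E t z : dom3 z -> partial1of2 f t z =
    ridge_kernel (v :: s) (fun z => phi z / z.2) p1 (t *: v + x) z.
  by move=> zD; rewrite partial1of2E; case: (df t z zD).
have gub (t : R) z (_ : (`](-1), 1[%classic : set R) t) : dom3 z ->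
    `|partial1of2 f t z| <= `|dirs_bound (v :: s) * K' * M'| * w3 z.
  move=> zD; rewrite d1E//; apply: (le_trans ((dker' t).2 z zD)).
  by apply: ler_wpM2r; [exact/ltW/w3_gt0|exact: ler_norm].
have cv := @cvg_differentiation_under_integral R _ _ mu3 f dom3 measurable_dom3 0 (-1) 1 I0
  intf derf _ g0 (integrable_Zw3 _) gub.
apply: is_derive_from_line.
have E : \int[mu3]_(z in dom3) partial1of2 f 0 z =
    ridge_transform (v :: s) (fun z => phi z / z.2) p1 x.
  apply: eq_Rintegral => z; rewrite inE => zD.
  by rewrite d1E// scale0r add0r.
rewrite E in cv.
have {}cv : (fun h : R => h^-1 *: (ridge_transform s phi p0 ((h *: 1 + 0) *: v + x) -
    ridge_transform s phi p0 (0 *: v + x))) @ 0^' -->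
    ridge_transform (v :: s) (fun z => phi z / z.2) p1 x.
  apply: cvg_trans cv; apply: near_eq_cvg; apply: nearW => h.
  by rewrite -[h%:A]/(h * 1) mulr1.
by split; [apply/cvg_ex; eexists; exact: cv|exact/cvg_lim].
Qed.

Lemma l1norm_le_norm v : l1norm v <= n%:R * `|v|.
Proof.
rewrite /l1norm (le_trans (ler_sum _ (G := fun=> `|v|) _))//; last first.
  by rewrite sumr_const card_ord mulr_natl.
move=> i _; rewrite [`|v|]mx_normrE.
exact: (@le_bigmax _ _ _ 0 (fun ij : 'I_1 * 'I_n => `|v ij.1 ij.2|) (ord0, i)).
Qed.

Lemma lipschitz_of_derive (p0 p1 : R -> R) K :
  (forall t, is_derive t (1 : R) p0 (p1 t)) -> (forall t, `|p1 t| <= K) ->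
  forall t r, `|p0 t - p0 r| <= K * `|t - r|.
Proof.
move=> dp b1 t r.
wlog tr : t r / r <= t.
  by move=> H; have [/H//|/ltW/H] := leP r t; rewrite distrC (distrC r).
have [c _ ->] := MVT_segment tr (fun q _ => dp q)
  (continuous_subspaceT (is_derive1_continuous dp)).
by rewrite normrM ler_wpM2r.
Qed.

(** Directional derivatives alone do not give continuity, whence a Lipschitz bound: the mean value
    theorem for [p0] produces [|(x - y).u| / a], and the second domination absorbs [1/a]. *)
Lemma continuous_ridge_transform s phi (p0 p1 : R -> R) M M' K K' :
  dominated3 phi M -> dominated3 (fun z => phi z / z.2) M' ->
  (forall t, is_derive t (1 : R) p0 (p1 t)) ->
  (forall t, `|p0 t| <= K) -> (forall t, `|p1 t| <= K') ->
  continuous (ridge_transform s phi p0).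
Proof.
move=> dphi dphi' dp b0 b1.
have cp0 := is_derive1_continuous dp.
have K0 : 0 <= K' := le_trans (normr_ge0 _) (b1 0).
(* The factor [n] comes from [l1norm_le_norm]; the 1 makes the constant positive. *)
pose C := `|dirs_bound s * K' * M' * mass3| * n%:R + 1.
have C0 : 0 < C by rewrite ltr_wpDl// mulr_ge0.
have lip x y : `|ridge_transform s phi p0 x - ridge_transform s phi p0 y| <= C * `|x - y|.
  have kx := dominated3_kernel s x dphi cp0 b0; have ky := dominated3_kernel s y dphi cp0 b0.
  rewrite /ridge_transform -(RintegralB measurable_dom3 (dominated3_integrable kx)
    (dominated3_integrable ky)).
  have dom : dominated3 (fun z => ridge_kernel s phi p0 x z - ridge_kernel s phi p0 y z)
     (dirs_bound s * K' * M' * l1norm (x - y)).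
    split; first exact: measurable_funB kx.1 ky.1.
    move=> z zD; have [z1 z2] := (dom3P z).1 zD.
    rewrite /ridge_kernel -mulrBr !normrM.
    have := lipschitz_of_derive dp b1 ((dotrV x z.1.1 - z.1.2) / z.2) ((dotrV y z.1.1 - z.1.2) / z.2).
    rewrite -mulrBl opprB addrA subrK normrM -[- dotrV y _]mulN1r -dotrVZl -dotrVDl scaleN1r => L.
    have b2 := normr_dotrV_le (x - y) z1; have b3 := dphi'.2 z zD.
    rewrite normrM in b3.
    apply: (@le_trans _ _ (`|phi z| * dirs_bound s * (K' * (l1norm (x - y) * `|z.2^-1|)))).
      apply: ler_pM; rewrite ?mulr_ge0//; first by apply: ler_wpM2l => //; exact: normr_dirs_le.
      by apply: (le_trans L); apply: ler_wpM2l => //; apply: ler_wpM2r.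
    rewrite [leLHS](_ : _ = dirs_bound s * K' * l1norm (x - y) * (`|phi z| * `|z.2^-1|)); last by ring.
    rewrite [leRHS](_ : _ = dirs_bound s * K' * l1norm (x - y) * (M' * w3 z)); last by ring.
    by apply: ler_wpM2l => //; rewrite !mulr_ge0 ?dirs_bound_ge0 ?l1norm_ge0.
  apply: (le_trans (dominated3_Rintegral_le dom)).
  rewrite mulrAC (le_trans (ler_wpM2r (l1norm_ge0 _) (ler_norm _)))//.
  rewrite (le_trans (ler_wpM2l (normr_ge0 _) (l1norm_le_norm _)))//.
  by rewrite mulrA ler_wpM2r// /C lerDl.
exact: lipschitz_continuous C0 lip.
Qed.

End RidgeTransform.

(** * Fubini's theorem on [Y^{n+1}] *)

Section FubiniY.
Context {R : realType} {n : nat}.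
Local Notation leb := (@lebesgue_measure R).
Local Notation T3 := ('rV[R]_n * measurableTypeR R * measurableTypeR R)%type.
Local Notation T2 := ('rV[R]_n * measurableTypeR R)%type.
Local Notation sphere_line := (@sphere_line R n).
Local Notation mu3 := (@mu3 R n).
Local Notation dom3 := (@dom3 R n).
Local Notation w3 := (@w3 R n).
Local Notation sigma := (@surface_measure R n).
Variables (Q : T3 -> R) (M : R).
Hypothesis dQ : dominated3 Q M.

(** After extension by zero the bound by [|M| * w3] holds on the whole product, so that every slice
    in every variable is integrable. *)
Let P := Q \_ dom3.

Let PE (u : 'rV[R]_n) (b a : R) :
  P (u, b, a) = if (u \in sphere n) && (0 < a) then Q (u, b, a) else 0.
Proof.
rewrite /P patchE; case: ifPn.
  by rewrite inE => /dom3P[/= u1 a0]; rewrite mem_set// a0.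
move=> /negP nD; case: ifPn => // /andP[]; rewrite inE => u1 a0.
by exfalso; apply: nD; rewrite inE; apply/dom3P.
Qed.

Let mP : measurable_fun setT P.
Proof. by apply/(measurable_restrict _ (@measurable_dom3 R n)) => //; rewrite setTI; exact: dQ.1. Qed.

Let bP z : `|P z| <= `|M| * w3 z.
Proof.
rewrite /P patchE; case: ifPn => [|_].
  rewrite inE => /dQ.2 h; apply: (le_trans h); apply: ler_wpM2r; last exact: ler_norm.
  exact/ltW/w3_gt0.
by rewrite normr0 mulr_ge0//; exact/ltW/w3_gt0.
Qed.

Let iP : mu3.-integrable setT (EFin \o P).
Proof.
rewrite /P -restrict_EFin; apply/(integrable_mkcond _ (@measurable_dom3 R n)).
exact: dominated3_integrable dQ.
Qed.

Let iPa (q : T2) : leb.-integrable setT (fun a => (P (q, a))%:E).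
Proof.
apply: (@integrable_dominated _ (measurableTypeR R) _ leb _ (fun a => P (q, a))
  (fun a => `|M| * (1 + q.2 ^+ 2)^-1 * (1 + a ^+ 2)^-1)) => //.
- exact: (measurableT_comp mP (measurable_pair1 q)).
- by move=> a _; rewrite -mulrA; exact: bP.
- exact: integrable_Zw1.
Qed.

Let mPq (a : R) : measurable_fun setT (fun q : T2 => P (q, a)).
Proof. exact: (measurableT_comp mP (measurable_pair2 a)). Qed.

Let iPq (a : R) : sphere_line.-integrable setT (fun q => (P (q, a))%:E).
Proof.
apply: (@integrable_dominated _ T2 _ sphere_line _ (fun q => P (q, a))
  (fun q => `|M| * (1 + a ^+ 2)^-1 * (1 + q.2 ^+ 2)^-1)) => //.
- by move=> q _; rewrite -mulrA (mulrC (_^-1)); exact: bP.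
- exact: (@integrableZl _ _ _ sphere_line setT measurableT _ _ integrable_sphere_line).
Qed.

Let iPu (b a : R) : sigma.-integrable setT (fun u => (P (u, b, a))%:E).
Proof.
apply: (@integrable_dominated _ 'rV[R]_n _ sigma _ (fun u => P (u, b, a))
  (fun u => `|M| * ((1 + b ^+ 2)^-1 * (1 + a ^+ 2)^-1))) => //.
- exact: (measurableT_comp (mPq a) (measurable_pair2 b)).
- exact: integrable_cst_surface.
Qed.

Let iPb (u : 'rV[R]_n) (a : R) : leb.-integrable setT (fun b => (P (u, b, a))%:E).
Proof.
apply: (@integrable_dominated _ (measurableTypeR R) _ leb _ (fun b => P (u, b, a))
  (fun b => `|M| * (1 + a ^+ 2)^-1 * (1 + b ^+ 2)^-1)) => //.
- exact: (measurableT_comp (mPq a) (measurable_pair1 u)).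
- by move=> b _; rewrite -mulrA (mulrC (_^-1)); exact: (bP (u, b, a)).
- exact: integrable_Zw1.
Qed.

Let Rintegral_mu3E : \int[mu3]_(z in dom3) Q z = \int[mu3]_z P z.
Proof. by rewrite Rintegral_mkcond. Qed.

Let Rintegral_fun0 d (T : measurableType d) (mu : {measure set T -> \bar R}) (f : T -> R) :
  (forall t, f t = 0) -> \int[mu]_t f t = 0.
Proof.
by move=> f0; rewrite (_ : f = fun=> 0) ?/Rintegral ?integral0//; apply/funext.
Qed.

(** The variable [u] is integrated first. Through this lemma Green's formula, which holds for fixed
    [b] and [a], reaches the triple integral. *)
Lemma Rintegral_mu3_eq0 :
  (forall b a, 0 < a -> \int[sigma]_(u in sphere n) Q (u, b, a) = 0) ->
  \int[mu3]_(z in dom3) Q z = 0.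
Proof.
move=> Q0; rewrite Rintegral_mu3E.
rewrite (Rintegral_prod21 sigma_finite_sphere_line iP iPq).
apply: Rintegral_fun0 => a.
have -> : \int[sphere_line]_q P (q, a) = \int[leb]_b \int[sigma]_u P (u, b, a).
  exact: (@Rintegral_prod21 _ _ 'rV[R]_n (measurableTypeR R) R sigma leb
    sigma_finite_surface (fun q => P (q, a)) (iPq a) (fun b => iPu b a)).
apply: Rintegral_fun0 => b; have [a0|a0] := leP a 0.
  by apply: Rintegral_fun0 => u; rewrite PE ltNge a0 andbF.
rewrite -[RHS](Q0 b a a0) [RHS]Rintegral_mkcond; apply: eq_Rintegral => u _.
by rewrite PE a0 andbT patchE.
Qed.

(** The product measure puts [a] innermost while the synthesis operator puts [b] innermost, so the
    two are exchanged for each fixed [u]. *)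
Lemma Rintegral_mu3_iterated : \int[mu3]_(z in dom3) Q z =
  \int[sigma]_(u in sphere n) \int[leb]_(a in `]0, +oo[) \int[leb]_b Q (u, b, a).
Proof.
rewrite Rintegral_mu3E (Rintegral_prod12 sigma_finite_sphere_line iP iPa).
have iG := integrable_Rintegral2 sigma_finite_sphere_line iP iPa.
have bG (u : 'rV[R]_n) (b : R) : `|\int[leb]_a P (u, b, a)| <=
    `|M| * (1 + b ^+ 2)^-1 * \int[leb]_a ((1 + a ^+ 2)^-1).
  rewrite -(RintegralZl _ measurableT integrable_oneDsqrV).
  apply: normr_Rintegral_le => //; last exact: integrable_Zw1.
    exact: (measurableT_comp mP (measurable_pair1 (u, b))).
  by move=> a _; rewrite -mulrA; exact: bP.
have iGb (u : 'rV[R]_n) : leb.-integrable setT (fun b => (\int[leb]_a P (u, b, a))%:E).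
  apply: (@integrable_dominated _ (measurableTypeR R) _ leb _ (fun b => \int[leb]_a P (u, b, a))
    (fun b => `|M| * (\int[leb]_a ((1 + a ^+ 2)^-1)) * (1 + b ^+ 2)^-1)) => //.
  - have mG : measurable_fun setT (fun q : T2 => \int[leb]_a P (q, a)).
      by apply/measurable_EFinP; case/integrableP : iG.
    exact: (measurableT_comp mG (measurable_pair1 u)).
  - by move=> b _; rewrite mulrAC; exact: bG.
  - exact: integrable_Zw1.
have -> : \int[sphere_line]_q \int[leb]_a P (q, a) =
    \int[sigma]_u \int[leb]_b \int[leb]_a P (u, b, a).
  exact: (@Rintegral_prod12 _ _ 'rV[R]_n (measurableTypeR R) R sigma leb
    sigma_finite_surface (fun q => \int[leb]_a P (q, a)) iG iGb).
rewrite [RHS]Rintegral_mkcond; apply: eq_Rintegral => u _; rewrite patchE.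
case: ifPn => [uS|uS]; last first.
  by apply: Rintegral_fun0 => b; apply: Rintegral_fun0 => a; rewrite PE (negbTE uS).
pose Pu (q : measurableTypeR R * measurableTypeR R) := P (u, q.1, q.2).
have mPu : measurable_fun setT Pu.
  apply: (measurableT_comp mP); apply: measurable_fun_pair; last exact: measurable_snd.
  by apply: measurable_fun_pair; [exact: measurable_cst|exact: measurable_fst].
have iPu2 : (leb \x leb)%E.-integrable setT (EFin \o Pu).
  apply: (@integrable_dominated _ (measurableTypeR R * measurableTypeR R)%type _ (leb \x leb)%E _ Pu
    (fun q => `|M| * (1 + q.1 ^+ 2)^-1 * (1 + q.2 ^+ 2)^-1)) => //.
    by move=> q _; rewrite -mulrA; exact: bP.
  apply: (@integrable_prodM _ _ (measurableTypeR R) (measurableTypeR R) R leb leb _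
    (fun b => `|M| * (1 + b ^+ 2)^-1) (fun a => (1 + a ^+ 2)^-1)).
  - exact: sigma_finiteT.
  - exact: integrable_Zw1.
  - exact: integrable_oneDsqrV.
have sl : sigma_finite setT leb by exact: sigma_finiteT.
transitivity (\int[(leb \x leb)%E]_q Pu q).
  by rewrite (Rintegral_prod12 sl iPu2 (fun b => iPa (u, b))).
rewrite (Rintegral_prod21 sl iPu2 (iPb u)) [RHS]Rintegral_mkcond.
apply: eq_Rintegral => a _; rewrite patchE; case: ifPn => [|a0].
  rewrite inE /= in_itv/= andbT => a0; apply: eq_Rintegral => b _.
  by rewrite /Pu PE uS a0.
apply: Rintegral_fun0 => b; rewrite /Pu PE uS; case: ifPn => //= a1.
by move: a0; rewrite mem_set//= in_itv/= a1.
Qed.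

End FubiniY.

Section Decay.
Context {R : realType} {n : nat}.
Local Notation T3 := ('rV[R]_n * measurableTypeR R * measurableTypeR R)%type.
Local Notation L := (@laplace_beltrami R n).
Local Notation mu3 := (@mu3 R n).
Local Notation dom3 := (@dom3 R n).
Implicit Types (Phi : spaceY R n -> R[i]) (z : T3) (x u : 'rV[R]_n) (c : bool)
  (p q r k m N : nat) (f g : nat -> R -> R) (M B C : R).

Definition boundedY N Phi M : Prop :=
  forall k s r, (k <= N)%N -> (s <= N)%N -> (r <= N)%N -> forall w : spaceY R n,
    ((val w).2 ^+ s + ((val w).2 ^+ s)^-1) * (1 + (val w).1.2 ^+ 2) `^ (r%:R / 2) *
    Normc.normc (iter k L Phi w) <= M.

Definition rapidY Phi : Prop := smoothY Phi /\ forall N, exists M, boundedY N Phi M.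

Lemma boundedYW N N' Phi M : (N <= N')%N -> boundedY N' Phi M -> boundedY N Phi M.
Proof. by move=> NN' b k s r kN sN rN; apply: b; exact: leq_trans NN'. Qed.

(** Separate exponents for [a] and [1/a] keep everything in natural numbers: antiderivatives raise
    [p], derivatives in [x] raise [q], the substitution [x.u = a tau + b] raises [p] and [r], and
    Green's formula raises [k]. *)
Definition symbol c p q r k Phi z : R :=
  z.2 ^+ p * z.2^-1 ^+ q * z.1.2 ^+ r * part c (extY (iter k L Phi) z).

Lemma symbol_div c p q r k Phi :
  (fun z => symbol c p q r k Phi z / z.2) = symbol c p q.+1 r k Phi.
Proof. by apply/funext => z; rewrite /symbol exprS; ring. Qed.

Lemma pow_le_powDV (a : R) p q s : 0 < a -> (p <= s)%N -> (q <= s)%N ->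
  a ^+ p * a^-1 ^+ q <= a ^+ s + (a ^+ s)^-1.
Proof.
move=> a0 ps qs; have ai : 0 < a^-1 by rewrite invr_gt0.
have [a0' ai'] := (ltW a0, ltW ai).
have [a1|/ltW a1] := leP a 1.
  apply: (@le_trans _ _ (a ^+ s)^-1); last by rewrite lerDr exprn_ge0.
  rewrite -exprVn -[leRHS]mul1r; apply: ler_pM; rewrite ?exprn_ge0 ?exprn_ile1//.
  by rewrite ler_weXn2l// invf_ge1.
apply: (@le_trans _ _ (a ^+ s)); last by rewrite lerDl invr_ge0 exprn_ge0.
rewrite -[leRHS]mulr1; apply: ler_pM; rewrite ?exprn_ge0//; first by rewrite ler_weXn2l.
by rewrite exprn_ile1// invf_le1.
Qed.

(** Two further powers of [a] pay for [1 + a^2], whose two terms give the factor 2. As the seminorm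
    has exponent [r/2], the index [2r + 2] gives [(1 + b^2)^(r+1)], which covers
    [|b|^r (1 + b^2)]. *)
Lemma dominated3_symbol c p q r k Phi N M : smoothY Phi -> boundedY N Phi M ->
  (p + q + 2 <= N)%N -> (r.*2 + 2 <= N)%N -> (k <= N)%N ->
  dominated3 (symbol c p q r k Phi) (2 * M).
Proof.
move=> sPhi bPhi pN rN kN; split.
  apply: (@continuous_measurable_dom3 _ _ (symbol c p q r k Phi)) => z z1 z2.
  have c12 : {for z, continuous (fun z : 'rV[R]_n * R * R => z.1.2)}.
    by apply: (@cvg_comp _ _ _ fst snd); [exact: cvg_fst|exact: cvg_snd].
  have c2 : {for z, continuous (fun z : 'rV[R]_n * R * R => z.2)} by exact: cvg_snd.
  have cX (h : 'rV[R]_n * R * R -> R) j : {for z, continuous h} -> {for z, continuous (fun z => h z ^+ j)}.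
    move=> ch; apply: (@continuous_comp _ _ _ h (fun t : R => t ^+ j)) => //.
    exact: exprn_continuous.
  apply: continuousM.
    apply: continuousM; last exact: cX.
    apply: continuousM; first exact: cX.
    apply: (cX (fun z => z.2^-1)); apply: continuousV => //; exact: lt0r_neq0.
  exact: (smooth_on_part c (smoothY_iter_laplace k sPhi) [::] (conj z1 z2)).1.
move=> z /dom3P[z1 z2].
have [w wE wz] := extY_dom (iter k L Phi) (conj (sphere_neq0 z1) z2 : domY z).
have Ew : (val w).2 = z.2 /\ (val w).1.2 = z.1.2 by rewrite wz.
rewrite /symbol wE; set a := z.2 in z2 Ew *; set b := z.1.2 in Ew *.
pose s := (p + q + 2)%N.
have := bPhi k s (r.*2 + 2)%N kN pN rN w; rewrite Ew.1 Ew.2.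
have -> : (r.*2 + 2)%N%:R / 2 = r.+1%:R :> R.
  by rewrite -muln2 -mulSnr natrM mulfK// pnatr_eq0.
rewrite powR_mulrn; last by rewrite addr_ge0 ?sqr_ge0.
move=> H.
rewrite /w3 -/a -/b -invfM ler_pdivlMr; last by rewrite mulr_gt0 ?ltr_pwDl ?sqr_ge0.
rewrite !normrM !normrX normfV (gtr0_norm z2).
have hb : `|b| ^+ r * (1 + b ^+ 2) <= (1 + b ^+ 2) ^+ r.+1.
  rewrite [leRHS]exprSr; apply: ler_wpM2r; first by rewrite addr_ge0 ?sqr_ge0.
  apply: lerXn2r; rewrite ?nnegrE ?addr_ge0 ?sqr_ge0//.
  rewrite -(real_normK (num_real b)); have := normr_ge0 b; nra.
have ha : a ^+ p * a^-1 ^+ q * (1 + a ^+ 2) <= 2 * (a ^+ s + (a ^+ s)^-1).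
  rewrite mulrDr mulr1 mulr_natl mulr2n lerD//.
    by apply: pow_le_powDV => //; rewrite /s; lia.
  rewrite mulrAC -exprD; apply: pow_le_powDV => //; rewrite /s; lia.
have hc := normr_part_le c (iter k L Phi w).
set X := a ^+ p * a^-1 ^+ q in ha *.
have [a0' ai'] : 0 <= a /\ 0 <= a^-1 by rewrite invr_ge0 ltW.
have X0 : 0 <= X by rewrite mulr_ge0 ?exprn_ge0 ?invr_ge0// ltW.
rewrite [leLHS](_ : _ = (X * (1 + a ^+ 2)) * (`|b| ^+ r * (1 + b ^+ 2)) *
  `|part c (iter k L Phi w)|); last by ring.
apply: (@le_trans _ _ (2 * ((a ^+ s + (a ^+ s)^-1) * (1 + b ^+ 2) ^+ r.+1 *
   Normc.normc (iter k L Phi w)))); last by rewrite ler_wpM2l.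
have b0 : 0 <= 1 + b ^+ 2 by rewrite addr_ge0 ?sqr_ge0.
have a0 : 0 <= 1 + a ^+ 2 by rewrite addr_ge0 ?sqr_ge0.
rewrite [leRHS]mulrA [2 * (_ * _)]mulrA.
apply: ler_pM; rewrite ?mulr_ge0 ?exprn_ge0//.
by apply: ler_pM; rewrite ?mulr_ge0 ?exprn_ge0// ?addr_ge0 ?sqr_ge0 ?invr_ge0 ?exprn_ge0.
Qed.

Lemma rapidY_dominated c p q r k Phi : rapidY Phi -> exists M, dominated3 (symbol c p q r k Phi) M.
Proof.
move=> [sPhi bPhi].
have [M hM] := bPhi (maxn (p + q + 2) (maxn (r.*2 + 2) k)).
by exists (2 * M); apply: dominated3_symbol sPhi hM _ _ _; rewrite !leq_max leqnn ?orbT.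
Qed.

Lemma S0_bounded f k : S0_family f -> exists K, forall t, `|f k t| <= K.
Proof.
move=> [[_ rf] _]; have [K hK] := rf 0%N k.
by exists K => t; have := hK t; rewrite expr0 mul1r.
Qed.

Lemma rapidY_kernel c p q r k Phi f j x : rapidY Phi -> S0_family f ->
  exists M, dominated3 (ridge_kernel [::] (symbol c p q r k Phi) (f j) x) M.
Proof.
move=> rPhi sf; have [M hM] := rapidY_dominated c p q r k rPhi.
have [K hK] := S0_bounded j sf.
eexists; apply: dominated3_kernel hM _ hK; exact: rapid_continuous sf.1.
Qed.

(** Stated for a list so that the seven terms of the next identity are integrated at once. *)
Lemma Rintegral_mu3_comb (e : seq (R * (T3 -> R))) :
  (forall i, (i < size e)%N -> exists M, dominated3 (nth (0, fun=> 0) e i).2 M) ->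
  (exists M, dominated3 (fun z => \sum_(t <- e) t.1 * t.2 z) M) /\
  \int[mu3]_(z in dom3) \sum_(t <- e) t.1 * t.2 z =
  \sum_(t <- e) t.1 * \int[mu3]_(z in dom3) t.2 z.
Proof.
elim: e => [|[a h] e IH] He.
  rewrite big_nil; split.
    exists 0; under eq_fun do rewrite big_nil; split; first exact: measurable_cst.
    by move=> z _; rewrite normr0 mul0r.
  by under eq_Rintegral do rewrite big_nil; rewrite /Rintegral integral0.
have [[M dM] E] := IH (fun i => He i.+1).
have [K dK] := He 0%N isT; rewrite /= in dK.
have dah : dominated3 (fun z => a * h z) (`|a| * K).
  split; first by apply: measurable_funM => //; exact: dK.1.
  by move=> z zD; rewrite normrM -mulrA ler_wpM2l// dK.2.
split.
  exists (`|a| * K + M); under eq_fun do rewrite big_cons.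
  split; first exact: measurable_funD dah.1 dM.1.
  by move=> z zD; rewrite (le_trans (ler_normD _ _))// mulrDl lerD ?dah.2 ?dM.2.
rewrite big_cons /= -E.
transitivity (\int[mu3]_(z in dom3) (a * h z + \sum_(t <- e) t.1 * t.2 z)).
  by apply: eq_Rintegral => z _; rewrite big_cons.
rewrite (RintegralD (@measurable_dom3 R n) (dominated3_integrable dah) (dominated3_integrable dM)).
by rewrite (RintegralZl _ (@measurable_dom3 R n) (dominated3_integrable dK)).
Qed.

(* [|x|^2 h''(x.u)] differs from the spherical Laplacian of [u |-> h(x.u)] by terms
   without growth in [x]; the Laplacian is moved onto [Phi] by Green's formula. *)
Lemma ridge_transform_sqr c p q r k Phi f x : rapidY Phi -> S0_family f ->
  let T p q r k (psi : nat -> R -> R) :=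
    ridge_transform [::] (symbol c p q r k Phi) (psi 0%N) x in
  let th := anti_family f in
  dotrV x x * T p q r k f =
  T p.+2 q r k.+1 (anti_family th) + T p.+2 q r k (mulX_family (mulX_family f)) +
  2 * T p.+1 q r.+1 k (mulX_family f) + T p q r.+2 k f +
  (n%:R - 1) * (T p.+2 q r k (mulX_family th) + T p.+1 q r.+1 k th).
Proof.
move=> rPhi sf T th.
have sth : S0_family th by exact: S0_anti.
have sch : S0_family (anti_family th) by exact: S0_anti.
have sX : S0_family (mulX_family f) by exact: S0_mulX.
pose K p q r k (psi : nat -> R -> R) := ridge_kernel [::] (symbol c p q r k Phi) (psi 0%N) x.
(* All terms of the claim on one side: for fixed [b] and [a] their sum is the integrand of Green's
   formula. *)
pose e : seq (R * (T3 -> R)) := [:: (dotrV x x, K p q r k f);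
  (- 1, K p.+2 q r k.+1 (anti_family th)); (- 1, K p.+2 q r k (mulX_family (mulX_family f)));
  (- 2, K p.+1 q r.+1 k (mulX_family f)); (- 1, K p q r.+2 k f);
  (- (n%:R - 1), K p.+2 q r k (mulX_family th)); (- (n%:R - 1), K p.+1 q r.+1 k th)].
have dK p' q' r' k' psi : S0_family psi -> exists M, dominated3 (K p' q' r' k' psi) M.
  by move=> spsi; exact: rapidY_kernel.
have He i : (i < size e)%N -> exists M, dominated3 (nth (0, fun=> 0) e i).2 M.
  by case: i => [|[|[|[|[|[|[|//]]]]]]] _ /=; apply: dK => //; exact: S0_mulX.
have [[M dM] E] := Rintegral_mu3_comb He.
have := E; rewrite (Rintegral_mu3_eq0 dM).
  rewrite /e !big_cons big_nil /= -!/(ridge_transform _ _ _ _) /T /=.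
  do 7!move: (ridge_transform _ _ _ _) => ?; move=> E0.
  apply/eqP; rewrite -subr_eq0; apply/eqP; rewrite [RHS]E0; ring.
move=> b a a0.
pose W : R := a ^+ p * a^-1 ^+ q * b ^+ r.
(* A second antiderivative of [W f((t - b)/a)]. Each antiderivative costs a factor [a], whence the
   indices [p.+1] and [p.+2]. *)
pose h t := W * a ^+ 2 * anti_family th 0 ((t - b) / a).
pose h' t := W * a * th 0%N ((t - b) / a).
pose h'' t := W * f 0%N ((t - b) / a).
have dt t : is_derive t (1 : R) (fun t => (t - b) / a) a^-1.
  apply: (@is_derive_quadratic _ _ _ _ _ _ 0) => s.
  by rewrite -[s%:A]/(s * 1) mulr1 [X in `|X|](_ : _ = 0) ?normr0 ?mul0r//; ring.
have dh t : is_derive t (1 : R) h (h' t).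
  have := is_deriveZ (W * a ^+ 2) (is_derive_comp1 (dt t) (sch.1.1 0%N _)).
  rewrite (_ : _ *: _ = h' t)// /h' /GRing.scale /=.
  by field; rewrite lt0r_neq0.
have dh' t : is_derive t (1 : R) h' (h'' t).
  have := is_deriveZ (W * a) (is_derive_comp1 (dt t) (sth.1.1 0%N _)).
  rewrite (_ : _ *: _ = h'' t)// /h'' /GRing.scale /=.
  by field; rewrite lt0r_neq0.
have ch'' : continuous h''.
  move=> t; apply: cvgM; first exact: cvg_cst.
  apply: (@continuous_comp _ _ _ (fun t : R => (t - b) / a) (f 0%N)).
    exact: is_derive1_continuous dt t.
  exact: rapid_continuous sf.1 _.
have sPhi := smoothY_iter_laplace k rPhi.1.
rewrite -[RHS](sphere_green (extY_sphere_C2 c b sPhi a0) (ridge_sphere_C2 x dh dh' ch'')).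
apply: eq_Rintegral => u; rewrite inE => u1.
rewrite (ridge_laplacian _ _ _ u1) (ridge_sphere _ _ u1) -(extY_laplace c u b a sPhi).
rewrite /e !big_cons big_nil /= /K /ridge_kernel /dirs /= big_nil /symbol /= /mulX_family.
rewrite /h /h' /h''.
set t := dotrV x u; set tau := (t - b) / a.
(* The factors [t^2] and [t] of [ridge_laplacian] expand into powers of [tau], realised by
   [mulX_family], and powers of [b], counted by [r]. *)
have -> : t = tau * a + b by rewrite /tau divfK ?subrK// lt0r_neq0.
set F0 := part c (extY (iter k L Phi) _); set F1 := part c (extY (L _) _).
rewrite !exprS /W /th /=; ring.
Qed.

End Decay.

(** * Bilinear estimates and rapid decay *)

Section Tame.
Context {R : realType} {n : nat}.
Local Notation transform := ((spaceY R n -> R[i]) -> (nat -> R -> R) -> 'rV[R]_n -> R).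
Implicit Types (Phi : spaceY R n -> R[i]) (x v : 'rV[R]_n) (c : bool)
  (p q r k m N : nat) (f : nat -> R -> R) (G : transform).

(* Continuity estimate of a bilinear transform, uniform in [x]. *)
Definition tame G : Prop := exists N (C : R), 0 <= C /\
  forall Phi f (B1 B2 : R) x, rapidY Phi -> boundedY N Phi B1 -> 0 <= B1 ->
    S0_family f -> bounded_family N f B2 -> `|G Phi f x| <= C * B1 * B2.

Lemma tame_eq G G' : (forall Phi f x, rapidY Phi -> S0_family f -> G Phi f x = G' Phi f x) ->
  tame G -> tame G'.
Proof.
move=> E [N [C [C0 h]]]; exists N, C; split => // Phi f B1 B2 x rPhi bPhi B10 sf bf.
by rewrite -E//; exact: h.
Qed.

Lemma tameD G G' : tame G -> tame G' -> tame (fun Phi f x => G Phi f x + G' Phi f x).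
Proof.
move=> [N [C [C0 h]]] [N' [C' [C0' h']]]; exists (maxn N N'), (C + C').
split => [|Phi f B1 B2 x rPhi bPhi B10 sf bf]; first exact: addr_ge0.
rewrite (le_trans (ler_normD _ _))// !mulrDl; apply: lerD.
  apply: h => //; [exact: boundedYW (leq_maxl _ _) bPhi|exact: bounded_familyW (leq_maxl _ _) bf].
apply: h' => //; [exact: boundedYW (leq_maxr _ _) bPhi|exact: bounded_familyW (leq_maxr _ _) bf].
Qed.

Lemma tameZ (a : R) G : tame G -> tame (fun Phi f x => a * G Phi f x).
Proof.
move=> [N [C [C0 h]]]; exists N, (`|a| * C); split => [|Phi f B1 B2 x *]; first exact: mulr_ge0.
by rewrite normrM -2![leRHS]mulrA ler_wpM2l// [leRHS]mulrA; apply: h.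
Qed.

(** Here [j] is the loss of order of [O]: 1 for multiplication by the variable, 2 for the
    antiderivative. *)
Lemma tame_op (O : (nat -> R -> R) -> nat -> R -> R) j (D : nat -> R) G :
  (forall f, S0_family f -> S0_family (O f)) -> (forall N, 0 <= D N) ->
  (forall N f B, S0_family f -> bounded_family (j + N) f B ->
     bounded_family N (O f) (D N * B)) ->
  tame G -> tame (fun Phi f => G Phi (O f)).
Proof.
move=> O0 D0 OD [N [C [C0 h]]]; exists (j + N)%N, (C * D N).
split => [|Phi f B1 B2 x rPhi bPhi B10 sf bf]; first exact: mulr_ge0.
rewrite [leRHS](_ : _ = C * B1 * (D N * B2)); last by ring.
by apply: h => //; [exact: boundedYW (leq_addl _ _) bPhi|exact: O0|exact: OD].
Qed.

Lemma tame_mulX G : tame G -> tame (fun Phi f => G Phi (mulX_family f)).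
Proof.
apply: (@tame_op _ 1 (fun N => N%:R + 1)) => [f|N|N f B _]; first exact: S0_mulX.
  by rewrite addr_ge0.
exact: bounded_mulX.
Qed.

Lemma tame_anti G : tame G -> tame (fun Phi f => G Phi (anti_family f)).
Proof.
apply: (@tame_op _ 2 (fun N => anti_const)) => [f|N|N f B]; first exact: S0_anti.
  by rewrite (le_trans _ anti_const_ge1).
exact: bounded_anti.
Qed.

(** The iterated derivative along [s] of the transform for [s = [::]], in closed form: each
    direction adds a factor [1/a] and takes one derivative of [f]. *)
Definition ridge_derive c p q r k s Phi f : 'rV[R]_n -> R :=
  ridge_transform s (symbol c p (q + size s) r k Phi) (f (size s)).

Lemma tame_ridge_derive c p q r k s : tame (ridge_derive c p q r k s).
Proof.
(* The order covers the derivative [f (size s)] and the three thresholds of [dominated3_symbol]. *)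
exists (maxn (maxn (size s) (p + (q + size s) + 2)) (maxn (r.*2 + 2) k)),
  (2 * dirs_bound s * @mass3 R n).
split => [|Phi f B1 B2 x [sPhi _] bPhi B10 sf bf].
  by rewrite !mulr_ge0 ?dirs_bound_ge0 ?mass3_ge0.
rewrite [leRHS](_ : _ = dirs_bound s * B2 * (2 * B1) * @mass3 R n); last by ring.
apply: ridge_transform_le.
- by apply: dominated3_symbol sPhi bPhi _ _ _; rewrite !leq_max leqnn ?orbT.
- exact: rapid_continuous sf.1.
- move=> t; have := bf 0%N (size s) (leq0n _) _ t.
  by rewrite expr0 mul1r; apply; rewrite !leq_max leqnn.
Qed.

Definition japV x : R := 1 + dotrV x x.

Lemma japV_ge1 x : 1 <= japV x. Proof. by rewrite lerDl dotrV_ge0. Qed.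

Lemma japV_gt0 x : 0 < japV x. Proof. exact: lt_le_trans (japV_ge1 x). Qed.

Definition decaying G := forall m, tame (fun Phi f x => japV x ^+ m * G Phi f x).

(** One more factor [1 + |x|^2] is traded, by [ridge_transform_sqr], for transforms with other
    indices and one-variable functions. The induction hypothesis covers them because it is uniform
    in the indices and [tame] is stable under [mulX_family] and [anti_family]. *)
Lemma decaying_ridge_transform c p q r k : decaying (ridge_derive c p q r k [::]).
Proof.
move=> m; elim: m c p q r k => [|m IH] c p q r k.
  apply: tame_eq (tame_ridge_derive c p q r k [::]) => Phi f x _ _.
  by rewrite expr0 mul1r.
pose T p q r k Phi f x := japV x ^+ m * ridge_derive c p q r k [::] Phi f x.
have tT p' q' r' k' : tame (T p' q' r' k') by exact: IH.
have t1 := tame_anti (tame_anti (tT p.+2 q r k.+1)).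
have t2 := tame_mulX (tame_mulX (tT p.+2 q r k)).
have t3 := tameZ 2 (tame_mulX (tT p.+1 q r.+1 k)).
have t4 := tT p q r.+2 k.
have t5 := tame_anti (tame_mulX (tT p.+2 q r k)).
have t6 := tame_anti (tT p.+1 q r.+1 k).
apply: tame_eq (tameD (tT p q r k) (tameD (tameD (tameD (tameD t1 t2) t3) t4)
  (tameZ (n%:R - 1) (tameD t5 t6)))) => Phi f x rPhi sf.
rewrite [in RHS]exprSr -[RHS]mulrA [X in _ = _ * X]mulrDl mul1r.
have := ridge_transform_sqr c p q r k x rPhi sf; cbv zeta beta => E.
rewrite /T /ridge_derive /= !addn0 E /=; do 7!move: (ridge_transform _ _ _ _) => ?; ring.
Qed.

Lemma ridge_kernel_data c p q r k Phi f j : rapidY Phi -> S0_family f ->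
  exists M M' K K', [/\ dominated3 (symbol c p q r k Phi) M,
    dominated3 (fun z => symbol c p q r k Phi z / z.2) M',
    forall t, `|f j t| <= K & forall t, `|f j.+1 t| <= K'].
Proof.
move=> rPhi sf.
have [M hM] := rapidY_dominated c p q r k rPhi.
have [M' hM'] := rapidY_dominated c p q.+1 r k rPhi; rewrite -symbol_div in hM'.
have [[K hK] [K' hK']] := (S0_bounded j sf, S0_bounded j.+1 sf).
by exists M, M', K, K'.
Qed.

Lemma is_derive_ridge_derive c p q r k s Phi f x v : rapidY Phi -> S0_family f ->
  is_derive x v (ridge_derive c p q r k s Phi f) (ridge_derive c p q r k (v :: s) Phi f x).
Proof.
move=> rPhi sf.
have [M [M' [K [K' [dM dM' hK hK']]]]] :=
  ridge_kernel_data c p (q + size s) r k (size s) rPhi sf.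
have := is_derive_ridge_transform s x v dM dM' (sf.1.1 (size s)) _ hK hK'.
rewrite symbol_div /ridge_derive /= addnS; apply.
exact: rapid_continuous sf.1.
Qed.

Lemma continuous_ridge_derive c p q r k s Phi f : rapidY Phi -> S0_family f ->
  continuous (ridge_derive c p q r k s Phi f).
Proof.
move=> rPhi sf.
have [M [M' [K [K' [dM dM' hK hK']]]]] :=
  ridge_kernel_data c p (q + size s) r k (size s) rPhi sf.
exact: continuous_ridge_transform dM dM' (sf.1.1 (size s)) hK hK'.
Qed.

(** A form of Peetre's inequality, from [|x|^2 <= 2 |x + h v|^2 + 2 |h v|^2]. *)
Lemma japV_shift x v (h : R) : 0 <= h <= 1 ->
  japV x <= 2 * (1 + dotrV v v) * japV (h *: v + x).
Proof.
move=> /andP[h0 h1].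
have H : dotrV x x <= 2 * dotrV (h *: v + x) (h *: v + x) + 2 * dotrV v v.
  rewrite /dotrV !mulr_sumr -big_split/=; apply: ler_sum => i _; rewrite !mxE.
  set a := v ord0 i; set b := x ord0 i.
  have h2 : (h * a) ^+ 2 <= a ^+ 2.
    by rewrite exprMn ler_piMl ?sqr_ge0// expr_le1.
  have := sqr_ge0 (b + 2 * (h * a)); nra.
have v0 := dotrV_ge0 v; have y0 := dotrV_ge0 (h *: v + x).
rewrite /japV; nra.
Qed.

(* Landau's interpolation inequality with the step [japV x ^- m]. *)
Lemma weighted_derive_le (g g1 g2 : 'rV[R]_n -> R) v m (M0 M2 : R) :
  (forall x, is_derive x v g (g1 x)) -> (forall x, is_derive x v g1 (g2 x)) ->
  (forall x, japV x ^+ m.*2 * `|g x| <= M0) -> (forall x, `|g2 x| <= M2) ->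
  forall x, japV x ^+ m * `|g1 x| <= ((2 * (1 + dotrV v v)) ^+ m.*2 + 1) * M0 + M2.
Proof.
move=> d1 d2 b0 b2 x.
pose l (t : R) := t *: v + x.
have L (f f' : 'rV[R]_n -> R) : (forall x, is_derive x v f (f' x)) ->
    forall t, is_derive t (1 : R) (f \o l) (f' (l t)).
  by move=> df t; exact: is_derive_line (df (l t)).
have [d1l d2l] := (L _ _ d1, L _ _ d2).
pose J := japV x ^+ m; have J1 : 1 <= J by exact/exprn_ege1/japV_ge1.
have J0 : 0 < J := lt_le_trans ltr01 J1.
pose h := J^-1; have [h0 h1] : 0 < h /\ h <= 1 by rewrite invr_gt0 J0 invf_le1.
have [t /andP[]] := MVT h0 (fun s _ => d1l s)
  (continuous_subspaceT (is_derive1_continuous d1l)).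
rewrite bnd_simp => t0; rewrite bnd_simp => th.
rewrite subr0 => E1.
have := lipschitz_of_derive d2l (fun s => b2 (l s)) t 0.
have l0 : l 0 = x by rewrite /l scale0r add0r.
rewrite /= l0 subr0 (gtr0_norm t0) => E2.
rewrite /= l0 in E1.
have M20 : 0 <= M2 := le_trans (normr_ge0 _) (b2 0).
have M00 : 0 <= M0 by rewrite (le_trans _ (b0 0))// mulr_ge0// exprn_ge0// ltW// japV_gt0.
(* The difference quotient costs [1/h = J], so that with the outer weight [J] the function [g] needs
   [J^2 = japV x ^+ m.*2]. The error is at most [M2 * h], and its factor [h] cancels the outer
   weight. *)
have g1E : g1 x = (g (l h) - g x) * J - (g1 (l t) - g1 x).
  by rewrite E1 -mulrA /h mulVf ?lt0r_neq0//; ring.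
have JJ : J * J = japV x ^+ m.*2 by rewrite /J -exprD addnn.
rewrite g1E; rewrite (le_trans (ler_wpM2l (ltW J0) (ler_normB _ _)))//.
rewrite mulrDr; apply: lerD; last first.
  rewrite (le_trans (ler_wpM2l (ltW J0) E2))// mulrC -mulrA ler_piMr//.
  by rewrite (le_trans (ler_wpM2r (ltW J0) (ltW th)))// /h mulVf ?lt0r_neq0.
rewrite normrM (gtr0_norm J0) mulrCA JJ mulrC.
have K0 : 0 <= 2 * (1 + dotrV v v) by rewrite mulr_ge0// addr_ge0// dotrV_ge0.
have JX0 : 0 <= japV x ^+ m.*2 by rewrite exprn_ge0// ltW// japV_gt0.
rewrite (le_trans (ler_wpM2l JX0 (ler_normB _ _)))//.
rewrite mulrDr mulrDl mul1r; apply: lerD => //.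
apply: (le_trans _ (ler_wpM2l _ (b0 (l h)))); last exact: exprn_ge0.
rewrite mulrA -exprMn; apply: ler_wpM2r => //.
apply: lerXn2r; rewrite ?nnegrE ?(ltW (japV_gt0 _))//.
  by rewrite mulr_ge0// ltW// japV_gt0.
by apply: japV_shift; rewrite ltW.
Qed.

(** Decay of order [2m] along [s] and boundedness along [v :: v :: s] give decay of order [m] along
    [v :: s]; as [m] is arbitrary, the halving is harmless. *)
Lemma decaying_ridge_derive c p q r k s : decaying (ridge_derive c p q r k s).
Proof.
elim: s => [|v s IH]; first exact: decaying_ridge_transform.
move=> m; have [N [C [C0 h]]] := IH m.*2.
have [N' [C' [C0' h']]] := tame_ridge_derive c p q r k (v :: v :: s).
pose K : R := (2 * (1 + dotrV v v)) ^+ m.*2 + 1.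
have K0 : 0 <= K by rewrite addr_ge0// exprn_ge0// mulr_ge0// addr_ge0// dotrV_ge0.
exists (maxn N N'), (K * C + C'); split; first by rewrite addr_ge0// mulr_ge0.
move=> Phi f B1 B2 x rPhi bPhi B10 sf bf.
have b1 := boundedYW (leq_maxl N N') bPhi; have b1' := boundedYW (leq_maxr N N') bPhi.
have b2 := bounded_familyW (leq_maxl N N') bf; have b2' := bounded_familyW (leq_maxr N N') bf.
rewrite normrM normrX gtr0_norm ?japV_gt0//.
rewrite [leRHS](_ : _ = K * (C * B1 * B2) + C' * B1 * B2); last by ring.
apply: (@weighted_derive_le (ridge_derive c p q r k s Phi f) _
  (ridge_derive c p q r k (v :: v :: s) Phi f) v).
- by move=> y; exact: is_derive_ridge_derive.
- by move=> y; exact: is_derive_ridge_derive.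
- move=> y; have := h Phi f B1 B2 y rPhi b1 B10 sf b2.
  by rewrite normrM normrX gtr0_norm ?japV_gt0.
- by move=> y; exact: h'.
Qed.

End Tame.

(** * Moments *)

Section Moments.
Context {R : realType} {n : nat}.
Local Notation e_ i := (delta_mx ord0 i : 'rV[R]_n).
Implicit Types (Phi : spaceY R n -> R[i]) (x v : 'rV[R]_n) (c : bool) (i : 'I_n)
  (p q r k N d : nat) (f : nat -> R -> R) (m : {ffun 'I_n -> nat}).

Lemma rapid_bounded_family f N : rapid_family f -> exists M, bounded_family N f M.
Proof.
move=> [_ rf].
pose K j := projT1 (choice (rf j)).
have hK j k t : `|t| ^+ j * `|f k t| <= K j k := projT2 (choice (rf j)) k t.
exists (\sum_(j < N.+1) \sum_(k < N.+1) `|K j k|) => j k jN kN t.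
apply: (le_trans (hK j k t)); apply: (le_trans (ler_norm _)).
rewrite (bigD1 (Ordinal (jN : j < N.+1)%N))//= (bigD1 (Ordinal (kN : k < N.+1)%N))//=.
by rewrite -addrA lerDl addr_ge0 ?sumr_ge0// => l _; rewrite sumr_ge0.
Qed.

Lemma decaying_bounded (G : (spaceY R n -> R[i]) -> (nat -> R -> R) -> 'rV[R]_n -> R) d Phi f :
  decaying G -> rapidY Phi -> S0_family f ->
  exists C, forall x, japV x ^+ d * `|G Phi f x| <= C.
Proof.
move=> /(_ d)[N [C [C0 h]]] rPhi sf.
have [B1 b1] := rPhi.2 N; have [B2 b2] := rapid_bounded_family N sf.1.
have b1' : boundedY N Phi `|B1|.
  by move=> k s r kN sN rN w; rewrite (le_trans _ (ler_norm _))// b1.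
exists (C * `|B1| * B2) => x; have := h Phi f _ B2 x rPhi b1' (normr_ge0 _) sf b2.
by rewrite normrM normrX gtr0_norm ?japV_gt0.
Qed.

Lemma monomial_le m x : `|monomial m x| <= japV x ^+ \sum_i m i.
Proof.
rewrite /monomial normr_prod -prodrXr; apply: ler_prod => i _.
rewrite normr_ge0 normrX/= lerXn2r ?nnegrE ?normr_ge0 ?(ltW (japV_gt0 _))//.
apply: (@le_trans _ _ (1 + x ord0 i ^+ 2)); last by rewrite lerD2l sqr_coord_le.
rewrite -(real_normK (num_real (x ord0 i))); have := normr_ge0 (x ord0 i); nra.
Qed.

Lemma wrV_ge_japV x : (japV x ^+ n)^-1 <= wrV x.
Proof.
rewrite /wrV -{2}(card_ord n) -prodr_const -prodfV; apply: ler_prod => i _.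
rewrite invr_ge0 (ltW (japV_gt0 _))//= lef_pV2 ?posrE ?japV_gt0//.
  by rewrite lerD2l sqr_coord_le.
by rewrite ltr_pwDl ?sqr_ge0.
Qed.

(** The degree of the monomial pays for its growth, and [n] further powers of [japV] pay for
    [wrV]. *)
Lemma monomialM_le_wrV m (g : 'rV[R]_n -> R) (C : R) :
  (forall x, japV x ^+ (\sum_i m i + n) * `|g x| <= C) ->
  forall x, `|monomial m x * g x| <= C * wrV x.
Proof.
move=> b x; have J0 := japV_gt0 x.
have C0 : 0 <= C by rewrite (le_trans _ (b 0))// mulr_ge0// exprn_ge0// ltW// japV_gt0.
apply: (le_trans _ (ler_wpM2l C0 (wrV_ge_japV x))).
rewrite ler_pdivlMr ?exprn_gt0// normrM (le_trans _ (b x))// exprD.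
rewrite mulrAC ler_wpM2r// ler_wpM2r ?exprn_ge0 ?(ltW J0)//.
exact: monomial_le.
Qed.

Definition decr i m : {ffun 'I_n -> nat} := [ffun j => if j == i then (m j).-1 else m j].

Lemma decrE i m : decr i m i = (m i).-1. Proof. by rewrite ffunE eqxx. Qed.

Lemma sum_decr i m : (0 < m i)%N -> (\sum_j m j = (\sum_j decr i m j).+1)%N.
Proof.
move=> mi; rewrite (bigD1 i)//= [in RHS](bigD1 i)//= decrE -addSn prednK//; congr addn.
by apply: eq_bigr => j ji; rewrite ffunE (negbTE ji).
Qed.

Lemma is_derive_monomial i m x :
  is_derive x (e_ i) (monomial m) ((m i)%:R * monomial (decr i m) x).
Proof.
pose P : R := \prod_(j | j != i) x ord0 j ^+ m j.
have dX (t : R) : is_derive t (1 : R) (fun t : R => t ^+ m i) ((m i)%:R * t ^+ (m i).-1).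
  have := is_deriveX (m i) (is_derive_id t (1 : R)); rewrite exprfctE.
  by rewrite -[_ *: 1]/(_ * 1) mulr1.
have dc : is_derive x (e_ i) (fun y : 'rV[R]_n => y ord0 i ^+ m i)
    ((m i)%:R * x ord0 i ^+ (m i).-1).
  have := is_derive_comp1 (is_derive_coord i x (e_ i)) (dX (x ord0 i)).
  by rewrite mxE !eqxx mulr1.
have := is_deriveZ P (is_derive_line (_ : is_derive (0 *: e_ i + x) (e_ i) _ _)).
rewrite scale0r add0r => /(_ _ _ dc) H; apply: is_derive_from_line.
have -> : (m i)%:R * monomial (decr i m) x = P *: ((m i)%:R * x ord0 i ^+ (m i).-1).
  rewrite /monomial (bigD1 i)//= decrE /GRing.scale /= [RHS]mulrC -mulrA; congr (_ * (_ * _)).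
  by apply: eq_bigr => j ji; rewrite ffunE (negbTE ji).
rewrite (_ : (fun s : R => monomial m (s *: e_ i + x)) =
  P \*: (fun s : R => (s *: e_ i + x) ord0 i ^+ m i))//.
apply/funext => s; rewrite /monomial (bigD1 i)//= mulrC; congr (_ * _).
by apply: eq_bigr => j ji; rewrite !mxE (negbTE ji) andbF mulr0 add0r.
Qed.

Lemma continuous_monomial m : continuous (monomial m : 'rV[R]_n -> R).
Proof.
move=> x; apply: continuous_prod => i.
apply: (@continuous_comp _ _ _ (fun y : 'rV[R]_n => y ord0 i) (fun t : R => t ^+ m i)).
  exact: coord_continuous.
exact: exprn_continuous.
Qed.

Lemma integrable_monomial_ridge m c p q r k s Phi f : rapidY Phi -> S0_family f ->
  (lebesgue_rV n).-integrable setT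
    (fun x => (monomial m x * ridge_derive c p q r k s Phi f x)%:E).
Proof.
move=> rPhi sf.
have [C hC] := decaying_bounded (\sum_i m i + n) (decaying_ridge_derive c p q r k s) rPhi sf.
apply: (@integrable_dominated _ _ _ _ _
  (fun x => monomial m x * ridge_derive c p q r k s Phi f x) (fun x => C * wrV x)) => //.
- apply: (continuous_measurable_rV openT) => x _; apply: continuousM.
    exact: continuous_monomial.
  exact: continuous_ridge_derive.
- by move=> x _; exact: monomialM_le_wrV.
- exact: integrable_ZwrV.
Qed.

(** The two extra powers of [a] cancel the [a^-2] of the second derivatives, and these undo the two
    antiderivatives. *)
Lemma ridge_derive_laplacian c p q r k Phi f x : rapidY Phi -> S0_family f ->
  ridge_derive c p q r k [::] Phi f x =
  \sum_i ridge_derive c p.+2 q r k [:: e_ i; e_ i] Phi (anti_family (anti_family f)) x.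
Proof.
move=> rPhi sf; rewrite /ridge_derive /=.
pose K i := ridge_kernel [:: e_ i; e_ i] (symbol c p.+2 (q + 2) r k Phi) (f 0%N) x.
have dK i : exists M, dominated3 (K i) M.
  have [M hM] := rapidY_dominated c p.+2 (q + 2) r k rPhi.
  have [B hB] := S0_bounded 0 sf.
  eexists; apply: dominated3_kernel hM _ hB; exact: rapid_continuous sf.1.
rewrite -(@Rintegral_sum R _ _ (@mu3 R n) _ _ (index_enum 'I_n) K (@measurable_dom3 R n)); last first.
  by move=> i; have [M /dominated3_integrable] := dK i.
apply: eq_Rintegral => z; rewrite inE => /dom3P[z1 z2].
rewrite /K /ridge_kernel /dirs addn0 -mulr_suml -mulr_sumr big_nil mulr1; congr (_ * _).
rewrite (eq_bigr (fun i => z.1.1 ord0 i ^+ 2)); last first.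
  by move=> i _; rewrite !big_cons big_nil mulr1 !dotrV_delta expr2.
rewrite (_ : \sum_i _ = 1); last first.
  by rewrite -[RHS](expr1n _ 2) -z1 sqr_normrV /dotrV; apply: eq_bigr => i _; rewrite expr2.
rewrite mulr1 /symbol !exprS exprD; field; exact: lt0r_neq0.
Qed.

Lemma Rintegral_monomial_ridge m c p q r k Phi f : rapidY Phi -> S0_family f ->
  \int[lebesgue_rV n]_x (monomial m x * ridge_derive c p q r k [::] Phi f x) = 0.
Proof.
move=> rPhi; have [d] := ubnP (\sum_i m i)%N.
elim: d m p f => // d IH m p f; rewrite ltnS => md sf.
have sch : S0_family (anti_family (anti_family f)) by do 2!apply: S0_anti.
pose G s := ridge_derive c p.+2 q r k s Phi (anti_family (anti_family f)).
have E x : monomial m x * ridge_derive c p q r k [::] Phi f x =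
    \sum_i monomial m x * G [:: e_ i; e_ i] x.
  by rewrite ridge_derive_laplacian// mulr_sumr.
under eq_Rintegral do rewrite E.
rewrite (@Rintegral_sum R _ _ _ _ _ (index_enum 'I_n)
  (fun i x => monomial m x * G [:: e_ i; e_ i] x) measurableT); last first.
  by move=> i; exact: integrable_monomial_ridge.
rewrite big1// => i _.
pose m1 := decr i m; pose m2 := decr i m1.
pose a1 : R := (m i)%:R; pose a2 : R := a1 * (m1 i)%:R.
(* Two integrations by parts at once: in the derivative [h] of [H] the terms with one derivative of
   [G] cancel. *)
pose H x := monomial m x * G [:: e_ i] x - a1 * (monomial m1 x * G [::] x).
pose h x := monomial m x * G [:: e_ i; e_ i] x - a2 * (monomial m2 x * G [::] x).
have dH x : is_derive x (e_ i) H (h x).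
  have dG s : is_derive x (e_ i) (G s) (G (e_ i :: s) x) by exact: is_derive_ridge_derive.
  have := is_deriveB (is_deriveM (is_derive_monomial i m x) (dG [:: e_ i]))
    (is_deriveZ a1 (is_deriveM (is_derive_monomial i m1 x) (dG [::]))).
  rewrite (_ : _ - _ = h x)// /h /a2 /GRing.scale /=.
  by do 3!move: (G _ x) => ?; move: (monomial _ x) (monomial _ x) (monomial _ x) => *; ring.
have ch : continuous h.
  have cG m' s' : continuous (fun x => monomial m' x * G s' x).
    move=> x; apply: continuousM; first exact: continuous_monomial.
    exact: continuous_ridge_derive.
  have ca : continuous (fun x => a2 * (monomial m2 x * G [::] x)).
    by move=> x; exact: continuousM (@cst_continuous _ _ a2 x) (cG m2 [::] x).
  by move=> x; exact: continuousB (cG m _ x) (ca x).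
have bG m' s : exists C, forall x, `|monomial m' x * G s x| <= C * wrV x.
  have [C hC] := decaying_bounded (\sum_i m' i + n) (decaying_ridge_derive c p.+2 q r k s) rPhi sch.
  by exists C; exact: monomialM_le_wrV.
have bD m' m'' s s' a : exists C, forall x,
    `|monomial m' x * G s x - a * (monomial m'' x * G s' x)| <= C * wrV x.
  have [[C hC] [C' hC']] := (bG m' s, bG m'' s').
  exists (C + `|a| * C') => x; rewrite mulrDl (le_trans (ler_normB _ _))// lerD//.
  by rewrite normrM -mulrA ler_wpM2l.
have [[C hC] [C' hC']] := (bD m m1 [:: e_ i] [::] a1, bD m m2 [:: e_ i; e_ i] [::] a2).
have h0 : \int[lebesgue_rV n]_x h x = 0.
  apply: (@Rintegral_partial_eq0 _ _ i H h (Num.max C C')) => // x.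
    by rewrite (le_trans (hC x))// ler_wpM2r ?(ltW (wrV_gt0 _))// le_max lexx.
  by rewrite (le_trans (hC' x))// ler_wpM2r ?(ltW (wrV_gt0 _))// le_max lexx orbT.
have I2 := integrable_monomial_ridge m2 c p.+2 q r k [::] rPhi sch.
have a20 : a2 * \int[lebesgue_rV n]_x (monomial m2 x * G [::] x) = 0.
  (* For [m i <= 1] the coefficient [m_i (m_i - 1)] is 0. Otherwise the degree drops by two and the
     induction hypothesis applies to [p.+2] and the double antiderivative, which is why it is
     general in [p] and [f]. *)
  have [mi|] := boolP (1 < m i)%N; last first.
    rewrite -leqNgt /a2 /a1 decrE; case: (m i) => [|[|//]] _; by rewrite /= ?mulr0 !mul0r.
  rewrite IH ?mulr0//; apply: leq_trans md.
  rewrite (@sum_decr i m) ?(ltnW mi)// (@sum_decr i m1)//.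
  by rewrite decrE -ltnS prednK// ltnW.
move: h0; rewrite (RintegralB measurableT).
- rewrite (RintegralZl _ measurableT I2) a20 subr0; exact.
- exact: integrable_monomial_ridge.
- exact: (@integrableZl _ _ _ _ setT measurableT a2 _ I2).
Qed.

End Moments.

(** * The synthesis operator *)

Lemma wsup_leP {R : realType} {T : Type} (w : T -> R) (f : T -> R[i]) (M : R) :
  (wsup w f <= M%:E)%E <-> forall x, w x * Normc.normc (f x) <= M.
Proof.
split=> [h x|h]; last by apply: ge_ereal_sup => _ [x _ <-]; rewrite lee_fin.
by rewrite -lee_fin (le_trans _ h)//; apply: ereal_sup_ubound; exists x.
Qed.

Lemma wsup_fin {R : realType} {T : Type} (w : T -> R) (f : T -> R[i]) :
  (wsup w f < +oo)%E -> exists M : R, (wsup w f <= M%:E)%E.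
Proof.
case: (wsup w f) => [r _|//|_]; first by exists r.
by exists 0; exact: leNye.
Qed.

Section PartialDerivatives.
Context {R : realType}.

Lemma iter_derive_cat {V : normedModType R} (s s' : seq V) (f : V -> R) :
  iter_derive (s ++ s') f = iter_derive s (iter_derive s' f).
Proof. by elim: s => //= v s ->. Qed.

Lemma part_iter_cderive {V : normedModType R} c k (v : V) (f : V -> R[i]) :
  part c \o iter k (cderive v) f = iter_derive (nseq k v) (part c \o f).
Proof.
by elim: k => //= k <-; apply/funext => x /=; rewrite part_cderive.
Qed.

Definition pdirs n (m : {ffun 'I_n -> nat}) : seq 'rV[R]_n :=
  flatten [seq nseq (m i) (delta_mx ord0 i) | i <- enum 'I_n].

Lemma part_pderive n (m : {ffun 'I_n -> nat}) c (f : 'rV[R]_n -> R[i]) :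
  part c \o pderive m f = iter_derive (pdirs m) (part c \o f).
Proof.
rewrite /pderive /pdirs; elim: (enum 'I_n) => //= i s IH.
by rewrite part_iter_cderive IH iter_derive_cat.
Qed.

End PartialDerivatives.

Section RealFamily.
Context {R : realType}.
Local Notation leb := (@lebesgue_measure R).
Local Notation e0 := (delta_mx ord0 ord0 : 'rV[R]_1).
Implicit Types (psi : 'rV[R]_1 -> R[i]) (t B : R) (j k N : nat) (c : bool).

Definition real_family c psi k t : R :=
  iter_derive (nseq k e0) (part c \o psi) (const_mx t).

Lemma real_family0 c psi t : real_family c psi 0 t = part c (psi (const_mx t)).
Proof. by []. Qed.

Lemma const_mx_e0 t : const_mx t = t *: e0 :> 'rV[R]_1.
Proof. by apply/matrixP => i j; rewrite !mxE !ord1 !eqxx mulr1. Qed.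

Definition idx1 j : {ffun 'I_1 -> nat} := [ffun=> j].

Lemma real_family_pderive c psi k t :
  real_family c psi k t = part c (pderive (idx1 k) psi (const_mx t)).
Proof.
rewrite -[RHS]/((part c \o pderive (idx1 k) psi) _) part_pderive /pdirs enum_ordSl.
rewrite (_ : enum 'I_0 = [::]) /=; last by apply: size0nil; rewrite size_enum_ord.
by rewrite cats0 ffunE.
Qed.

Lemma monomial_idx1 j t : monomial (idx1 j) (const_mx t) = t ^+ j.
Proof. by rewrite /monomial big_ord1 mxE ffunE. Qed.

Lemma real_family_le c psi j k B :
  (schwartz_seminorm (idx1 j, idx1 k) psi <= B%:E)%E ->
  forall t, `|t| ^+ j * `|real_family c psi k t| <= B.
Proof.
move=> /wsup_leP h t; apply: le_trans (h (const_mx t)).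
rewrite /= monomial_idx1 normrX real_family_pderive; apply: ler_wpM2l; first exact: exprn_ge0.
exact: normr_part_le.
Qed.

Lemma bounded_real_family c psi N B :
  (forall j k, (j <= N)%N -> (k <= N)%N ->
    (schwartz_seminorm (idx1 j, idx1 k) psi <= B%:E)%E) ->
  bounded_family N (real_family c psi) B.
Proof. by move=> h j k jN kN; apply: real_family_le; exact: h. Qed.

Lemma rapid_real_family c psi : is_schwartz psi -> rapid_family (real_family c psi).
Proof.
move=> [spsi bpsi]; split=> [k t|j k].
  pose g := iter_derive (nseq k e0) (part c \o psi).
  have dg : is_derive (t *: e0 + 0) e0 g (real_family c psi k.+1 t).
    rewrite addr0 -const_mx_e0; apply: DeriveDef => //.
    exact: (smooth_on_part c spsi (nseq k e0) I).2.
  have := is_derive_line dg.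
  rewrite (_ : (fun s : R => g (s *: e0 + 0)) = real_family c psi k)//.
  by apply/funext => s; rewrite addr0 -const_mx_e0.
have [M hM] := wsup_fin (bpsi (idx1 j, idx1 k)).
by exists M; exact: real_family_le.
Qed.

(** Splitting off the only coordinate leaves an integral over ['rV_0], whose measure is a Dirac
    mass. *)
Lemma Rintegral_rV1 (f : 'rV[R]_1 -> R) (C : R) :
  measurable_fun setT f -> (forall x, `|f x| <= C * wrV x) ->
  \int[lebesgue_rV 1]_x f x = \int[leb]_t f (const_mx t).
Proof.
move=> mf bf; rewrite (Rintegral_rV12 mf bf).
have E y t : f (consrV (t, y)) = f (const_mx t).
  congr f; apply/matrixP => i j; rewrite !mxE !ord1.
  by case: unliftP => // -[].
under eq_Rintegral do under eq_Rintegral do rewrite E.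
by rewrite {1}/Rintegral integral_dirac//= indicE in_setT mul1r.
Qed.

Lemma S0_real_family c (psi : schwartz0 R 1) : S0_family (real_family c psi).
Proof.
have spsi : is_schwartz psi by apply/set_mem; exact: (schwartz_funP (schwartz0_val psi)).
have rf := rapid_real_family c spsi; split => // j.
have [_ E] := (set_mem (schwartz0_valP psi)) (idx1 j).
have {}E : \int[lebesgue_rV 1]_x (monomial (idx1 j) x * part c (psi x)) = 0.
  have : part c (cintegral (lebesgue_rV 1) setT
      (fun x => (monomial (idx1 j) x)%:C%C * psi x)) = 0 by rewrite E part0.
  move=> <-; rewrite /cintegral /part.
  case: c {rf} => /=; apply: eq_Rintegral => x _.
    by case: (psi x) => a b /=; rewrite mul0r addr0.
  by case: (psi x) => a b /=; rewrite mul0r subr0.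
have [M hM] := rapid_le_w1 j 0 rf.
rewrite -[RHS]E (@Rintegral_rV1 _ M).
- by apply: eq_Rintegral => t _; rewrite monomial_idx1.
- apply: (continuous_measurable_rV openT) => x _; apply: continuousM.
    exact: continuous_monomial.
  exact: (smooth_on_part c spsi.1 [::] I).1.
- move=> x; have -> : x = const_mx (x ord0 ord0).
    by apply/matrixP => a b; rewrite !mxE !ord1.
  by rewrite monomial_idx1 /wrV big_ord1 mxE.
Qed.

End RealFamily.

Section RealFamilyY.
Context {R : realType} {n : nat}.
Implicit Types (Phi : spaceY R n -> R[i]).

Lemma boundedY_seminorm N Phi (B : R) :
  (forall k s r, (k <= N)%N -> (s <= N)%N -> (r <= N)%N ->
    (seminormY (0%N, 0%N, k, s, r) Phi <= B%:E)%E) -> boundedY N Phi B.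
Proof. by move=> h k s r kN sN rN w; move: w; apply/wsup_leP; exact: h. Qed.

Lemma rapidY_schwartz Phi : is_schwartzY Phi -> rapidY Phi.
Proof.
move=> [sPhi bPhi]; split => // N.
have H k s r : exists M : R, (seminormY (0%N, 0%N, k, s, r) Phi <= M%:E)%E.
  exact: wsup_fin (bPhi (0%N, 0%N, k, s, r)).
pose K k s := projT1 (choice (H k s)).
have hK k s r : (seminormY (0%N, 0%N, k, s, r) Phi <= (K k s r)%:E)%E := projT2 (choice (H k s)) r.
exists (\sum_(k < N.+1) \sum_(s < N.+1) \sum_(r < N.+1) `|K k s r|).
apply: boundedY_seminorm => k s r kN sN rN; rewrite (le_trans (hK k s r))// lee_fin.
apply: (le_trans (ler_norm _)).
rewrite (bigD1 (Ordinal (kN : k < N.+1)%N))//= (bigD1 (Ordinal (sN : s < N.+1)%N))//=.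
rewrite (bigD1 (Ordinal (rN : r < N.+1)%N))//= -!addrA lerDl !addr_ge0 ?sumr_ge0// => *.
  by rewrite sumr_ge0.
by rewrite sumr_ge0// => *; rewrite sumr_ge0.
Qed.

End RealFamilyY.

Section Ridgelet.
Context {R : realType} {n : nat}.
Local Notation T3 := ('rV[R]_n * measurableTypeR R * measurableTypeR R)%type.
Local Notation mu3 := (@mu3 R n).
Local Notation dom3 := (@dom3 R n).
Implicit Types (Phi : spaceY R n -> R[i]) (psi : 'rV[R]_1 -> R[i]) (x v : 'rV[R]_n) (c : bool)
  (m : {ffun 'I_n -> nat}).

Let S0_pair psi : Prop := forall c, S0_family (real_family c psi).

(** The sign that makes one formula, [partM], give both parts of a complex product. *)
Definition part_sign c : R := if c then 1 else - 1.

Lemma partM c (z w : R[i]) :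
  part c (z * w) = part c z * part false w + part_sign c * (part (~~ c) z * part true w).
Proof.
by case: z => a b; case: w => a' b'; case: c; rewrite /part /part_sign /= ?mulN1r ?mul1r// addrC.
Qed.

Lemma part_real c (a : R) : part c (a%:C%C) = if c then 0 else a.
Proof. by case: c. Qed.

Lemma partMreal c (z : R[i]) (a : R) : part c (z * a%:C%C) = part c z * a.
Proof. by rewrite partM !part_real mulr0 mulr0 addr0. Qed.

(** The exponent [n + 1] of [1/a] joins the normalisation [1/a] of the ridge function and the [a^-n]
    of the measure. *)
Definition ridgelet_part c s psi Phi x : R :=
  ridge_derive c 0 n.+1 0 0 s Phi (real_family false psi) x +
  part_sign c * ridge_derive (~~ c) 0 n.+1 0 0 s Phi (real_family true psi) x.

Let K c c' psi Phi x : T3 -> R :=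
  ridge_kernel [::] (symbol c 0 (n.+1 + 0) 0 0 Phi) (real_family c' psi 0) x.

Let dK c c' psi Phi x : rapidY Phi -> S0_pair psi -> exists M, dominated3 (K c c' psi Phi x) M.
Proof. by move=> rPhi spsi; exact: rapidY_kernel. Qed.

Let part_integrand c psi Phi x z : dom3 z -> part c (ridgelet_integrand psi Phi x z) =
  K c false psi Phi x z + part_sign c * K (~~ c) true psi Phi x z.
Proof.
case: z => [[u b] a] /dom3P[/= u1 a0].
rewrite /ridgelet_integrand partMreal partM !partMreal.
rewrite /K /ridge_kernel /symbol /dirs big_nil !real_family0 /= addn0 !expr0 exprS exprVn.
ring.
Qed.

Let dK2 c psi Phi x : rapidY Phi -> S0_pair psi ->
  exists M, dominated3 (fun z => part c (ridgelet_integrand psi Phi x z)) M.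
Proof.
move=> rPhi spsi; have [M [mM hM]] := dK c false x rPhi spsi.
have [M' [mM' hM']] := dK (~~ c) true x rPhi spsi.
exists (M + `|part_sign c| * M'); split.
  apply: (@eq_measurable_fun _ _ _ _ _
    (fun z => K c false psi Phi x z + part_sign c * K (~~ c) true psi Phi x z)).
    by move=> z; rewrite inE => zD; rewrite part_integrand.
  by apply: measurable_funD => //; apply: measurable_funM.
move=> z zD; rewrite part_integrand// mulrDl (le_trans (ler_normD _ _))// lerD ?hM//.
by rewrite normrM -mulrA ler_wpM2l// hM'.
Qed.

Lemma cintegrable_ridgelet psi Phi x : rapidY Phi -> S0_pair psi ->
  cintegrable mu3 dom3 (ridgelet_integrand psi Phi x).
Proof.
move=> rPhi spsi; have [M dM] := dK2 false x rPhi spsi; have [M' dM'] := dK2 true x rPhi spsi.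
by split; [exact: dominated3_integrable dM|exact: dominated3_integrable dM'].
Qed.

(** One integral over the product measure, for which the estimates are available;
    [ridgelet_fun_synthesis] identifies it with the iterated integral. *)
Definition ridgelet_fun psi Phi x : R[i] := cintegral mu3 dom3 (ridgelet_integrand psi Phi x).

Lemma part_ridgelet_fun c psi Phi x : rapidY Phi -> S0_pair psi ->
  part c (ridgelet_fun psi Phi x) = ridgelet_part c [::] psi Phi x.
Proof.
move=> rPhi spsi.
have -> : part c (ridgelet_fun psi Phi x) =
    \int[mu3]_(z in dom3) part c (ridgelet_integrand psi Phi x z) by case: c.
rewrite (@eq_Rintegral _ _ _ _ _ (fun z =>
  K c false psi Phi x z + part_sign c * K (~~ c) true psi Phi x z)); last first.
  by move=> z; rewrite inE => /part_integrand.
have [M /dominated3_integrable i1] := dK c false x rPhi spsi.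
have [M' /dominated3_integrable i2] := dK (~~ c) true x rPhi spsi.
rewrite (RintegralD (@measurable_dom3 R n) i1); last first.
  exact: (@integrableZl _ _ _ _ _ (@measurable_dom3 R n) (part_sign c) _ i2).
by rewrite (RintegralZl _ (@measurable_dom3 R n) i2).
Qed.

Lemma ridgelet_fun_synthesis psi Phi x : rapidY Phi -> S0_pair psi ->
  ridgelet_fun psi Phi x = ridgelet_synthesis psi Phi x.
Proof.
move=> rPhi spsi; have [M dM] := dK2 false x rPhi spsi; have [M' dM'] := dK2 true x rPhi spsi.
rewrite /ridgelet_fun /cintegral (Rintegral_mu3_iterated dM) (Rintegral_mu3_iterated dM').
by [].
Qed.

Lemma iter_derive_ridgelet_part c s psi Phi : rapidY Phi -> S0_pair psi ->
  iter_derive s (ridgelet_part c [::] psi Phi) = ridgelet_part c s psi Phi.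
Proof.
move=> rPhi spsi; elim: s => // v s /= ->; apply/funext => x.
have d1 := is_derive_ridge_derive c 0 n.+1 0 0 s x v rPhi (spsi false).
have d2 := is_derive_ridge_derive (~~ c) 0 n.+1 0 0 s x v rPhi (spsi true).
by have [_ ->] := is_deriveD d1 (is_deriveZ (part_sign c) d2).
Qed.

Lemma smooth_ridgelet_part c psi Phi : rapidY Phi -> S0_pair psi ->
  smooth_on setT (ridgelet_part c [::] psi Phi).
Proof.
move=> rPhi spsi s x _; rewrite iter_derive_ridgelet_part//; split=> [|v].
  have c1 := @continuous_ridge_derive R n c 0 n.+1 0 0 s _ _ rPhi (spsi false) x.
  have c2 := @continuous_ridge_derive R n (~~ c) 0 n.+1 0 0 s _ _ rPhi (spsi true) x.
  exact: continuousD c1 (continuousM (@cst_continuous _ _ (part_sign c) x) c2).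
have d1 := is_derive_ridge_derive c 0 n.+1 0 0 s x v rPhi (spsi false).
have d2 := is_derive_ridge_derive (~~ c) 0 n.+1 0 0 s x v rPhi (spsi true).
by have [] := is_deriveD d1 (is_deriveZ (part_sign c) d2).
Qed.

Lemma part_ridgelet_funE c psi Phi : rapidY Phi -> S0_pair psi ->
  part c \o ridgelet_fun psi Phi = ridgelet_part c [::] psi Phi.
Proof. by move=> rPhi spsi; apply/funext => x /=; exact: part_ridgelet_fun. Qed.

Lemma csmooth_ridgelet_fun psi Phi : rapidY Phi -> S0_pair psi ->
  csmooth_on setT (ridgelet_fun psi Phi).
Proof.
move=> rPhi spsi; split.
  have := smooth_ridgelet_part false rPhi spsi; by rewrite -part_ridgelet_funE.
have := smooth_ridgelet_part true rPhi spsi; by rewrite -part_ridgelet_funE.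
Qed.

(** The monomial is bounded by a power of [japV]. Each part of the derivative is a sum of two ridge
    transforms, bounded with [C + C'], and the modulus is at most the sum of both parts, whence
    [2 * (C + C')]. *)
Lemma ridgelet_seminorm_le (i : {ffun 'I_n -> nat} * {ffun 'I_n -> nat}) :
  exists N (C : R), 0 <= C /\ forall psi Phi B1 B2, rapidY Phi -> S0_pair psi ->
    boundedY N Phi B1 -> 0 <= B1 -> (forall c, bounded_family N (real_family c psi) B2) ->
    (schwartz_seminorm i (ridgelet_fun psi Phi) <= (C * B1 * B2)%:E)%E.
Proof.
pose d := (\sum_j i.1 j)%N; pose s : seq 'rV[R]_n := pdirs i.2.
have H c : tame (fun Phi f x => japV x ^+ d * ridge_derive c 0 n.+1 0 0 s Phi f x).
  exact: decaying_ridge_derive.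
have [N [C [C0 h]]] := H false; have [N' [C' [C0' h']]] := H true.
pose P c := if c then C' else C.
exists (maxn N N'), (2 * (C + C')); split; first by rewrite mulr_ge0// addr_ge0.
move=> psi Phi B1 B2 rPhi spsi bPhi B10 bpsi; apply/wsup_leP => x.
have hc c c' : japV x ^+ d * `|ridge_derive c 0 n.+1 0 0 s Phi (real_family c' psi) x| <= P c * B1 * B2.
  have -> : japV x ^+ d * `|ridge_derive c 0 n.+1 0 0 s Phi (real_family c' psi) x| =
      `|japV x ^+ d * ridge_derive c 0 n.+1 0 0 s Phi (real_family c' psi) x|.
    by rewrite normrM normrX gtr0_norm ?japV_gt0.
  case: c; [apply: h' => //|apply: h => //].
  - exact: boundedYW (leq_maxr _ _) bPhi.
  - exact: bounded_familyW (leq_maxr _ _) (bpsi c').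
  - exact: boundedYW (leq_maxl _ _) bPhi.
  - exact: bounded_familyW (leq_maxl _ _) (bpsi c').
have J0 : 0 <= japV x ^+ d by rewrite exprn_ge0// ltW// japV_gt0.
have hp c : japV x ^+ d * `|part c (pderive i.2 (ridgelet_fun psi Phi) x)| <= (C + C') * B1 * B2.
  rewrite -[part c _]/((part c \o pderive i.2 (ridgelet_fun psi Phi)) x) part_pderive.
  rewrite part_ridgelet_funE// iter_derive_ridgelet_part// /ridgelet_part.
  rewrite (le_trans (ler_wpM2l J0 (ler_normD _ _)))// mulrDr !mulrDl.
  have -> : `|part_sign c * ridge_derive (~~ c) 0 n.+1 0 0 s Phi (real_family true psi) x| =
      `|ridge_derive (~~ c) 0 n.+1 0 0 s Phi (real_family true psi) x|.
    by rewrite /part_sign; case: c; rewrite ?mul1r ?mulN1r ?normrN.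
  have := hc c false; have := hc (~~ c) true; rewrite /P -/s.
  by case: c => /= ? ?; [rewrite addrC|]; rewrite lerD.
apply: (@le_trans _ _ (japV x ^+ d * (`|part false (pderive i.2 (ridgelet_fun psi Phi) x)| +
    `|part true (pderive i.2 (ridgelet_fun psi Phi) x)|))).
  apply: ler_pM => //; [|exact: monomial_le|exact: normc_le_parts].
  by apply: le_trans (normr_ge0 _) (normr_part_le false _).
have -> : 2 * (C + C') * B1 * B2 = (C + C') * B1 * B2 + (C + C') * B1 * B2 by ring.
by rewrite mulrDr lerD.
Qed.

End Ridgelet.

Section Operator.
Context {R : realType} {n : nat}.
Implicit Types (Phi : schwartzY R n) (psi : schwartz0 R 1) (x : 'rV[R]_n).

Let rPhi Phi : rapidY Phi.
Proof. by apply: rapidY_schwartz; apply/set_mem; exact: (schwartzY_funP Phi). Qed.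

Let spsi psi c : S0_family (real_family c psi).
Proof. exact: S0_real_family. Qed.

Lemma ridgelet_schwartz Phi psi : is_schwartz (ridgelet_fun psi Phi).
Proof.
split=> [|i]; first exact: csmooth_ridgelet_fun (rPhi Phi) (spsi psi).
have [N [C [C0 h]]] := @ridgelet_seminorm_le R n i.
have [B1 b1] := (rPhi Phi).2 N.
have [M1 m1] := rapid_bounded_family N (spsi psi false).1.
have [M2 m2] := rapid_bounded_family N (spsi psi true).1.
apply: (@le_lt_trans _ _ (C * `|B1| * Num.max M1 M2)%:E); last exact: ltry.
apply: h => //.
- by move=> k s r kN sN rN w; rewrite (le_trans _ (ler_norm _))// b1.
- move=> [] j k jN kN t; rewrite le_max; apply/orP.
    by right; exact: m2.
  by left; exact: m1.
Qed.

Lemma ridgelet_moments Phi psi (f : schwartz R n) : f = ridgelet_fun psi Phi :> (_ -> _) ->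
  vanishing_moments f.
Proof.
move=> fE m; rewrite fE.
have E c x : part c ((monomial m x)%:C%C * ridgelet_fun psi Phi x) =
    monomial m x * ridge_derive c 0 n.+1 0 0 [::] Phi (real_family false psi) x +
    part_sign c * (monomial m x * ridge_derive (~~ c) 0 n.+1 0 0 [::] Phi (real_family true psi) x).
  rewrite mulrC partMreal part_ridgelet_fun//.
  rewrite /ridgelet_part; ring.
have I c b : (lebesgue_rV n).-integrable setT (fun x =>
    (monomial m x * ridge_derive c 0 n.+1 0 0 [::] Phi (real_family b psi) x)%:E).
  exact: integrable_monomial_ridge.
have IZ c b (a : R) : (lebesgue_rV n).-integrable setT (fun x =>
    (a * (monomial m x * ridge_derive c 0 n.+1 0 0 [::] Phi (real_family b psi) x))%:E).
  exact: (@integrableZl _ _ _ _ setT measurableT a _ (I c b)).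
have I2 c : (lebesgue_rV n).-integrable setT (fun x =>
    (part c ((monomial m x)%:C%C * ridgelet_fun psi Phi x))%:E).
  under eq_fun do rewrite E.
  exact: (@integrableD _ _ _ _ setT measurableT _ _ (I c false) (IZ (~~ c) true (part_sign c))).
have E0 c : \int[lebesgue_rV n]_x part c ((monomial m x)%:C%C * ridgelet_fun psi Phi x) = 0.
  under eq_Rintegral do rewrite E.
  rewrite (RintegralD measurableT (I c false) (IZ (~~ c) true (part_sign c))).
  rewrite (RintegralZl _ measurableT (I (~~ c) true)).
  by rewrite !Rintegral_monomial_ridge// mulr0 addr0.
split; first by split; [exact: (I2 false)|exact: (I2 true)].
by apply/eqP; rewrite eq_complex; apply/andP; split; apply/eqP; [exact: (E0 false)|exact: (E0 true)].
Qed.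

Definition ridgelet_schw Phi psi : schwartz R n := Schwartz (mem_set (ridgelet_schwartz Phi psi)).

Definition ridgelet_map Phi psi : schwartz0 R n :=
  Schwartz0 (mem_set (ridgelet_moments
    (erefl : ridgelet_schw Phi psi = ridgelet_fun psi Phi :> (_ -> _)))).

Lemma ridgelet_mapE Phi psi x : ridgelet_map Phi psi x = ridgelet_fun psi Phi x.
Proof. by []. Qed.

Lemma schwartz0_eq d (f g : schwartz0 R d) : f =1 g -> f = g.
Proof. by move=> fg; apply/val_inj/val_inj/funext. Qed.

Lemma ridgelet_map_linearl psi (a : R[i]) Phi Phi' :
  ridgelet_map (a *: Phi + Phi') psi = a *: ridgelet_map Phi psi + ridgelet_map Phi' psi.
Proof.
apply: schwartz0_eq => x.
have i1 := cintegrable_ridgelet x (rPhi Phi) (spsi psi).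
have i2 := cintegrable_ridgelet x (rPhi Phi') (spsi psi).
rewrite ridgelet_mapE -[RHS]/(a * ridgelet_fun psi Phi x + ridgelet_fun psi Phi' x).
rewrite /ridgelet_fun -(cintegral_lin a (@measurable_dom3 R n) i1 i2).2.
congr cintegral; apply/funext => -[[u b] t].
rewrite /ridgelet_integrand.
rewrite (_ : extY (a *: Phi + Phi') (u, b, t) = a * extY Phi (u, b, t) + extY Phi' (u, b, t)).
  by ring.
rewrite /extY; case: insub => [w|//]; first by [].
by rewrite mulr0 addr0.
Qed.

Lemma ridgelet_map_linearr Phi (a : R[i]) psi psi' :
  ridgelet_map Phi (a *: psi + psi') = a *: ridgelet_map Phi psi + ridgelet_map Phi psi'.
Proof.
apply: schwartz0_eq => x.
have i1 := cintegrable_ridgelet x (rPhi Phi) (spsi psi).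
have i2 := cintegrable_ridgelet x (rPhi Phi) (spsi psi').
rewrite ridgelet_mapE -[RHS]/(a * ridgelet_fun psi Phi x + ridgelet_fun psi' Phi x).
rewrite /ridgelet_fun -(cintegral_lin a (@measurable_dom3 R n) i1 i2).2.
congr cintegral; apply/funext => -[[u b] t].
rewrite /ridgelet_integrand.
set y := const_mx _.
rewrite -[(a *: psi + psi') y]/(a * psi y + psi' y).
by ring.
Qed.

End Operator.

(** Open sets are unions of finite intersections of subbasic sets, and neighbourhood filters are
    stable under finite intersections. *)
Lemma subbase_near {X : topologicalType} {T : Type} (f : X -> T) (b : set (set T)) (x : X)
    (U : set T) :
  (forall B, b B -> B (f x) -> \forall y \near x, B (f y)) ->
  (exists2 D, D `<=` finI_from b id & \bigcup_(A in D) A = U) ->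
  U (f x) -> \forall y \near x, U (f y).
Proof.
move=> hb [D Db <-] [A DA Afx].
have [E Eb EA] := Db A DA.
suff : \forall y \near x, A (f y) by apply: filterS => y Ay; exists A.
rewrite -EA; apply: (@filter_bigI _ _ E (fun B => f @^-1` B) (nbhs x)) => B BE.
apply: hb; first by have := Eb B BE; rewrite inE.
by move: Afx; rewrite -EA; apply.
Qed.

(** * Seminorm topologies and joint continuity *)

Section Topologies.
Context {R : realType}.

Lemma lt_ereal_fin (p : \bar R) (e : R) : (p < e%:E)%E -> exists2 M : R, M < e & (p <= M%:E)%E.
Proof.
case: p => [r| |] //; first by rewrite lte_fin => re; exists r.
by move=> _; exists (e - 1); [rewrite ltrBlDr ltrDl|exact: leNye].
Qed.

Lemma schwartz_seminorm_triangle n i (f g h : schwartz R n) (a b : R) :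
  (schwartz_seminorm i (f - g)%R <= a%:E)%E -> (schwartz_seminorm i (g - h)%R <= b%:E)%E ->
  (schwartz_seminorm i (f - h)%R <= (a + b)%:E)%E.
Proof.
move=> /wsup_leP fg /wsup_leP gh; apply/wsup_leP => x.
have S (k : schwartz R n) : csmooth_on setT k := (set_mem (schwartz_funP k)).1.
have -> : schwartz_fun (f - h) = 1 *: schwartz_fun (f - g) + schwartz_fun (g - h).
  apply/funext => y; rewrite scale1r -[RHS]/(f y - g y + (g y - h y)).
  by rewrite -[LHS]/(f y - h y) addrA subrK.
rewrite (pderive_lin i.2 1 (S _) (S _)).2 scale1r.
rewrite -[(_ + _) x]/(pderive i.2 (f - g) x + pderive i.2 (g - h) x).
apply: (le_trans _ (lerD (fg x) (gh x))); rewrite -mulrDr.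
by apply: ler_wpM2l => //; exact: le_normcD.
Qed.

(** A subbasic ball that contains [f x] may have another centre [g]; the gap between its radius and
    the seminorm of [f x - g] leaves room for a ball around [f x]. *)
Lemma schwartz_seminorm_cont n (X : topologicalType) (f : X -> schwartz R n) x :
  (forall i (e : R), 0 < e ->
    \forall y \near x, (schwartz_seminorm i (f y - f x)%R <= e%:E)%E) ->
  {for x, continuous f}.
Proof.
move=> H U; rewrite nbhsE => -[V [oV Vx] VU].
suff : \forall y \near x, V (f y) by apply: filterS => y /VU.
move: Vx; apply: subbase_near oV => B [g [i [e [e0 ->]]]] /= /lt_ereal_fin[M Me hM].
have d0 : 0 < (e - M) / 2 by rewrite divr_gt0 ?subr_gt0.
apply: filterS (H i _ d0) => y hy.
apply: le_lt_trans (schwartz_seminorm_triangle hy hM) _.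
rewrite lte_fin; lra.
Qed.

Lemma schwartz_near n (f : schwartz R n) i (e : R) : 0 < e ->
  \forall g \near f, (schwartz_seminorm i (g - f)%R < e%:E)%E.
Proof.
move=> e0; apply: open_nbhs_nbhs; split.
  exists [set [set g | (schwartz_seminorm i (g - f)%R < e%:E)%E]]; last by rewrite bigcup_set1.
  by move=> _ ->; apply: finI_from1; exists f, i, e.
rewrite /= subrr; apply: (@le_lt_trans _ _ 0%:E); rewrite ?lte_fin//; apply/wsup_leP => x.
have s0 := (@is_schwartz0 R n).1.
have := (pderive_lin i.2 (-1) s0 s0).2.
rewrite !scaleN1r !addNr => E.
rewrite -[pderive i.2 _]/(pderive i.2 0) E.
by rewrite [X in Normc.normc X](_ : _ = 0)// Normc.normc0 mulr0.
Qed.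

Lemma schwartzY_near n (F : schwartzY R n) k s r (e : R) : 0 < e ->
  \forall G \near F, (seminormY (0%N, 0%N, k, s, r) (G - F)%R < e%:E)%E.
Proof.
move=> e0; apply: open_nbhs_nbhs; split.
  exists [set [set G : schwartzY R n | (seminormY (0%N, 0%N, k, s, r) (G - F)%R < e%:E)%E]].
    by move=> _ ->; apply: finI_from1; exists F, (0%N, 0%N, k, s, r), e.
  by rewrite bigcup_set1.
rewrite /= subrr; apply: (@le_lt_trans _ _ 0%:E); rewrite ?lte_fin//; apply/wsup_leP => x.
have s0 := @smoothY0 R n.
have := (lin_on_iter k (@laplace_beltrami_lin R n) (-1) s0 s0).2.
rewrite !scaleN1r !addNr /= => E.
rewrite -[iter k _ _]/(iter k (@laplace_beltrami R n) 0) E.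
by rewrite [X in Normc.normc X](_ : _ = 0)// Normc.normc0 mulr0.
Qed.

End Topologies.

Section Continuity.
Context {R : realType} {n : nat}.
Implicit Types (Phi : schwartzY R n) (psi : schwartz0 R 1).

Lemma ridgelet_map_seminorm_le i : exists N (C : R), 0 <= C /\ forall Phi psi (B1 B2 : R),
  boundedY N Phi B1 -> 0 <= B1 -> (forall c, bounded_family N (real_family c psi) B2) ->
  (schwartz_seminorm i (schwartz0_val (ridgelet_map Phi psi)) <= (C * B1 * B2)%:E)%E.
Proof.
have [N [C [C0 h]]] := @ridgelet_seminorm_le R n i.
exists N, C; split; first exact: C0.
move=> Phi psi B1 B2 b1 B10 b2.
have rPhi : rapidY Phi.
  by apply: rapidY_schwartz; apply/set_mem; exact: (schwartzY_funP Phi).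
exact: (h psi Phi B1 B2 rPhi (fun c => S0_real_family c psi) b1 B10 b2).
Qed.

Lemma near_boundedY Phi N (d : R) : 0 < d ->
  \forall Phi' \near Phi, boundedY N (Phi' - Phi) d.
Proof.
move=> d0.
have := @filter_forall _ ('I_N.+1 * 'I_N.+1 * 'I_N.+1)%type
  (fun t Phi' => (seminormY (0%N, 0%N, val t.1.1, val t.1.2, val t.2) (Phi' - Phi)%R < d%:E)%E)
  (nbhs Phi) (nbhs_filter Phi) (fun t => schwartzY_near Phi t.1.1 t.1.2 t.2 d0).
move=> H'; apply: (filterS _ H') => Phi' h; apply: boundedY_seminorm => k s r kN sN rN; apply/ltW.
exact: (h (Ordinal (kN : k < N.+1)%N, Ordinal (sN : s < N.+1)%N, Ordinal (rN : r < N.+1)%N)).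
Qed.

Lemma near_bounded_family psi N (d : R) : 0 < d ->
  \forall psi' \near psi, forall c, bounded_family N (real_family c (psi' - psi)) d.
Proof.
move=> d0.
have H j k : \forall psi' \near psi,
    (schwartz_seminorm (idx1 j, idx1 k) (schwartz0_val psi' - schwartz0_val psi)%R < d%:E)%E.
  exact: (@initial_continuous _ _ (@schwartz0_val R 1) psi _ (schwartz_near _ _ d0)).
have := @filter_forall _ ('I_N.+1 * 'I_N.+1)%type
  (fun t psi' => (schwartz_seminorm (idx1 (val t.1), idx1 (val t.2))
     (schwartz0_val psi' - schwartz0_val psi)%R < d%:E)%E) (nbhs psi) (nbhs_filter psi) (fun t => H t.1 t.2).
move=> H'; apply: (filterS _ H') => psi' h c; apply: bounded_real_family => j k jN kN; apply/ltW.
exact: (h (Ordinal (jN : j < N.+1)%N, Ordinal (kN : k < N.+1)%N)).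
Qed.

Lemma continuous_ridgelet_map :
  continuous (fun p : schwartzY R n * schwartz0 R 1 => ridgelet_map p.1 p.2).
Proof.
(* [schwartz0] has the initial topology of its embedding, so continuity is tested in [schwartz], one
   seminorm at a time. *)
apply: continuous_comp_initial => -[Phi psi].
apply: schwartz_seminorm_cont => i e e0.
have [N [C [C0 h]]] := ridgelet_map_seminorm_le i.
have [B1 B10 b1] : exists2 B1, 0 <= B1 & boundedY N Phi B1.
  have [M hM] := (rapidY_schwartz (set_mem (schwartzY_funP Phi))).2 N.
  by exists `|M| => // k s r kN sN rN w; rewrite (le_trans _ (ler_norm _))// hM.
have [B2 B20 b2] : exists2 B2, 0 <= B2 & forall c, bounded_family N (real_family c psi) B2.
  have [M1 m1] := rapid_bounded_family N (S0_real_family false psi).1.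
  have [M2 m2] := rapid_bounded_family N (S0_real_family true psi).1.
  exists (Num.max M1 M2); first by rewrite le_max (bounded_family_ge0 m1).
  move=> [] j k jN kN t; rewrite le_max; apply/orP.
    by right; exact: m2.
  by left; exact: m1.
(* The minimum with 1 gives [d^2 <= d]; the denominator collects the constants of the three terms
   below, increased by 1 to be positive. *)
pose d := Num.min 1 (e / (C * (1 + B1 + B2) + 1)).
have D0 : 0 < C * (1 + B1 + B2) + 1 by rewrite ltr_wpDl// mulr_ge0// !addr_ge0.
have d0 : 0 < d by rewrite lt_min ltr01 divr_gt0.
have d1 : d <= 1 by rewrite ge_min lexx.
have de : d * (C * (1 + B1 + B2) + 1) <= e by rewrite -ler_pdivlMr// ge_min lexx orbT.
have h1 := near_boundedY Phi N d0; have h2 := near_bounded_family psi N d0.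
have : \forall p \near (Phi, psi), boundedY N (p.1 - Phi) d /\
    forall c, bounded_family N (real_family c (p.2 - psi)) d.
  by exists ([set Phi' | boundedY N (Phi' - Phi) d],
    [set psi' | forall c, bounded_family N (real_family c (psi' - psi)) d]).
apply: filterS => -[Phi' psi'] /= [hP hp].
have L (A B : schwartzY R n) p : ridgelet_map (A - B) p = ridgelet_map A p - ridgelet_map B p.
  by rewrite addrC -scaleN1r ridgelet_map_linearl scaleN1r addrC.
have L' (A : schwartzY R n) p q : ridgelet_map A (p - q) = ridgelet_map A p - ridgelet_map A q.
  by rewrite addrC -scaleN1r ridgelet_map_linearr scaleN1r addrC.
(* The path through [A1] and the image of [(Phi, psi')] has as increments the images of
   [(Phi' - Phi, psi' - psi)], [(Phi' - Phi, psi)] and [(Phi, psi' - psi)]. *)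
pose A1 := ridgelet_map Phi' psi + (ridgelet_map Phi psi' - ridgelet_map Phi psi).
have t1 : (schwartz_seminorm i (schwartz0_val (ridgelet_map Phi' psi') - schwartz0_val A1)%R <=
    (C * d * d)%:E)%E.
  rewrite -[X in schwartz_seminorm i (schwartz_fun X)]/(schwartz0_val (ridgelet_map Phi' psi' - A1)).
  have -> : ridgelet_map Phi' psi' - A1 = ridgelet_map (Phi' - Phi) (psi' - psi).
    rewrite L' !L /A1; do 4!move: (ridgelet_map _ _) => ?.
    by rewrite !opprD !opprK !addrA; congr (_ + _); exact: addrAC.
  by apply: h => //; exact: ltW.
have t2 : (schwartz_seminorm i (schwartz0_val A1 - schwartz0_val (ridgelet_map Phi psi'))%R <=
    (C * d * B2)%:E)%E.
  rewrite -[X in schwartz_seminorm i (schwartz_fun X)]/(schwartz0_val (A1 - ridgelet_map Phi psi')).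
  have -> : A1 - ridgelet_map Phi psi' = ridgelet_map (Phi' - Phi) psi.
    by rewrite L /A1 -addrA [X in _ + X]addrAC subrr add0r.
  by apply: h => //; exact: ltW.
have t3 : (schwartz_seminorm i
    (schwartz0_val (ridgelet_map Phi psi') - schwartz0_val (ridgelet_map Phi psi))%R <=
    (C * B1 * d)%:E)%E.
  rewrite -[X in schwartz_seminorm i (schwartz_fun X)]
    /(schwartz0_val (ridgelet_map Phi psi' - ridgelet_map Phi psi)).
  by rewrite -L'; exact: h.
apply: (le_trans (schwartz_seminorm_triangle t1 (schwartz_seminorm_triangle t2 t3))).
rewrite lee_fin (le_trans _ de)//.
have dd : C * d * d <= C * d by rewrite ler_piMr// mulr_ge0// ltW.
rewrite (_ : _ * (_ + 1) = C * d + (C * d * B2 + C * B1 * d) + d); last by ring.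
by rewrite -[leLHS]addr0; rewrite lerD ?(ltW d0)// lerD2r.
Qed.

End Continuity.

Theorem theorem4p2 (R : realType) (n : nat) (n_ge2 : (2 <= n)%N) :
  (forall (Phi : schwartzY R n) (psi : schwartz0 R 1) (x : 'rV[R]_n),
     ridgelet_integrable psi Phi x) /\
  exists Rt : schwartzY R n -> schwartz0 R 1 -> schwartz0 R n,
    [/\ forall Phi psi x, Rt Phi psi x = ridgelet_synthesis psi Phi x,
        bilinear_for *:%R *:%R Rt
      & continuous (fun p : schwartzY R n * schwartz0 R 1 => Rt p.1 p.2)].
Proof.
have rPhi (Phi : schwartzY R n) : rapidY Phi.
  by apply: rapidY_schwartz; apply/set_mem; exact: (schwartzY_funP Phi).
split=> [Phi psi x|].
  exact: (cintegrable_ridgelet x (rPhi Phi) (fun c => S0_real_family c psi)).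
exists ridgelet_map; split.
- move=> Phi psi x; rewrite ridgelet_mapE.
  exact: (ridgelet_fun_synthesis x (rPhi Phi) (fun c => S0_real_family c psi)).
- split=> [psi a Phi Phi'|Phi a psi psi']; first exact: ridgelet_map_linearl.
  exact: ridgelet_map_linearr.
- exact: continuous_ridgelet_map.
Qed.
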